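(* For any category $\mathbf{C}$ with pushouts, the structure $2\mathrm{Cosp}(\mathbf{C})$ of double cospans in $\mathbf{C}$ forms a double bicategory.
   Context: DOUBLE BICATEGORY. $\mathbf{Bicat}$ denotes the (mere) category of bicategories and weak 2-functors. A double bicategory is a bicategory internal to $\mathbf{Bicat}$ (a strict model in $\mathbf{Bicat}$ of the theory of bicategories). It consists of bicategories $\mathbf{Obj}$, $\mathbf{Mor}$, $\mathbf{2Mor}$; source and target 2-functors $s,t:\mathbf{Mor}\to\mathbf{Obj}$, $s,t:\mathbf{2Mor}\to\mathbf{Obj}$, $s,t:\mathbf{2Mor}\to\mathbf{Mor}$; identity 2-functors $\mathrm{id}:\mathbf{Obj}\to\mathbf{Mor}$ and $\mathrm{id}:\mathbf{Mor}\to\mathbf{2Mor}$; composition 2-functors $\circ:\mathbf{Mor}\times_{\mathbf{Obj}}\mathbf{Mor}\to\mathbf{Mor}$, $\circ:\mathbf{2Mor}\times_{\mathbf{Mor}}\mathbf{2Mor}\to\mathbf{2Mor}$, $\cdot:\mathbf{2Mor}\times_{\mathbf{Obj}}\mathbf{2Mor}\to\mathbf{2Mor}$ (strict pullbacks) satisfying the interchange law; an associator 2-functor $a:\mathbf{Mor}\times_{\mathbf{Obj}}\mathbf{Mor}\times_{\mathbf{Obj}}\mathbf{Mor}\to\mathbf{2Mor}$ with $s\circ a=\circ\,(\circ\times 1)$, $t\circ a=\circ\,(1\times\circ)$, taking invertible values; and invertible left and right unitors $l,r:\mathbf{Mor}\to\mathbf{2Mor}$ relating $f$ to its composites with identities.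 These satisfy (as equations in $\mathbf{Bicat}$, hence at the level of objects, morphisms and 2-morphisms) the pentagon identity and the unitor laws. COSPANS. A cospan in $\mathbf{C}$ from $X_1$ to $X_2$ is a diagram $X_1\to S\leftarrow X_2$. A cospan map (with fixed ends $X_1,X_2$) is a morphism $S\to S'$ between the middle objects commuting with the maps from $X_1$ and $X_2$. Cospans are composed by pushout: $X_1\to S\leftarrow X_2$ and $X_2\to S'\leftarrow X_3$ compose to $X_1\to S\sqcup_{X_2}S'\leftarrow X_3$ (for a chosen pushout). $\mathrm{Cosp}(\mathbf{C})$ is the bicategory of objects of $\mathbf{C}$, cospans and cospan maps, with associators and unitors given by the universal property. DOUBLE COSPANS. Let $\Lambda$ be the cospan shape $\bullet\to\bullet\leftarrow\bullet$ and let $\Theta$ be the cospan-map shape: two objects $a,b$, and objects $m,m'$, with maps $a\to m\leftarrow b$, $m\to m'$, $a\to m'\leftarrow b$, commuting. $2\mathrm{Cosp}(\mathbf{C})$ has: - $\mathbf{Obj}=\mathrm{Cosp}(\mathbf{C})$. - $\mathbf{Mor}$: objects are cospans in $\mathbf{C}$ (written horizontally); morphisms from $X_1\to S\leftarrow X_2$ to $X_1'\to S'\leftarrow X_2'$ are double cospans, i.e. commuting $3\times3$ diagrams of shape $\Lambda\times\Lambda$ with rows $X_1\to S\leftarrow X_2$, $T_1\to M\leftarrow T_2$, $X_1'\to S'\leftarrow X_2'$ and columns $X_1\to T_1\leftarrow X_1'$, $S\to M\leftarrow S'$, $X_2\to T_2\leftarrow X_2'$; 2-morphisms are cospans of cospan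 maps, i.e. commuting diagrams of shape $\Lambda\times\Theta$ ($\Lambda$ horizontal, $\Theta$ vertical), joining two double cospans with the same top and bottom rows by a map of middle rows. - $\mathbf{2Mor}$: objects are cospan maps in $\mathbf{C}$ (between horizontal cospans); morphisms are cospan maps of cospans, i.e. commuting diagrams of shape $\Theta\times\Lambda$ ($\Theta$ horizontal, $\Lambda$ vertical); 2-morphisms are cospan maps of cospan maps, i.e. commuting diagrams of shape $\Theta\times\Theta$. All composition operations (in both directions) are by pushout; source and target operations are the same as those for cospans (e.g. $s,t:\mathbf{Mor}\to\mathbf{Obj}$ take the left and right columns, and $s,t:\mathbf{2Mor}\to\mathbf{Mor}$ take the two horizontal cospan parts of each cospan map). The associators and unitors in the horizontal and vertical bicategories are the maps coming from the universal property of pushouts. *)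

(* Defs.v *)
From Stdlib Require Import ProofIrrelevance.
From mathcomp Require Import ssreflect ssrfun ssrbool.

Set Implicit Arguments.
Unset Strict Implicit.
Unset Printing Implicit Defensive.
Set Primitive Projections.

(** All compositions of arrows and cells below are in diagrammatic order. *)

Record category := Category {
  ob :> Type;
  hom : ob -> ob -> Type;
  idm : forall x, hom x x;
  comp : forall x y z, hom x y -> hom y z -> hom x z;
  comp1m : forall x y (f : hom x y), comp (idm x) f = f;
  compm1 : forall x y (f : hom x y), comp f (idm y) = f;
  compA : forall w x y z (f : hom w x) (g : hom x y) (h : hom y z),
    comp f (comp g h) = comp (comp f g) h }.

Arguments hom {c} x y.
Arguments idm {c} x.
Arguments comp {c x y z} f g.
Notation "f ;; g" := (comp f g) (at level 50, left associativity).

Record functor (C D : category) := Functor {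
  fob :> C -> D;
  fmap : forall x y : C, hom x y -> hom (fob x) (fob y);
  fmap1 : forall x : C, fmap (idm x) = idm (fob x);
  fmapM : forall (x y z : C) (f : hom x y) (g : hom y z),
    fmap (f ;; g) = fmap f ;; fmap g }.

Record pushouts (C : category) := Pushouts {
  po : forall x a b : C, hom x a -> hom x b -> C;
  inl : forall (x a b : C) (f : hom x a) (g : hom x b), hom a (po f g);
  inr : forall (x a b : C) (f : hom x a) (g : hom x b), hom b (po f g);
  po_comm : forall (x a b : C) (f : hom x a) (g : hom x b),
    f ;; inl f g = g ;; inr f g;
  copair : forall (x a b : C) (f : hom x a) (g : hom x b)
    (z : C) (u : hom a z) (v : hom b z), f ;; u = g ;; v -> hom (po f g) z;
  copair_inl : forall (x a b : C) (f : hom x a) (g : hom x b)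
    (z : C) (u : hom a z) (v : hom b z) (e : f ;; u = g ;; v),
    inl f g ;; copair e = u;
  copair_inr : forall (x a b : C) (f : hom x a) (g : hom x b)
    (z : C) (u : hom a z) (v : hom b z) (e : f ;; u = g ;; v),
    inr f g ;; copair e = v;
  copair_uniq : forall (x a b : C) (f : hom x a) (g : hom x b)
    (z : C) (w w' : hom (po f g) z),
    inl f g ;; w = inl f g ;; w' -> inr f g ;; w = inr f g ;; w' -> w = w' }.

Arguments po {C} P {x a b} f g : rename.
Arguments inl {C} P {x a b} f g : rename.
Arguments inr {C} P {x a b} f g : rename.
Arguments po_comm {C} P {x a b} f g : rename.
Arguments copair {C} P {x a b f g z u v} e : rename.
Arguments copair_inl {C} P {x a b f g z u v} e : rename.
Arguments copair_inr {C} P {x a b f g z u v} e : rename.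
Arguments copair_uniq {C} P {x a b f g z} w w' _ _ : rename.

(** The data of bicategories and weak 2-functors is kept apart from the laws.
    Equality of weak 2-functors, i.e. equality in the category of bicategories,
    is Leibniz equality of their data (objects, 1-cells, 2-cells and coherence
    cells). *)

Record prebicat := Prebicat {
  cell0 :> Type;
  cell1 : cell0 -> cell0 -> Type;
  cell2 : forall x y, cell1 x y -> cell1 x y -> Type;
  id1 : forall x, cell1 x x;
  comp1 : forall x y z, cell1 x y -> cell1 y z -> cell1 x z;
  id2 : forall x y (f : cell1 x y), cell2 f f;
  vcomp : forall x y (f g h : cell1 x y), cell2 f g -> cell2 g h -> cell2 f h;
  hcomp : forall x y z (f f' : cell1 x y) (g g' : cell1 y z),
    cell2 f f' -> cell2 g g' -> cell2 (comp1 f g) (comp1 f' g');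
  assoc : forall w x y z (f : cell1 w x) (g : cell1 x y) (h : cell1 y z),
    cell2 (comp1 (comp1 f g) h) (comp1 f (comp1 g h));
  lunit : forall x y (f : cell1 x y), cell2 (comp1 (id1 x) f) f;
  runit : forall x y (f : cell1 x y), cell2 (comp1 f (id1 y)) f }.

Arguments cell1 {p} x y.
Arguments cell2 {p x y} f g.
Arguments id1 {p} x.
Arguments comp1 {p x y z} f g.
Arguments id2 {p x y} f.
Arguments vcomp {p x y f g h} a b.
Arguments hcomp {p x y z f f' g g'} a b.
Arguments assoc {p w x y z} f g h.
Arguments lunit {p x y} f.
Arguments runit {p x y} f.

Definition iso2 (B : prebicat) (x y : B) (f g : cell1 x y) (a : cell2 f g) :=
  exists b : cell2 g f, vcomp a b = id2 f /\ vcomp b a = id2 g.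

Record is_bicat (B : prebicat) : Prop := IsBicat {
  vcomp1c : forall (x y : B) (f g : cell1 x y) (a : cell2 f g),
    vcomp (id2 f) a = a;
  vcompc1 : forall (x y : B) (f g : cell1 x y) (a : cell2 f g),
    vcomp a (id2 g) = a;
  vcompA : forall (x y : B) (f g h k : cell1 x y)
    (a : cell2 f g) (b : cell2 g h) (c : cell2 h k),
    vcomp a (vcomp b c) = vcomp (vcomp a b) c;
  hcomp_id2 : forall (x y z : B) (f : cell1 x y) (g : cell1 y z),
    hcomp (id2 f) (id2 g) = id2 (comp1 f g);
  hcomp_vcomp : forall (x y z : B) (f f' f'' : cell1 x y)
    (g g' g'' : cell1 y z) (a : cell2 f f') (a' : cell2 f' f'')
    (b : cell2 g g') (b' : cell2 g' g''),
    hcomp (vcomp a a') (vcomp b b') = vcomp (hcomp a b) (hcomp a' b');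
  assoc_nat : forall (w x y z : B) (f f' : cell1 w x) (g g' : cell1 x y)
    (h h' : cell1 y z) (a : cell2 f f') (b : cell2 g g') (c : cell2 h h'),
    vcomp (hcomp (hcomp a b) c) (assoc f' g' h')
    = vcomp (assoc f g h) (hcomp a (hcomp b c));
  lunit_nat : forall (x y : B) (f f' : cell1 x y) (a : cell2 f f'),
    vcomp (hcomp (id2 (id1 x)) a) (lunit f') = vcomp (lunit f) a;
  runit_nat : forall (x y : B) (f f' : cell1 x y) (a : cell2 f f'),
    vcomp (hcomp a (id2 (id1 y))) (runit f') = vcomp (runit f) a;
  assoc_iso : forall (w x y z : B)
    (f : cell1 w x) (g : cell1 x y) (h : cell1 y z), iso2 (assoc f g h);
  lunit_iso : forall (x y : B) (f : cell1 x y), iso2 (lunit f);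
  runit_iso : forall (x y : B) (f : cell1 x y), iso2 (runit f);
  pentagon : forall (v w x y z : B) (f : cell1 v w) (g : cell1 w x)
    (h : cell1 x y) (k : cell1 y z),
    vcomp (vcomp (hcomp (assoc f g h) (id2 k)) (assoc f (comp1 g h) k))
          (hcomp (id2 f) (assoc g h k))
    = vcomp (assoc (comp1 f g) h k) (assoc f g (comp1 h k));
  triangle : forall (x y z : B) (f : cell1 x y) (g : cell1 y z),
    vcomp (assoc f (id1 y) g) (hcomp (id2 f) (lunit g))
    = hcomp (runit f) (id2 g) }.

Record prefun (A B : prebicat) := Prefun {
  f0 :> A -> B;
  f1 : forall x y : A, cell1 x y -> cell1 (f0 x) (f0 y);
  f2 : forall (x y : A) (f g : cell1 x y), cell2 f g -> cell2 (f1 f) (f1 g);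
  fid : forall x : A, cell2 (id1 (f0 x)) (f1 (id1 x));
  fcomp : forall (x y z : A) (f : cell1 x y) (g : cell1 y z),
    cell2 (comp1 (f1 f) (f1 g)) (f1 (comp1 f g)) }.

Arguments f1 {A B} F {x y} f : rename.
Arguments f2 {A B} F {x y f g} a : rename.
Arguments fid {A B} F x : rename.
Arguments fcomp {A B} F {x y z} f g : rename.

Record is_weak_functor (A B : prebicat) (F : prefun A B) : Prop :=
  IsWeakFunctor {
  f2_id2 : forall (x y : A) (f : cell1 x y), f2 F (id2 f) = id2 (f1 F f);
  f2_vcomp : forall (x y : A) (f g h : cell1 x y)
    (a : cell2 f g) (b : cell2 g h),
    f2 F (vcomp a b) = vcomp (f2 F a) (f2 F b);
  fcomp_nat : forall (x y z : A) (f f' : cell1 x y) (g g' : cell1 y z)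
    (a : cell2 f f') (b : cell2 g g'),
    vcomp (hcomp (f2 F a) (f2 F b)) (fcomp F f' g')
    = vcomp (fcomp F f g) (f2 F (hcomp a b));
  fid_iso : forall x : A, iso2 (fid F x);
  fcomp_iso : forall (x y z : A) (f : cell1 x y) (g : cell1 y z),
    iso2 (fcomp F f g);
  fcomp_assoc : forall (w x y z : A)
    (f : cell1 w x) (g : cell1 x y) (h : cell1 y z),
    vcomp (vcomp (hcomp (fcomp F f g) (id2 (f1 F h))) (fcomp F (comp1 f g) h))
          (f2 F (assoc f g h))
    = vcomp (assoc (f1 F f) (f1 F g) (f1 F h))
            (vcomp (hcomp (id2 (f1 F f)) (fcomp F g h))
                   (fcomp F f (comp1 g h)));
  fcomp_lunit : forall (x y : A) (f : cell1 x y),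
    vcomp (vcomp (hcomp (fid F x) (id2 (f1 F f))) (fcomp F (id1 x) f))
          (f2 F (lunit f))
    = lunit (f1 F f);
  fcomp_runit : forall (x y : A) (f : cell1 x y),
    vcomp (vcomp (hcomp (id2 (f1 F f)) (fid F y)) (fcomp F f (id1 y)))
          (f2 F (runit f))
    = runit (f1 F f) }.

Definition pid (A : prebicat) : prefun A A :=
  @Prefun A A (fun x => x) (fun _ _ f => f) (fun _ _ _ _ a => a)
    (fun x => id2 (id1 x)) (fun _ _ _ f g => id2 (comp1 f g)).

Definition pcomp (A B C : prebicat) (G : prefun B C) (F : prefun A B) :
    prefun A C :=
  @Prefun A C (fun x => G (F x)) (fun _ _ f => f1 G (f1 F f))
    (fun _ _ _ _ a => f2 G (f2 F a))
    (fun x => vcomp (fid G (F x)) (f2 G (fid F x)))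
    (fun _ _ _ f g => vcomp (fcomp G (f1 F f) (f1 F g)) (f2 G (fcomp F f g))).

Notation "G ∘ F" := (pcomp G F) (at level 40, left associativity).

(** Strict (1-categorical) pullbacks in the category of bicategories and weak
    2-functors. *)

Definition is_pullback (P A B C : prebicat) (p : prefun P A) (q : prefun P B)
    (f : prefun A C) (g : prefun B C) : Prop :=
  f ∘ p = g ∘ q /\
  forall (T : prebicat) (u : prefun T A) (v : prefun T B),
    is_bicat T -> is_weak_functor u -> is_weak_functor v -> f ∘ u = g ∘ v ->
    exists! w : prefun T P, [/\ is_weak_functor w, p ∘ w = u & q ∘ w = v].

Definition is_triple_pullback (P A B C D E : prebicat)
    (p : prefun P A) (q : prefun P B) (r : prefun P C)
    (f : prefun A D) (g : prefun B D) (h : prefun B E) (k : prefun C E)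
    : Prop :=
  [/\ f ∘ p = g ∘ q, h ∘ q = k ∘ r &
  forall (T : prebicat) (u : prefun T A) (v : prefun T B) (w : prefun T C),
    is_bicat T -> is_weak_functor u -> is_weak_functor v ->
    is_weak_functor w -> f ∘ u = g ∘ v -> h ∘ v = k ∘ w ->
    exists! x : prefun T P,
      [/\ is_weak_functor x, p ∘ x = u, q ∘ x = v & r ∘ x = w]].

(** A double bicategory is a bicategory internal to the category of
    bicategories and weak 2-functors: the structure below consists of the
    operations of the theory of bicategories, together with the pullbacks on
    which they are defined; [is_double_bicat] states that everything lives in
    that category, that the pullbacks are pullbacks there, and that the
    equations of the theory hold. *)

Record double_bicat_data := DoubleBicatData {
  Obj : prebicat;
  Mor : prebicat;
  TwoMor : prebicat;
  srcM : prefun Mor Obj;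
  tgtM : prefun Mor Obj;
  srcO : prefun TwoMor Obj;
  tgtO : prefun TwoMor Obj;
  srcT : prefun TwoMor Mor;
  tgtT : prefun TwoMor Mor;
  idO : prefun Obj Mor;
  idM : prefun Mor TwoMor;
  MorMor : prebicat;                        (* Mor x_Obj Mor *)
  mm1 : prefun MorMor Mor;
  mm2 : prefun MorMor Mor;
  compM : prefun MorMor Mor;
  TwoVert : prebicat;                       (* TwoMor x_Mor TwoMor *)
  vv1 : prefun TwoVert TwoMor;
  vv2 : prefun TwoVert TwoMor;
  compV : prefun TwoVert TwoMor;
  TwoHoriz : prebicat;                      (* TwoMor x_Obj TwoMor *)
  hh1 : prefun TwoHoriz TwoMor;
  hh2 : prefun TwoHoriz TwoMor;
  compH : prefun TwoHoriz TwoMor;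
  MorMorMor : prebicat;                     (* Mor x_Obj Mor x_Obj Mor *)
  mmm1 : prefun MorMorMor Mor;
  mmm2 : prefun MorMorMor Mor;
  mmm3 : prefun MorMorMor Mor;
  assocM : prefun MorMorMor TwoMor;
  lunitM : prefun Mor TwoMor;
  runitM : prefun Mor TwoMor }.

Section GeneralizedElements.

(** Equations between maps out of iterated pullbacks are expressed on
    generalized elements, i.e. weak 2-functors out of an arbitrary bicategory
    [T]; taking for [T] the iterated pullback with its projections gives back
    the equation of 2-functors itself.  Each predicate below describes the
    graph of an operation, including composability of its arguments. *)

Variables (D : double_bicat_data) (T : prebicat).

Definition is_compM (f g h : prefun T (Mor D)) : Prop :=
  exists u : prefun T (MorMor D),
    [/\ is_weak_functor u, mm1 D ∘ u = f, mm2 D ∘ u = g & compM D ∘ u = h].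

Definition is_compV (a b c : prefun T (TwoMor D)) : Prop :=
  exists u : prefun T (TwoVert D),
    [/\ is_weak_functor u, vv1 D ∘ u = a, vv2 D ∘ u = b & compV D ∘ u = c].

Definition is_compH (a b c : prefun T (TwoMor D)) : Prop :=
  exists u : prefun T (TwoHoriz D),
    [/\ is_weak_functor u, hh1 D ∘ u = a, hh2 D ∘ u = b & compH D ∘ u = c].

Definition is_assocM (f g h : prefun T (Mor D)) (a : prefun T (TwoMor D))
    : Prop :=
  exists u : prefun T (MorMorMor D),
    [/\ is_weak_functor u, mmm1 D ∘ u = f, mmm2 D ∘ u = g, mmm3 D ∘ u = h
      & assocM D ∘ u = a].

Definition vsquare (a b c d : prefun T (TwoMor D)) : Prop :=
  exists2 e, is_compV a b e & is_compV c d e.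

Definition invertible (a : prefun T (TwoMor D)) : Prop :=
  exists b : prefun T (TwoMor D),
    [/\ is_weak_functor b, is_compV a b (idM D ∘ (srcT D ∘ a))
      & is_compV b a (idM D ∘ (tgtT D ∘ a))].

End GeneralizedElements.

Record is_double_bicat (D : double_bicat_data) : Prop := IsDoubleBicat {
  Obj_bicat : is_bicat (Obj D);
  Mor_bicat : is_bicat (Mor D);
  TwoMor_bicat : is_bicat (TwoMor D);
  MorMor_bicat : is_bicat (MorMor D);
  TwoVert_bicat : is_bicat (TwoVert D);
  TwoHoriz_bicat : is_bicat (TwoHoriz D);
  MorMorMor_bicat : is_bicat (MorMorMor D);
  srcM_wf : is_weak_functor (srcM D);
  tgtM_wf : is_weak_functor (tgtM D);
  srcO_wf : is_weak_functor (srcO D);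
  tgtO_wf : is_weak_functor (tgtO D);
  srcT_wf : is_weak_functor (srcT D);
  tgtT_wf : is_weak_functor (tgtT D);
  idO_wf : is_weak_functor (idO D);
  idM_wf : is_weak_functor (idM D);
  mm1_wf : is_weak_functor (mm1 D);
  mm2_wf : is_weak_functor (mm2 D);
  compM_wf : is_weak_functor (compM D);
  vv1_wf : is_weak_functor (vv1 D);
  vv2_wf : is_weak_functor (vv2 D);
  compV_wf : is_weak_functor (compV D);
  hh1_wf : is_weak_functor (hh1 D);
  hh2_wf : is_weak_functor (hh2 D);
  compH_wf : is_weak_functor (compH D);
  mmm1_wf : is_weak_functor (mmm1 D);
  mmm2_wf : is_weak_functor (mmm2 D);
  mmm3_wf : is_weak_functor (mmm3 D);
  assocM_wf : is_weak_functor (assocM D);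
  lunitM_wf : is_weak_functor (lunitM D);
  runitM_wf : is_weak_functor (runitM D);

  MorMor_pb : is_pullback (mm1 D) (mm2 D) (tgtM D) (srcM D);
  TwoVert_pb : is_pullback (vv1 D) (vv2 D) (tgtT D) (srcT D);
  TwoHoriz_pb : is_pullback (hh1 D) (hh2 D) (tgtO D) (srcO D);
  MorMorMor_pb : is_triple_pullback (mmm1 D) (mmm2 D) (mmm3 D)
    (tgtM D) (srcM D) (tgtM D) (srcM D);

  srcO_srcT : srcO D = srcM D ∘ srcT D;
  srcO_tgtT : srcO D = srcM D ∘ tgtT D;
  tgtO_srcT : tgtO D = tgtM D ∘ srcT D;
  tgtO_tgtT : tgtO D = tgtM D ∘ tgtT D;
  srcM_idO : srcM D ∘ idO D = pid (Obj D);
  tgtM_idO : tgtM D ∘ idO D = pid (Obj D);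
  srcT_idM : srcT D ∘ idM D = pid (Mor D);
  tgtT_idM : tgtT D ∘ idM D = pid (Mor D);
  srcM_compM : srcM D ∘ compM D = srcM D ∘ mm1 D;
  tgtM_compM : tgtM D ∘ compM D = tgtM D ∘ mm2 D;
  srcT_compV : srcT D ∘ compV D = srcT D ∘ vv1 D;
  tgtT_compV : tgtT D ∘ compV D = tgtT D ∘ vv2 D;
  srcT_compH : is_compM (srcT D ∘ hh1 D) (srcT D ∘ hh2 D) (srcT D ∘ compH D);
  tgtT_compH : is_compM (tgtT D ∘ hh1 D) (tgtT D ∘ hh2 D) (tgtT D ∘ compH D);
  srcT_assocM : forall (T : prebicat) (f g h fg fgh : prefun T (Mor D))
    (a : prefun T (TwoMor D)), is_bicat T ->
    is_assocM f g h a -> is_compM f g fg -> is_compM fg h fgh ->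
    srcT D ∘ a = fgh;
  tgtT_assocM : forall (T : prebicat) (f g h gh fgh : prefun T (Mor D))
    (a : prefun T (TwoMor D)), is_bicat T ->
    is_assocM f g h a -> is_compM g h gh -> is_compM f gh fgh ->
    tgtT D ∘ a = fgh;
  srcT_lunitM : is_compM (idO D ∘ srcM D) (pid (Mor D)) (srcT D ∘ lunitM D);
  tgtT_lunitM : tgtT D ∘ lunitM D = pid (Mor D);
  srcT_runitM : is_compM (pid (Mor D)) (idO D ∘ tgtM D) (srcT D ∘ runitM D);
  tgtT_runitM : tgtT D ∘ runitM D = pid (Mor D);

  compV_id_l : is_compV (idM D ∘ srcT D) (pid (TwoMor D)) (pid (TwoMor D));
  compV_id_r : is_compV (pid (TwoMor D)) (idM D ∘ tgtT D) (pid (TwoMor D));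
  compV_assoc : forall (T : prebicat) (a b c ab bc : prefun T (TwoMor D)),
    is_bicat T -> is_compV a b ab -> is_compV b c bc -> vsquare a bc ab c;

  compH_id : forall (T : prebicat) (f g h : prefun T (Mor D)), is_bicat T ->
    is_compM f g h -> is_compH (idM D ∘ f) (idM D ∘ g) (idM D ∘ h);
  interchange : forall (T : prebicat)
    (a a' b b' aa' bb' ab a'b' : prefun T (TwoMor D)), is_bicat T ->
    is_compV a a' aa' -> is_compV b b' bb' ->
    is_compH a b ab -> is_compH a' b' a'b' ->
    exists2 c, is_compH aa' bb' c & is_compV ab a'b' c;

  assocM_nat : forall (T : prebicat)
    (a b c ab bc ab_c a_bc as_ at_ : prefun T (TwoMor D)), is_bicat T ->
    is_compH a b ab -> is_compH ab c ab_c ->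
    is_compH b c bc -> is_compH a bc a_bc ->
    is_assocM (srcT D ∘ a) (srcT D ∘ b) (srcT D ∘ c) as_ ->
    is_assocM (tgtT D ∘ a) (tgtT D ∘ b) (tgtT D ∘ c) at_ ->
    vsquare ab_c at_ as_ a_bc;
  lunitM_nat : forall x : prefun (TwoMor D) (TwoMor D),
    is_compH (idM D ∘ (idO D ∘ srcO D)) (pid (TwoMor D)) x ->
    vsquare x (lunitM D ∘ tgtT D) (lunitM D ∘ srcT D) (pid (TwoMor D));
  runitM_nat : forall x : prefun (TwoMor D) (TwoMor D),
    is_compH (pid (TwoMor D)) (idM D ∘ (idO D ∘ tgtO D)) x ->
    vsquare x (runitM D ∘ tgtT D) (runitM D ∘ srcT D) (pid (TwoMor D));
  assocM_inv : invertible (assocM D);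
  lunitM_inv : invertible (lunitM D);
  runitM_inv : invertible (runitM D);

  pentagonM : forall (T : prebicat) (f g h k fg gh hk : prefun T (Mor D))
    (a1 a2 a3 a4 a5 a1k fa3 a1a2 : prefun T (TwoMor D)), is_bicat T ->
    is_compM f g fg -> is_compM g h gh -> is_compM h k hk ->
    is_assocM f g h a1 -> is_assocM f gh k a2 -> is_assocM g h k a3 ->
    is_assocM fg h k a4 -> is_assocM f g hk a5 ->
    is_compH a1 (idM D ∘ k) a1k -> is_compH (idM D ∘ f) a3 fa3 ->
    is_compV a1k a2 a1a2 -> vsquare a1a2 fa3 a4 a5;
  triangleM : forall (T : prebicat) (f g : prefun T (Mor D))
    (a x y : prefun T (TwoMor D)), is_bicat T ->
    is_assocM f (idO D ∘ (tgtM D ∘ f)) g a ->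
    is_compH (idM D ∘ f) (lunitM D ∘ g) x ->
    is_compH (runitM D ∘ f) (idM D ∘ g) y ->
    is_compV a x y }.

Section Cospans.

Variable C : category.

Record cospan (x y : C) := Cospan {
  apex : C;
  legl : hom x apex;
  legr : hom y apex }.

Record cospan_map (x y : C) (f g : cospan x y) := CospanMap {
  cmap :> hom (apex f) (apex g);
  cmap_l : legl f ;; cmap = legl g;
  cmap_r : legr f ;; cmap = legr g }.

Lemma cospan_map_ext (x y : C) (f g : cospan x y) (a b : cospan_map f g) :
  cmap a = cmap b -> a = b.
Proof.
case: a => a al ar; case: b => b bl br /= e; subst b.
by rewrite (proof_irrelevance _ al bl) (proof_irrelevance _ ar br).
Qed.

Definition cospan_id (x : C) : cospan x x := Cospan (idm x) (idm x).

Lemma cmap_id_l (x y : C) (f : cospan x y) : legl f ;; idm (apex f) = legl f.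
Proof. exact: compm1. Qed.

Lemma cmap_id_r (x y : C) (f : cospan x y) : legr f ;; idm (apex f) = legr f.
Proof. exact: compm1. Qed.

Definition cospan_map_id (x y : C) (f : cospan x y) : cospan_map f f :=
  CospanMap (cmap_id_l f) (cmap_id_r f).

Lemma cmap_comp_l (x y : C) (f g h : cospan x y)
    (a : cospan_map f g) (b : cospan_map g h) : legl f ;; (a ;; b) = legl h.
Proof. by rewrite compA !cmap_l. Qed.

Lemma cmap_comp_r (x y : C) (f g h : cospan x y)
    (a : cospan_map f g) (b : cospan_map g h) : legr f ;; (a ;; b) = legr h.
Proof. by rewrite compA !cmap_r. Qed.

Definition cospan_map_comp (x y : C) (f g h : cospan x y)
    (a : cospan_map f g) (b : cospan_map g h) : cospan_map f h :=
  CospanMap (cmap_comp_l a b) (cmap_comp_r a b).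

(** A map of cospans whose ends are allowed to vary along [u] and [v]. *)
Record square (x y x' y' : C) (u : hom x x') (v : hom y y')
    (f : cospan x y) (g : cospan x' y') := Square {
  smap :> hom (apex f) (apex g);
  smap_l : legl f ;; smap = u ;; legl g;
  smap_r : legr f ;; smap = v ;; legr g }.

Definition square_id (x y : C) (f : cospan x y) :
  square (idm x) (idm y) f f.
Proof. by exists (idm (apex f)); rewrite comp1m compm1. Defined.

Definition square_comp (x y x' y' x'' y'' : C)
    (u : hom x x') (v : hom y y') (u' : hom x' x'') (v' : hom y' y'')
    (f : cospan x y) (g : cospan x' y') (h : cospan x'' y'')
    (s : square u v f g) (t : square u' v' g h) :
  square (u ;; u') (v ;; v') f h.
Proof.
exists (s ;; t).
- by rewrite compA smap_l -compA smap_l compA.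
- by rewrite compA smap_r -compA smap_r compA.
Defined.

Definition square_of_id (x x' : C) (u : hom x x') :
  square u u (cospan_id x) (cospan_id x').
Proof. by exists u; rewrite comp1m compm1. Defined.

Variable P : pushouts C.

Definition cospan_comp (x y z : C) (f : cospan x y) (g : cospan y z) :
    cospan x z :=
  Cospan (legl f ;; inl P (legr f) (legl g)) (legr g ;; inr P (legr f) (legl g)).

Lemma square_hcomp_comm (x y z x' y' z' : C)
    (u : hom x x') (v : hom y y') (w : hom z z')
    (f : cospan x y) (f' : cospan x' y') (g : cospan y z) (g' : cospan y' z')
    (s : square u v f f') (t : square v w g g') :
  legr f ;; (s ;; inl P (legr f') (legl g'))
  = legl g ;; (t ;; inr P (legr f') (legl g')).
Proof. by rewrite !compA smap_r smap_l -!compA po_comm. Qed.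

Definition square_hcomp (x y z x' y' z' : C)
    (u : hom x x') (v : hom y y') (w : hom z z')
    (f : cospan x y) (f' : cospan x' y') (g : cospan y z) (g' : cospan y' z')
    (s : square u v f f') (t : square v w g g') :
  square u w (cospan_comp f g) (cospan_comp f' g').
Proof.
exists (copair P (square_hcomp_comm s t)).
- by rewrite /= -compA copair_inl !compA smap_l.
- by rewrite /= -compA copair_inr !compA smap_r.
Defined.

Lemma cospan_map_hcomp_comm (x y z : C)
    (f f' : cospan x y) (g g' : cospan y z)
    (a : cospan_map f f') (b : cospan_map g g') :
  legr f ;; (a ;; inl P (legr f') (legl g'))
  = legl g ;; (b ;; inr P (legr f') (legl g')).
Proof. by rewrite !compA cmap_r cmap_l po_comm. Qed.

Definition cospan_map_hcomp (x y z : C) (f f' : cospan x y) (g g' : cospan y z)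
    (a : cospan_map f f') (b : cospan_map g g') :
  cospan_map (cospan_comp f g) (cospan_comp f' g').
Proof.
exists (copair P (cospan_map_hcomp_comm a b)).
- by rewrite /= -compA copair_inl compA cmap_l.
- by rewrite /= -compA copair_inr compA cmap_r.
Defined.

Section Associator.

Variables (w x y z : C) (f : cospan w x) (g : cospan x y) (h : cospan y z).

Let fg := cospan_comp f g.
Let gh := cospan_comp g h.

Lemma cospan_assoc_comm1 :
  legr f ;; inl P (legr f) (legl gh)
  = legl g ;; (inl P (legr g) (legl h) ;; inr P (legr f) (legl gh)).
Proof. by rewrite compA po_comm. Qed.

Lemma cospan_assoc_comm2 :
  legr fg ;; copair P cospan_assoc_comm1
  = legl h ;; (inr P (legr g) (legl h) ;; inr P (legr f) (legl gh)).
Proof. by rewrite /= -compA copair_inr !compA po_comm. Qed.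

Definition cospan_assoc :
  cospan_map (cospan_comp fg h) (cospan_comp f gh).
Proof.
exists (copair P cospan_assoc_comm2).
- by rewrite /= -!compA copair_inl copair_inl.
- by rewrite /= -!compA copair_inr.
Defined.

End Associator.

Lemma cospan_lunit_comm (x y : C) (f : cospan x y) :
  legr (cospan_id x) ;; legl f = legl f ;; idm (apex f).
Proof. by rewrite comp1m compm1. Qed.

Definition cospan_lunit (x y : C) (f : cospan x y) :
  cospan_map (cospan_comp (cospan_id x) f) f.
Proof.
exists (copair P (cospan_lunit_comm f)).
- by rewrite /= comp1m copair_inl.
- by rewrite /= -compA copair_inr compm1.
Defined.

Lemma cospan_runit_comm (x y : C) (f : cospan x y) :
  legr f ;; idm (apex f) = legl (cospan_id y) ;; legr f.
Proof. by rewrite comp1m compm1. Qed.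

Definition cospan_runit (x y : C) (f : cospan x y) :
  cospan_map (cospan_comp f (cospan_id y)) f.
Proof.
exists (copair P (cospan_runit_comm f)).
- by rewrite /= -compA copair_inl compm1.
- by rewrite /= comp1m copair_inr.
Defined.

Definition Cosp : prebicat :=
  @Prebicat C cospan cospan_map cospan_id cospan_comp cospan_map_id
    cospan_map_comp cospan_map_hcomp cospan_assoc cospan_lunit cospan_runit.

End Cospans.

Arguments Cospan {C x y} apex legl legr.

(** The action on cospans of a functor [F].  The comparison cell
    [F f ⊔ F g -> F (f ⊔ g)] is the one given by the universal property; it is
    invertible exactly when [F] preserves the pushouts involved. *)

Section CospFunctor.

Variables (C D : category) (F : functor C D).
Variables (P : pushouts C) (Q : pushouts D).

Definition map_cospan (x y : C) (f : cospan x y) : cospan (F x) (F y) :=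
  Cospan (F (apex f)) (fmap F (legl f)) (fmap F (legr f)).

Definition map_cospan_map (x y : C) (f g : cospan x y) (a : cospan_map f g) :
  cospan_map (map_cospan f) (map_cospan g).
Proof. by exists (fmap F a); rewrite /= -fmapM ?cmap_l ?cmap_r. Defined.

Definition map_cospan_id (x : C) :
  cospan_map (cospan_id (F x)) (map_cospan (cospan_id x)).
Proof. by exists (idm (F x)); rewrite /= compm1 fmap1. Defined.

Lemma map_cospan_comm (x y z : C) (f : cospan x y) (g : cospan y z) :
  legr (map_cospan f) ;; fmap F (inl P (legr f) (legl g))
  = legl (map_cospan g) ;; fmap F (inr P (legr f) (legl g)).
Proof. by rewrite /= -!fmapM po_comm. Qed.

Definition map_cospan_comp (x y z : C) (f : cospan x y) (g : cospan y z) :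
  cospan_map (cospan_comp Q (map_cospan f) (map_cospan g))
             (map_cospan (cospan_comp P f g)).
Proof.
exists (copair Q (map_cospan_comm f g)).
- by rewrite /= -compA copair_inl fmapM.
- by rewrite /= -compA copair_inr fmapM.
Defined.

Definition Cosp_functor : prefun (Cosp P) (Cosp Q) :=
  @Prefun (Cosp P) (Cosp Q) F map_cospan map_cospan_map
    map_cospan_id map_cospan_comp.

End CospFunctor.

(** [row_cat] and [cell_cat] are the categories of diagrams of the shapes of
    cospans and of maps of cospans with common ends.  A cospan in [row_cat] is
    a commuting 3x3 diagram, i.e. a double cospan, whose top and bottom rows
    are its ends, and a map of such cospans is a cospan of cospan maps; hence
    the objects, 1-cells and 2-cells of [Cosp (row_po P)] are the cospans,
    double cospans and cospans of cospan maps in [C].  Likewise those of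
    [Cosp (cell_po P)] are the cospan maps, the cospan maps of cospans and the
    cospan maps of cospan maps.  The remaining categories consist of two or
    three adjacent such diagrams: [row2_cat] and [row3_cat] are the strict
    iterated pullbacks of [row_cat] over [C]; [vcells_cat] and [hcells_cat] are
    the strict pullbacks of [cell_cat] with itself over [row_cat] and [C].
    Pushouts in all of them are computed pointwise from those of [C]. *)

Section Diagrams.

Variable C : category.

Lemma square_ext (x y x' y' : C) (u : hom x x') (v : hom y y')
    (f : cospan x y) (g : cospan x' y') (s t : square u v f g) :
  smap s = smap t -> s = t.
Proof.
case: s => s sl sr; case: t => t tl tr /= e; subst t.
by rewrite (proof_irrelevance _ sl tl) (proof_irrelevance _ sr tr).
Qed.

Record twocell (x y : C) := Twocell {
  csrc : cospan x y;
  ctgt : cospan x y;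
  cmor : cospan_map csrc ctgt }.

Record tsquare (x y x' y' : C) (u : hom x x') (v : hom y y')
    (a : twocell x y) (b : twocell x' y') := Tsquare {
  sqs : square u v (csrc a) (csrc b);
  sqt : square u v (ctgt a) (ctgt b);
  sqc : cmor a ;; sqt = sqs ;; cmor b }.

Lemma tsquare_ext (x y x' y' : C) (u : hom x x') (v : hom y y')
    (a : twocell x y) (b : twocell x' y') (s t : tsquare u v a b) :
  smap (sqs s) = smap (sqs t) -> smap (sqt s) = smap (sqt t) -> s = t.
Proof.
case: s => s s' sc; case: t => t t' tc /= /square_ext e /square_ext e'.
by subst t t'; rewrite (proof_irrelevance _ sc tc).
Qed.

Definition tsquare_id (x y : C) (a : twocell x y) :
  tsquare (idm x) (idm y) a a.
Proof.
by exists (square_id (csrc a)) (square_id (ctgt a)); rewrite /= comp1m compm1.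
Defined.

Definition tsquare_comp (x y x' y' x'' y'' : C)
    (u : hom x x') (v : hom y y') (u' : hom x' x'') (v' : hom y' y'')
    (a : twocell x y) (b : twocell x' y') (c : twocell x'' y'')
    (s : tsquare u v a b) (t : tsquare u' v' b c) :
  tsquare (u ;; u') (v ;; v') a c.
Proof.
exists (square_comp (sqs s) (sqs t)) (square_comp (sqt s) (sqt t)).
by rewrite /= compA sqc -compA sqc compA.
Defined.

Record twopath (x y : C) := Twopath {
  pth0 : cospan x y;
  pth1 : cospan x y;
  pth2 : cospan x y;
  pth01 : cospan_map pth0 pth1;
  pth12 : cospan_map pth1 pth2 }.

Record psquare (x y x' y' : C) (u : hom x x') (v : hom y y')
    (a : twopath x y) (b : twopath x' y') := Psquare {
  psq0 : square u v (pth0 a) (pth0 b);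
  psq1 : square u v (pth1 a) (pth1 b);
  psq2 : square u v (pth2 a) (pth2 b);
  psq01 : pth01 a ;; psq1 = psq0 ;; pth01 b;
  psq12 : pth12 a ;; psq2 = psq1 ;; pth12 b }.

Lemma psquare_ext (x y x' y' : C) (u : hom x x') (v : hom y y')
    (a : twopath x y) (b : twopath x' y') (s t : psquare u v a b) :
  smap (psq0 s) = smap (psq0 t) -> smap (psq1 s) = smap (psq1 t) ->
  smap (psq2 s) = smap (psq2 t) -> s = t.
Proof.
case: s => s s' s'' sc sc'; case: t => t t' t'' tc tc' /=.
move=> /square_ext e /square_ext e' /square_ext e''; subst t t' t''.
by rewrite (proof_irrelevance _ sc tc) (proof_irrelevance _ sc' tc').
Qed.

Definition psquare_id (x y : C) (a : twopath x y) :
  psquare (idm x) (idm y) a a.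
Proof.
by exists (square_id (pth0 a)) (square_id (pth1 a)) (square_id (pth2 a));
  rewrite /= comp1m compm1.
Defined.

Definition psquare_comp (x y x' y' x'' y'' : C)
    (u : hom x x') (v : hom y y') (u' : hom x' x'') (v' : hom y' y'')
    (a : twopath x y) (b : twopath x' y') (c : twopath x'' y'')
    (s : psquare u v a b) (t : psquare u' v' b c) :
  psquare (u ;; u') (v ;; v') a c.
Proof.
exists (square_comp (psq0 s) (psq0 t)) (square_comp (psq1 s) (psq1 t))
  (square_comp (psq2 s) (psq2 t)).
- by rewrite /= compA psq01 -compA psq01 compA.
- by rewrite /= compA psq12 -compA psq12 compA.
Defined.

Record row := Row { row_l : C; row_r : C; row_c : cospan row_l row_r }.

Record row_map (A B : row) := RowMap {
  rm_l : hom (row_l A) (row_l B);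
  rm_r : hom (row_r A) (row_r B);
  rm_c : square rm_l rm_r (row_c A) (row_c B) }.

Lemma row_map_ext (A B : row) (f g : row_map A B) :
  rm_l f = rm_l g -> rm_r f = rm_r g -> smap (rm_c f) = smap (rm_c g) -> f = g.
Proof.
case: f => u v s; case: g => u' v' s' /= e1 e2; subst u' v'.
by move=> /square_ext ->.
Qed.

Definition row_map_id (A : row) : row_map A A := RowMap (square_id (row_c A)).
Definition row_map_comp (A B D : row) (f : row_map A B) (g : row_map B D) :
  row_map A D := RowMap (square_comp (rm_c f) (rm_c g)).

Definition row_cat : category.
Proof.
exists row row_map row_map_id row_map_comp => *; apply: row_map_ext => /=;
  by rewrite ?comp1m ?compm1 ?compA.
Defined.

Record row2 := Row2 {
  row2_1 : C; row2_2 : C; row2_3 : C;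
  row2_12 : cospan row2_1 row2_2;
  row2_23 : cospan row2_2 row2_3 }.

Record row2_map (A B : row2) := Row2Map {
  rm2_1 : hom (row2_1 A) (row2_1 B);
  rm2_2 : hom (row2_2 A) (row2_2 B);
  rm2_3 : hom (row2_3 A) (row2_3 B);
  rm2_12 : square rm2_1 rm2_2 (row2_12 A) (row2_12 B);
  rm2_23 : square rm2_2 rm2_3 (row2_23 A) (row2_23 B) }.

Lemma row2_map_ext (A B : row2) (f g : row2_map A B) :
  rm2_1 f = rm2_1 g -> rm2_2 f = rm2_2 g -> rm2_3 f = rm2_3 g ->
  smap (rm2_12 f) = smap (rm2_12 g) -> smap (rm2_23 f) = smap (rm2_23 g) ->
  f = g.
Proof.
case: f => u v w s t; case: g => u' v' w' s' t' /= e1 e2 e3; subst u' v' w'.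
by move=> /square_ext -> /square_ext ->.
Qed.

Definition row2_map_id (A : row2) : row2_map A A :=
  Row2Map (square_id (row2_12 A)) (square_id (row2_23 A)).
Definition row2_map_comp (A B D : row2) (f : row2_map A B) (g : row2_map B D) :
  row2_map A D :=
  Row2Map (square_comp (rm2_12 f) (rm2_12 g)) (square_comp (rm2_23 f) (rm2_23 g)).

Definition row2_cat : category.
Proof.
exists row2 row2_map row2_map_id row2_map_comp => *; apply: row2_map_ext => /=;
  by rewrite ?comp1m ?compm1 ?compA.
Defined.

Record row3 := Row3 {
  row3_1 : C; row3_2 : C; row3_3 : C; row3_4 : C;
  row3_12 : cospan row3_1 row3_2;
  row3_23 : cospan row3_2 row3_3;
  row3_34 : cospan row3_3 row3_4 }.

Record row3_map (A B : row3) := Row3Map {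
  rm3_1 : hom (row3_1 A) (row3_1 B);
  rm3_2 : hom (row3_2 A) (row3_2 B);
  rm3_3 : hom (row3_3 A) (row3_3 B);
  rm3_4 : hom (row3_4 A) (row3_4 B);
  rm3_12 : square rm3_1 rm3_2 (row3_12 A) (row3_12 B);
  rm3_23 : square rm3_2 rm3_3 (row3_23 A) (row3_23 B);
  rm3_34 : square rm3_3 rm3_4 (row3_34 A) (row3_34 B) }.

Lemma row3_map_ext (A B : row3) (f g : row3_map A B) :
  rm3_1 f = rm3_1 g -> rm3_2 f = rm3_2 g -> rm3_3 f = rm3_3 g ->
  rm3_4 f = rm3_4 g ->
  smap (rm3_12 f) = smap (rm3_12 g) -> smap (rm3_23 f) = smap (rm3_23 g) ->
  smap (rm3_34 f) = smap (rm3_34 g) -> f = g.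
Proof.
case: f => u v w z s t r; case: g => u' v' w' z' s' t' r' /= e1 e2 e3 e4.
subst u' v' w' z'.
by move=> /square_ext -> /square_ext -> /square_ext ->.
Qed.

Definition row3_map_id (A : row3) : row3_map A A :=
  Row3Map (square_id (row3_12 A)) (square_id (row3_23 A))
    (square_id (row3_34 A)).
Definition row3_map_comp (A B D : row3) (f : row3_map A B) (g : row3_map B D) :
  row3_map A D :=
  Row3Map (square_comp (rm3_12 f) (rm3_12 g)) (square_comp (rm3_23 f) (rm3_23 g))
    (square_comp (rm3_34 f) (rm3_34 g)).

Definition row3_cat : category.
Proof.
exists row3 row3_map row3_map_id row3_map_comp => *; apply: row3_map_ext => /=;
  by rewrite ?comp1m ?compm1 ?compA.
Defined.

Record cell := Cell { cell_l : C; cell_r : C; cell_c : twocell cell_l cell_r }.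

Record cell_map (A B : cell) := CellMap {
  cm_l : hom (cell_l A) (cell_l B);
  cm_r : hom (cell_r A) (cell_r B);
  cm_c : tsquare cm_l cm_r (cell_c A) (cell_c B) }.

Lemma cell_map_ext (A B : cell) (f g : cell_map A B) :
  cm_l f = cm_l g -> cm_r f = cm_r g ->
  smap (sqs (cm_c f)) = smap (sqs (cm_c g)) ->
  smap (sqt (cm_c f)) = smap (sqt (cm_c g)) -> f = g.
Proof.
case: f => u v s; case: g => u' v' s' /= e1 e2; subst u' v'.
by move=> /tsquare_ext e /e ->.
Qed.

Definition cell_map_id (A : cell) : cell_map A A :=
  CellMap (tsquare_id (cell_c A)).
Definition cell_map_comp (A B D : cell) (f : cell_map A B) (g : cell_map B D) :
  cell_map A D := CellMap (tsquare_comp (cm_c f) (cm_c g)).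

Definition cell_cat : category.
Proof.
exists cell cell_map cell_map_id cell_map_comp => *; apply: cell_map_ext => /=;
  by rewrite ?comp1m ?compm1 ?compA.
Defined.

Record vcells := Vcells {
  vc_l : C; vc_r : C; vc_c : twopath vc_l vc_r }.

Record vcells_map (A B : vcells) := VcellsMap {
  vm_l : hom (vc_l A) (vc_l B);
  vm_r : hom (vc_r A) (vc_r B);
  vm_c : psquare vm_l vm_r (vc_c A) (vc_c B) }.

Lemma vcells_map_ext (A B : vcells) (f g : vcells_map A B) :
  vm_l f = vm_l g -> vm_r f = vm_r g ->
  smap (psq0 (vm_c f)) = smap (psq0 (vm_c g)) ->
  smap (psq1 (vm_c f)) = smap (psq1 (vm_c g)) ->
  smap (psq2 (vm_c f)) = smap (psq2 (vm_c g)) -> f = g.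
Proof.
case: f => u v s; case: g => u' v' s' /= e1 e2; subst u' v'.
by move=> /psquare_ext e /e {}e /e ->.
Qed.

Definition vcells_map_id (A : vcells) : vcells_map A A :=
  VcellsMap (psquare_id (vc_c A)).
Definition vcells_map_comp (A B D : vcells)
    (f : vcells_map A B) (g : vcells_map B D) : vcells_map A D :=
  VcellsMap (psquare_comp (vm_c f) (vm_c g)).

Definition vcells_cat : category.
Proof.
exists vcells vcells_map vcells_map_id vcells_map_comp => *;
  apply: vcells_map_ext => /=; by rewrite ?comp1m ?compm1 ?compA.
Defined.

Record hcells := Hcells {
  hc_1 : C; hc_2 : C; hc_3 : C;
  hc_12 : twocell hc_1 hc_2;
  hc_23 : twocell hc_2 hc_3 }.

Record hcells_map (A B : hcells) := HcellsMap {
  hm_1 : hom (hc_1 A) (hc_1 B);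
  hm_2 : hom (hc_2 A) (hc_2 B);
  hm_3 : hom (hc_3 A) (hc_3 B);
  hm_12 : tsquare hm_1 hm_2 (hc_12 A) (hc_12 B);
  hm_23 : tsquare hm_2 hm_3 (hc_23 A) (hc_23 B) }.

Lemma hcells_map_ext (A B : hcells) (f g : hcells_map A B) :
  hm_1 f = hm_1 g -> hm_2 f = hm_2 g -> hm_3 f = hm_3 g ->
  smap (sqs (hm_12 f)) = smap (sqs (hm_12 g)) ->
  smap (sqt (hm_12 f)) = smap (sqt (hm_12 g)) ->
  smap (sqs (hm_23 f)) = smap (sqs (hm_23 g)) ->
  smap (sqt (hm_23 f)) = smap (sqt (hm_23 g)) -> f = g.
Proof.
case: f => u v w s t; case: g => u' v' w' s' t' /= e1 e2 e3; subst u' v' w'.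
by move=> /tsquare_ext e /e -> /tsquare_ext {}e /e ->.
Qed.

Definition hcells_map_id (A : hcells) : hcells_map A A :=
  HcellsMap (tsquare_id (hc_12 A)) (tsquare_id (hc_23 A)).
Definition hcells_map_comp (A B D : hcells)
    (f : hcells_map A B) (g : hcells_map B D) : hcells_map A D :=
  HcellsMap (tsquare_comp (hm_12 f) (hm_12 g)) (tsquare_comp (hm_23 f) (hm_23 g)).

Definition hcells_cat : category.
Proof.
exists hcells hcells_map hcells_map_id hcells_map_comp => *;
  apply: hcells_map_ext => /=; by rewrite ?comp1m ?compm1 ?compA.
Defined.

Variable P : pushouts C.

Section PushoutMap.

Variables (x a b x' a' b' : C).
Variables (f : hom x a) (g : hom x b) (f' : hom x' a') (g' : hom x' b').
Variables (k : hom x x') (ka : hom a a') (kb : hom b b').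
Variables (ea : f ;; ka = k ;; f') (eb : g ;; kb = k ;; g').

Lemma po_map_comm : f ;; (ka ;; inl P f' g') = g ;; (kb ;; inr P f' g').
Proof. by rewrite !compA ea eb -!compA po_comm. Qed.

Definition po_map : hom (po P f g) (po P f' g') := copair P po_map_comm.

End PushoutMap.

Section PushoutSquare.

Variables (x y xa ya xb yb : C).
Variables (ua : hom x xa) (va : hom y ya) (ub : hom x xb) (vb : hom y yb).
Variables (f : cospan x y) (fa : cospan xa ya) (fb : cospan xb yb).
Variables (s : square ua va f fa) (t : square ub vb f fb).

Definition cospan_po : cospan (po P ua ub) (po P va vb) :=
  Cospan (po P s t)
    (po_map (esym (smap_l s)) (esym (smap_l t)))
    (po_map (esym (smap_r s)) (esym (smap_r t))).

Definition square_inl : square (inl P ua ub) (inl P va vb) fa cospan_po.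
Proof. by exists (inl P s t); rewrite /= /po_map copair_inl. Defined.

Definition square_inr : square (inr P ua ub) (inr P va vb) fb cospan_po.
Proof. by exists (inr P s t); rewrite /= /po_map copair_inr. Defined.

Definition square_copair (x' y' : C) (f' : cospan x' y')
    (wa : hom xa x') (za : hom ya y') (wb : hom xb x') (zb : hom yb y')
    (sa : square wa za fa f') (sb : square wb zb fb f')
    (ex : ua ;; wa = ub ;; wb) (ey : va ;; za = vb ;; zb)
    (e : s ;; sa = t ;; sb) :
  square (copair P ex) (copair P ey) cospan_po f'.
Proof.
exists (copair P e); apply: copair_uniq; rewrite /po_map !compA.
- by rewrite !copair_inl -compA copair_inl smap_l.
- by rewrite !copair_inr -compA copair_inr smap_l.
- by rewrite !copair_inl -compA copair_inl smap_r.
- by rewrite !copair_inr -compA copair_inr smap_r.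
Defined.

End PushoutSquare.

Definition cospan_map_po (x y xa ya xb yb : C)
    (ua : hom x xa) (va : hom y ya) (ub : hom x xb) (vb : hom y yb)
    (f g : cospan x y) (fa ga : cospan xa ya) (fb gb : cospan xb yb)
    (s : square ua va f fa) (s' : square ua va g ga)
    (t : square ub vb f fb) (t' : square ub vb g gb)
    (k : cospan_map f g) (ka : cospan_map fa ga) (kb : cospan_map fb gb)
    (ea : s ;; ka = k ;; s') (eb : t ;; kb = k ;; t') :
  cospan_map (cospan_po s t) (cospan_po s' t').
Proof.
exists (po_map ea eb); apply: copair_uniq; rewrite /= /po_map !compA.
- by rewrite !copair_inl -compA copair_inl compA cmap_l.
- by rewrite !copair_inr -compA copair_inr compA cmap_l.
- by rewrite !copair_inl -compA copair_inl compA cmap_r.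
- by rewrite !copair_inr -compA copair_inr compA cmap_r.
Defined.

Section PushoutTsquare.

Variables (x y xa ya xb yb : C).
Variables (ua : hom x xa) (va : hom y ya) (ub : hom x xb) (vb : hom y yb).
Variables (a : twocell x y) (aa : twocell xa ya) (ab : twocell xb yb).
Variables (s : tsquare ua va a aa) (t : tsquare ub vb a ab).

Definition twocell_po : twocell (po P ua ub) (po P va vb) :=
  Twocell (cospan_map_po (esym (sqc s)) (esym (sqc t))).

Definition tsquare_inl : tsquare (inl P ua ub) (inl P va vb) aa twocell_po.
Proof.
exists (square_inl (sqs s) (sqs t)) (square_inl (sqt s) (sqt t)).
by rewrite /= /po_map copair_inl.
Defined.

Definition tsquare_inr : tsquare (inr P ua ub) (inr P va vb) ab twocell_po.
Proof.
exists (square_inr (sqs s) (sqs t)) (square_inr (sqt s) (sqt t)).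
by rewrite /= /po_map copair_inr.
Defined.

Definition tsquare_copair (x' y' : C) (a' : twocell x' y')
    (wa : hom xa x') (za : hom ya y') (wb : hom xb x') (zb : hom yb y')
    (sa : tsquare wa za aa a') (sb : tsquare wb zb ab a')
    (ex : ua ;; wa = ub ;; wb) (ey : va ;; za = vb ;; zb)
    (e : sqs s ;; sqs sa = sqs t ;; sqs sb)
    (e' : sqt s ;; sqt sa = sqt t ;; sqt sb) :
  tsquare (copair P ex) (copair P ey) twocell_po a'.
Proof.
exists (square_copair ex ey e) (square_copair ex ey e').
apply: copair_uniq; rewrite /= /po_map !compA.
- by rewrite !copair_inl -compA copair_inl sqc.
- by rewrite !copair_inr -compA copair_inr sqc.
Defined.

End PushoutTsquare.

Section PushoutPsquare.

Variables (x y xa ya xb yb : C).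
Variables (ua : hom x xa) (va : hom y ya) (ub : hom x xb) (vb : hom y yb).
Variables (a : twopath x y) (aa : twopath xa ya) (ab : twopath xb yb).
Variables (s : psquare ua va a aa) (t : psquare ub vb a ab).

Definition twopath_po : twopath (po P ua ub) (po P va vb) :=
  Twopath (cospan_map_po (esym (psq01 s)) (esym (psq01 t)))
    (cospan_map_po (esym (psq12 s)) (esym (psq12 t))).

Definition psquare_inl : psquare (inl P ua ub) (inl P va vb) aa twopath_po.
Proof.
exists (square_inl (psq0 s) (psq0 t)) (square_inl (psq1 s) (psq1 t))
  (square_inl (psq2 s) (psq2 t)); by rewrite /= /po_map copair_inl.
Defined.

Definition psquare_inr : psquare (inr P ua ub) (inr P va vb) ab twopath_po.
Proof.
exists (square_inr (psq0 s) (psq0 t)) (square_inr (psq1 s) (psq1 t))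
  (square_inr (psq2 s) (psq2 t)); by rewrite /= /po_map copair_inr.
Defined.

Definition psquare_copair (x' y' : C) (a' : twopath x' y')
    (wa : hom xa x') (za : hom ya y') (wb : hom xb x') (zb : hom yb y')
    (sa : psquare wa za aa a') (sb : psquare wb zb ab a')
    (ex : ua ;; wa = ub ;; wb) (ey : va ;; za = vb ;; zb)
    (e0 : psq0 s ;; psq0 sa = psq0 t ;; psq0 sb)
    (e1 : psq1 s ;; psq1 sa = psq1 t ;; psq1 sb)
    (e2 : psq2 s ;; psq2 sa = psq2 t ;; psq2 sb) :
  psquare (copair P ex) (copair P ey) twopath_po a'.
Proof.
exists (square_copair ex ey e0) (square_copair ex ey e1)
  (square_copair ex ey e2); apply: copair_uniq; rewrite /= /po_map !compA.
- by rewrite !copair_inl -compA copair_inl psq01.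
- by rewrite !copair_inr -compA copair_inr psq01.
- by rewrite !copair_inl -compA copair_inl psq12.
- by rewrite !copair_inr -compA copair_inr psq12.
Defined.

End PushoutPsquare.

Definition row_po_ob (X A B : row) (f : row_map X A) (g : row_map X B) : row :=
  Row
    (cospan_po (rm_c f) (rm_c g)).

Definition row_inl (X A B : row) (f : row_map X A) (g : row_map X B) :
    row_map A (row_po_ob f g) :=
  @RowMap A (row_po_ob f g) _ _
    (square_inl (rm_c f) (rm_c g)).

Definition row_inr (X A B : row) (f : row_map X A) (g : row_map X B) :
    row_map B (row_po_ob f g) :=
  @RowMap B (row_po_ob f g) _ _
    (square_inr (rm_c f) (rm_c g)).

Definition row_copair (X A B : row) (f : row_map X A) (g : row_map X B)
    (Z : row) (u : row_map A Z) (v : row_map B Z)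
    (e : row_map_comp f u = row_map_comp g v) : row_map (row_po_ob f g) Z :=
  @RowMap (row_po_ob f g) Z _ _
    (square_copair
       (f_equal (fun h => rm_l h) e)
       (f_equal (fun h => rm_r h) e)
       (f_equal (fun h => smap (rm_c h)) e)).

Definition row_po : pushouts row_cat.
Proof.
unshelve refine (@Pushouts row_cat row_po_ob row_inl row_inr _ row_copair _ _ _)
  => /=.
- by move=> *; apply: row_map_ext; exact: po_comm.
- by move=> *; apply: row_map_ext; exact: copair_inl.
- by move=> *; apply: row_map_ext; exact: copair_inr.
- move=> X A B f g Z w w' el er; apply: row_map_ext; apply: (copair_uniq P).
  + exact: (f_equal (fun h : row_map _ _ => rm_l h) el).
  + exact: (f_equal (fun h : row_map _ _ => rm_l h) er).
  + exact: (f_equal (fun h : row_map _ _ => rm_r h) el).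
  + exact: (f_equal (fun h : row_map _ _ => rm_r h) er).
  + exact: (f_equal (fun h : row_map _ _ => smap (rm_c h)) el).
  + exact: (f_equal (fun h : row_map _ _ => smap (rm_c h)) er).
Defined.

Definition row2_po_ob (X A B : row2) (f : row2_map X A) (g : row2_map X B) : row2 :=
  Row2
    (cospan_po (rm2_12 f) (rm2_12 g))
    (cospan_po (rm2_23 f) (rm2_23 g)).

Definition row2_inl (X A B : row2) (f : row2_map X A) (g : row2_map X B) :
    row2_map A (row2_po_ob f g) :=
  @Row2Map A (row2_po_ob f g) _ _ _
    (square_inl (rm2_12 f) (rm2_12 g))
    (square_inl (rm2_23 f) (rm2_23 g)).

Definition row2_inr (X A B : row2) (f : row2_map X A) (g : row2_map X B) :
    row2_map B (row2_po_ob f g) :=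
  @Row2Map B (row2_po_ob f g) _ _ _
    (square_inr (rm2_12 f) (rm2_12 g))
    (square_inr (rm2_23 f) (rm2_23 g)).

Definition row2_copair (X A B : row2) (f : row2_map X A) (g : row2_map X B)
    (Z : row2) (u : row2_map A Z) (v : row2_map B Z)
    (e : row2_map_comp f u = row2_map_comp g v) : row2_map (row2_po_ob f g) Z :=
  @Row2Map (row2_po_ob f g) Z _ _ _
    (square_copair
       (f_equal (fun h => rm2_1 h) e)
       (f_equal (fun h => rm2_2 h) e)
       (f_equal (fun h => smap (rm2_12 h)) e))
    (square_copair
       (f_equal (fun h => rm2_2 h) e)
       (f_equal (fun h => rm2_3 h) e)
       (f_equal (fun h => smap (rm2_23 h)) e)).

Definition row2_po : pushouts row2_cat.
Proof.
unshelve refine (@Pushouts row2_cat row2_po_ob row2_inl row2_inr _ row2_copair _ _ _)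
  => /=.
- by move=> *; apply: row2_map_ext; exact: po_comm.
- by move=> *; apply: row2_map_ext; exact: copair_inl.
- by move=> *; apply: row2_map_ext; exact: copair_inr.
- move=> X A B f g Z w w' el er; apply: row2_map_ext; apply: (copair_uniq P).
  + exact: (f_equal (fun h : row2_map _ _ => rm2_1 h) el).
  + exact: (f_equal (fun h : row2_map _ _ => rm2_1 h) er).
  + exact: (f_equal (fun h : row2_map _ _ => rm2_2 h) el).
  + exact: (f_equal (fun h : row2_map _ _ => rm2_2 h) er).
  + exact: (f_equal (fun h : row2_map _ _ => rm2_3 h) el).
  + exact: (f_equal (fun h : row2_map _ _ => rm2_3 h) er).
  + exact: (f_equal (fun h : row2_map _ _ => smap (rm2_12 h)) el).
  + exact: (f_equal (fun h : row2_map _ _ => smap (rm2_12 h)) er).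
  + exact: (f_equal (fun h : row2_map _ _ => smap (rm2_23 h)) el).
  + exact: (f_equal (fun h : row2_map _ _ => smap (rm2_23 h)) er).
Defined.

Definition row3_po_ob (X A B : row3) (f : row3_map X A) (g : row3_map X B) : row3 :=
  Row3
    (cospan_po (rm3_12 f) (rm3_12 g))
    (cospan_po (rm3_23 f) (rm3_23 g))
    (cospan_po (rm3_34 f) (rm3_34 g)).

Definition row3_inl (X A B : row3) (f : row3_map X A) (g : row3_map X B) :
    row3_map A (row3_po_ob f g) :=
  @Row3Map A (row3_po_ob f g) _ _ _ _
    (square_inl (rm3_12 f) (rm3_12 g))
    (square_inl (rm3_23 f) (rm3_23 g))
    (square_inl (rm3_34 f) (rm3_34 g)).

Definition row3_inr (X A B : row3) (f : row3_map X A) (g : row3_map X B) :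
    row3_map B (row3_po_ob f g) :=
  @Row3Map B (row3_po_ob f g) _ _ _ _
    (square_inr (rm3_12 f) (rm3_12 g))
    (square_inr (rm3_23 f) (rm3_23 g))
    (square_inr (rm3_34 f) (rm3_34 g)).

Definition row3_copair (X A B : row3) (f : row3_map X A) (g : row3_map X B)
    (Z : row3) (u : row3_map A Z) (v : row3_map B Z)
    (e : row3_map_comp f u = row3_map_comp g v) : row3_map (row3_po_ob f g) Z :=
  @Row3Map (row3_po_ob f g) Z _ _ _ _
    (square_copair
       (f_equal (fun h => rm3_1 h) e)
       (f_equal (fun h => rm3_2 h) e)
       (f_equal (fun h => smap (rm3_12 h)) e))
    (square_copair
       (f_equal (fun h => rm3_2 h) e)
       (f_equal (fun h => rm3_3 h) e)
       (f_equal (fun h => smap (rm3_23 h)) e))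
    (square_copair
       (f_equal (fun h => rm3_3 h) e)
       (f_equal (fun h => rm3_4 h) e)
       (f_equal (fun h => smap (rm3_34 h)) e)).

Definition row3_po : pushouts row3_cat.
Proof.
unshelve refine (@Pushouts row3_cat row3_po_ob row3_inl row3_inr _ row3_copair _ _ _)
  => /=.
- by move=> *; apply: row3_map_ext; exact: po_comm.
- by move=> *; apply: row3_map_ext; exact: copair_inl.
- by move=> *; apply: row3_map_ext; exact: copair_inr.
- move=> X A B f g Z w w' el er; apply: row3_map_ext; apply: (copair_uniq P).
  + exact: (f_equal (fun h : row3_map _ _ => rm3_1 h) el).
  + exact: (f_equal (fun h : row3_map _ _ => rm3_1 h) er).
  + exact: (f_equal (fun h : row3_map _ _ => rm3_2 h) el).
  + exact: (f_equal (fun h : row3_map _ _ => rm3_2 h) er).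
  + exact: (f_equal (fun h : row3_map _ _ => rm3_3 h) el).
  + exact: (f_equal (fun h : row3_map _ _ => rm3_3 h) er).
  + exact: (f_equal (fun h : row3_map _ _ => rm3_4 h) el).
  + exact: (f_equal (fun h : row3_map _ _ => rm3_4 h) er).
  + exact: (f_equal (fun h : row3_map _ _ => smap (rm3_12 h)) el).
  + exact: (f_equal (fun h : row3_map _ _ => smap (rm3_12 h)) er).
  + exact: (f_equal (fun h : row3_map _ _ => smap (rm3_23 h)) el).
  + exact: (f_equal (fun h : row3_map _ _ => smap (rm3_23 h)) er).
  + exact: (f_equal (fun h : row3_map _ _ => smap (rm3_34 h)) el).
  + exact: (f_equal (fun h : row3_map _ _ => smap (rm3_34 h)) er).
Defined.

Definition cell_po_ob (X A B : cell) (f : cell_map X A) (g : cell_map X B) : cell :=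
  Cell
    (twocell_po (cm_c f) (cm_c g)).

Definition cell_inl (X A B : cell) (f : cell_map X A) (g : cell_map X B) :
    cell_map A (cell_po_ob f g) :=
  @CellMap A (cell_po_ob f g) _ _
    (tsquare_inl (cm_c f) (cm_c g)).

Definition cell_inr (X A B : cell) (f : cell_map X A) (g : cell_map X B) :
    cell_map B (cell_po_ob f g) :=
  @CellMap B (cell_po_ob f g) _ _
    (tsquare_inr (cm_c f) (cm_c g)).

Definition cell_copair (X A B : cell) (f : cell_map X A) (g : cell_map X B)
    (Z : cell) (u : cell_map A Z) (v : cell_map B Z)
    (e : cell_map_comp f u = cell_map_comp g v) : cell_map (cell_po_ob f g) Z :=
  @CellMap (cell_po_ob f g) Z _ _
    (tsquare_copair
       (f_equal (fun h => cm_l h) e)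
       (f_equal (fun h => cm_r h) e)
       (f_equal (fun h => smap (sqs (cm_c h))) e)
       (f_equal (fun h => smap (sqt (cm_c h))) e)).

Definition cell_po : pushouts cell_cat.
Proof.
unshelve refine (@Pushouts cell_cat cell_po_ob cell_inl cell_inr _ cell_copair _ _ _)
  => /=.
- by move=> *; apply: cell_map_ext; exact: po_comm.
- by move=> *; apply: cell_map_ext; exact: copair_inl.
- by move=> *; apply: cell_map_ext; exact: copair_inr.
- move=> X A B f g Z w w' el er; apply: cell_map_ext; apply: (copair_uniq P).
  + exact: (f_equal (fun h : cell_map _ _ => cm_l h) el).
  + exact: (f_equal (fun h : cell_map _ _ => cm_l h) er).
  + exact: (f_equal (fun h : cell_map _ _ => cm_r h) el).
  + exact: (f_equal (fun h : cell_map _ _ => cm_r h) er).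
  + exact: (f_equal (fun h : cell_map _ _ => smap (sqs (cm_c h))) el).
  + exact: (f_equal (fun h : cell_map _ _ => smap (sqs (cm_c h))) er).
  + exact: (f_equal (fun h : cell_map _ _ => smap (sqt (cm_c h))) el).
  + exact: (f_equal (fun h : cell_map _ _ => smap (sqt (cm_c h))) er).
Defined.

Definition vcells_po_ob (X A B : vcells) (f : vcells_map X A) (g : vcells_map X B) : vcells :=
  Vcells
    (twopath_po (vm_c f) (vm_c g)).

Definition vcells_inl (X A B : vcells) (f : vcells_map X A) (g : vcells_map X B) :
    vcells_map A (vcells_po_ob f g) :=
  @VcellsMap A (vcells_po_ob f g) _ _
    (psquare_inl (vm_c f) (vm_c g)).

Definition vcells_inr (X A B : vcells) (f : vcells_map X A) (g : vcells_map X B) :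
    vcells_map B (vcells_po_ob f g) :=
  @VcellsMap B (vcells_po_ob f g) _ _
    (psquare_inr (vm_c f) (vm_c g)).

Definition vcells_copair (X A B : vcells) (f : vcells_map X A) (g : vcells_map X B)
    (Z : vcells) (u : vcells_map A Z) (v : vcells_map B Z)
    (e : vcells_map_comp f u = vcells_map_comp g v) : vcells_map (vcells_po_ob f g) Z :=
  @VcellsMap (vcells_po_ob f g) Z _ _
    (psquare_copair
       (f_equal (fun h => vm_l h) e)
       (f_equal (fun h => vm_r h) e)
       (f_equal (fun h => smap (psq0 (vm_c h))) e)
       (f_equal (fun h => smap (psq1 (vm_c h))) e)
       (f_equal (fun h => smap (psq2 (vm_c h))) e)).

Definition vcells_po : pushouts vcells_cat.
Proof.
unshelve refine (@Pushouts vcells_cat vcells_po_ob vcells_inl vcells_inr _ vcells_copair _ _ _)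
  => /=.
- by move=> *; apply: vcells_map_ext; exact: po_comm.
- by move=> *; apply: vcells_map_ext; exact: copair_inl.
- by move=> *; apply: vcells_map_ext; exact: copair_inr.
- move=> X A B f g Z w w' el er; apply: vcells_map_ext; apply: (copair_uniq P).
  + exact: (f_equal (fun h : vcells_map _ _ => vm_l h) el).
  + exact: (f_equal (fun h : vcells_map _ _ => vm_l h) er).
  + exact: (f_equal (fun h : vcells_map _ _ => vm_r h) el).
  + exact: (f_equal (fun h : vcells_map _ _ => vm_r h) er).
  + exact: (f_equal (fun h : vcells_map _ _ => smap (psq0 (vm_c h))) el).
  + exact: (f_equal (fun h : vcells_map _ _ => smap (psq0 (vm_c h))) er).
  + exact: (f_equal (fun h : vcells_map _ _ => smap (psq1 (vm_c h))) el).
  + exact: (f_equal (fun h : vcells_map _ _ => smap (psq1 (vm_c h))) er).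
  + exact: (f_equal (fun h : vcells_map _ _ => smap (psq2 (vm_c h))) el).
  + exact: (f_equal (fun h : vcells_map _ _ => smap (psq2 (vm_c h))) er).
Defined.

Definition hcells_po_ob (X A B : hcells) (f : hcells_map X A) (g : hcells_map X B) : hcells :=
  Hcells
    (twocell_po (hm_12 f) (hm_12 g))
    (twocell_po (hm_23 f) (hm_23 g)).

Definition hcells_inl (X A B : hcells) (f : hcells_map X A) (g : hcells_map X B) :
    hcells_map A (hcells_po_ob f g) :=
  @HcellsMap A (hcells_po_ob f g) _ _ _
    (tsquare_inl (hm_12 f) (hm_12 g))
    (tsquare_inl (hm_23 f) (hm_23 g)).

Definition hcells_inr (X A B : hcells) (f : hcells_map X A) (g : hcells_map X B) :
    hcells_map B (hcells_po_ob f g) :=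
  @HcellsMap B (hcells_po_ob f g) _ _ _
    (tsquare_inr (hm_12 f) (hm_12 g))
    (tsquare_inr (hm_23 f) (hm_23 g)).

Definition hcells_copair (X A B : hcells) (f : hcells_map X A) (g : hcells_map X B)
    (Z : hcells) (u : hcells_map A Z) (v : hcells_map B Z)
    (e : hcells_map_comp f u = hcells_map_comp g v) : hcells_map (hcells_po_ob f g) Z :=
  @HcellsMap (hcells_po_ob f g) Z _ _ _
    (tsquare_copair
       (f_equal (fun h => hm_1 h) e)
       (f_equal (fun h => hm_2 h) e)
       (f_equal (fun h => smap (sqs (hm_12 h))) e)
       (f_equal (fun h => smap (sqt (hm_12 h))) e))
    (tsquare_copair
       (f_equal (fun h => hm_2 h) e)
       (f_equal (fun h => hm_3 h) e)
       (f_equal (fun h => smap (sqs (hm_23 h))) e)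
       (f_equal (fun h => smap (sqt (hm_23 h))) e)).

Definition hcells_po : pushouts hcells_cat.
Proof.
unshelve refine (@Pushouts hcells_cat hcells_po_ob hcells_inl hcells_inr _ hcells_copair _ _ _)
  => /=.
- by move=> *; apply: hcells_map_ext; exact: po_comm.
- by move=> *; apply: hcells_map_ext; exact: copair_inl.
- by move=> *; apply: hcells_map_ext; exact: copair_inr.
- move=> X A B f g Z w w' el er; apply: hcells_map_ext; apply: (copair_uniq P).
  + exact: (f_equal (fun h : hcells_map _ _ => hm_1 h) el).
  + exact: (f_equal (fun h : hcells_map _ _ => hm_1 h) er).
  + exact: (f_equal (fun h : hcells_map _ _ => hm_2 h) el).
  + exact: (f_equal (fun h : hcells_map _ _ => hm_2 h) er).
  + exact: (f_equal (fun h : hcells_map _ _ => hm_3 h) el).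
  + exact: (f_equal (fun h : hcells_map _ _ => hm_3 h) er).
  + exact: (f_equal (fun h : hcells_map _ _ => smap (sqs (hm_12 h))) el).
  + exact: (f_equal (fun h : hcells_map _ _ => smap (sqs (hm_12 h))) er).
  + exact: (f_equal (fun h : hcells_map _ _ => smap (sqt (hm_12 h))) el).
  + exact: (f_equal (fun h : hcells_map _ _ => smap (sqt (hm_12 h))) er).
  + exact: (f_equal (fun h : hcells_map _ _ => smap (sqs (hm_23 h))) el).
  + exact: (f_equal (fun h : hcells_map _ _ => smap (sqs (hm_23 h))) er).
  + exact: (f_equal (fun h : hcells_map _ _ => smap (sqt (hm_23 h))) el).
  + exact: (f_equal (fun h : hcells_map _ _ => smap (sqt (hm_23 h))) er).
Defined.

(** Applying [Cosp_functor] to the following functors gives the structure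
    2-functors of double cospans.  Their action on maps of diagrams is what
    determines how those 2-functors act on double cospans and on 2-cells:
    [row2_comp], for instance, sends two horizontally adjacent 3x3 diagrams to
    the diagram obtained by taking pushouts in each of the three rows. *)

Definition row_left : functor row_cat C.
Proof. by exists row_l rm_l. Defined.

Definition row_right : functor row_cat C.
Proof. by exists row_r rm_r. Defined.

Definition cell_left : functor cell_cat C.
Proof. by exists cell_l cm_l. Defined.

Definition cell_right : functor cell_cat C.
Proof. by exists cell_r cm_r. Defined.

Definition cell_src : functor cell_cat row_cat.
Proof.
by exists (fun A => Row (csrc (cell_c A)))
  (fun A B f => @RowMap (Row (csrc (cell_c A))) (Row (csrc (cell_c B)))
                  _ _ (sqs (cm_c f))).
Defined.

Definition cell_tgt : functor cell_cat row_cat.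
Proof.
by exists (fun A => Row (ctgt (cell_c A)))
  (fun A B f => @RowMap (Row (ctgt (cell_c A))) (Row (ctgt (cell_c B)))
                  _ _ (sqt (cm_c f))).
Defined.

Definition row_of_id : functor C row_cat.
Proof.
by exists (fun x => Row (cospan_id x))
  (fun x y u => @RowMap (Row (cospan_id x)) (Row (cospan_id y))
                  _ _ (square_of_id u)) => *; apply: row_map_ext.
Defined.

Definition twocell_id (x y : C) (f : cospan x y) : twocell x y :=
  Twocell (cospan_map_id f).

Definition tsquare_of_id (x y x' y' : C) (u : hom x x') (v : hom y y')
    (f : cospan x y) (g : cospan x' y') (s : square u v f g) :
  tsquare u v (twocell_id f) (twocell_id g).
Proof. by exists s s; rewrite /= comp1m compm1. Defined.

Definition cell_of_id : functor row_cat cell_cat.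
Proof.
by exists (fun A => Cell (twocell_id (row_c A)))
  (fun A B f => @CellMap (Cell (twocell_id (row_c A)))
     (Cell (twocell_id (row_c B))) _ _ (tsquare_of_id (rm_c f)))
  => *; apply: cell_map_ext.
Defined.

Definition row2_fst : functor row2_cat row_cat.
Proof.
by exists (fun A => Row (row2_12 A))
  (fun A B f => @RowMap (Row (row2_12 A)) (Row (row2_12 B)) _ _ (rm2_12 f)).
Defined.

Definition row2_snd : functor row2_cat row_cat.
Proof.
by exists (fun A => Row (row2_23 A))
  (fun A B f => @RowMap (Row (row2_23 A)) (Row (row2_23 B)) _ _ (rm2_23 f)).
Defined.

Lemma square_hcomp_id (x y z : C) (f : cospan x y) (g : cospan y z) :
  square_hcomp P (square_id f) (square_id g) = square_id (cospan_comp P f g).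
Proof.
apply: square_ext; apply: (copair_uniq P);
  by rewrite ?copair_inl ?copair_inr /= comp1m compm1.
Qed.

Lemma square_hcomp_comp (x y z x' y' z' x'' y'' z'' : C)
    (u : hom x x') (v : hom y y') (w : hom z z')
    (u' : hom x' x'') (v' : hom y' y'') (w' : hom z' z'')
    (f : cospan x y) (f' : cospan x' y') (f'' : cospan x'' y'')
    (g : cospan y z) (g' : cospan y' z') (g'' : cospan y'' z'')
    (s : square u v f f') (t : square v w g g')
    (s' : square u' v' f' f'') (t' : square v' w' g' g'') :
  square_hcomp P (square_comp s s') (square_comp t t')
  = square_comp (square_hcomp P s t) (square_hcomp P s' t').
Proof.
apply: square_ext; apply: (copair_uniq P);
  by rewrite /= compA ?copair_inl ?copair_inr /= -!compA
    ?copair_inl ?copair_inr.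
Qed.

Definition row2_comp : functor row2_cat row_cat.
Proof.
exists (fun A => Row (cospan_comp P (row2_12 A) (row2_23 A)))
  (fun A B f => @RowMap (Row (cospan_comp P (row2_12 A) (row2_23 A)))
     (Row (cospan_comp P (row2_12 B) (row2_23 B))) _ _
     (square_hcomp P (rm2_12 f) (rm2_23 f)))
  => *; apply: row_map_ext => //; apply: f_equal.
- exact: square_hcomp_id.
- exact: square_hcomp_comp.
Defined.

Definition row3_fst : functor row3_cat row_cat.
Proof.
by exists (fun A => Row (row3_12 A))
  (fun A B f => @RowMap (Row (row3_12 A)) (Row (row3_12 B)) _ _ (rm3_12 f)).
Defined.

Definition row3_snd : functor row3_cat row_cat.
Proof.
by exists (fun A => Row (row3_23 A))
  (fun A B f => @RowMap (Row (row3_23 A)) (Row (row3_23 B)) _ _ (rm3_23 f)).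
Defined.

Definition row3_thd : functor row3_cat row_cat.
Proof.
by exists (fun A => Row (row3_34 A))
  (fun A B f => @RowMap (Row (row3_34 A)) (Row (row3_34 B)) _ _ (rm3_34 f)).
Defined.

Definition twocell_assoc (w x y z : C)
    (f : cospan w x) (g : cospan x y) (h : cospan y z) : twocell w z :=
  Twocell (cospan_assoc P f g h).

Lemma square_hcomp_inl (x y z x' y' z' : C)
    (u : hom x x') (v : hom y y') (w : hom z z')
    (f : cospan x y) (f' : cospan x' y') (g : cospan y z) (g' : cospan y' z')
    (s : square u v f f') (t : square v w g g') :
  inl P (legr f) (legl g) ;; square_hcomp P s t
  = s ;; inl P (legr f') (legl g').
Proof. exact: copair_inl. Qed.

Lemma square_hcomp_inr (x y z x' y' z' : C)
    (u : hom x x') (v : hom y y') (w : hom z z')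
    (f : cospan x y) (f' : cospan x' y') (g : cospan y z) (g' : cospan y' z')
    (s : square u v f f') (t : square v w g g') :
  inr P (legr f) (legl g) ;; square_hcomp P s t
  = t ;; inr P (legr f') (legl g').
Proof. exact: copair_inr. Qed.

Section AssocInjections.

Variables (w x y z : C) (f : cospan w x) (g : cospan x y) (h : cospan y z).
Let fg := cospan_comp P f g.
Let gh := cospan_comp P g h.

Lemma cospan_assoc_1 :
  inl P (legr f) (legl g) ;; (inl P (legr fg) (legl h) ;; cospan_assoc P f g h)
  = inl P (legr f) (legl gh).
Proof.
exact: (etrans (f_equal (comp _) (copair_inl P _)) (copair_inl P _)).
Qed.

Lemma cospan_assoc_2 :
  inr P (legr f) (legl g) ;; (inl P (legr fg) (legl h) ;; cospan_assoc P f g h)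
  = inl P (legr g) (legl h) ;; inr P (legr f) (legl gh).
Proof.
exact: (etrans (f_equal (comp _) (copair_inl P _)) (copair_inr P _)).
Qed.

Lemma cospan_assoc_3 :
  inr P (legr fg) (legl h) ;; cospan_assoc P f g h
  = inr P (legr g) (legl h) ;; inr P (legr f) (legl gh).
Proof. exact: copair_inr. Qed.

End AssocInjections.

Definition tsquare_assoc (w x y z w' x' y' z' : C)
    (a : hom w w') (b : hom x x') (c : hom y y') (d : hom z z')
    (f : cospan w x) (f' : cospan w' x') (g : cospan x y) (g' : cospan x' y')
    (h : cospan y z) (h' : cospan y' z')
    (s : square a b f f') (t : square b c g g') (r : square c d h h') :
  tsquare a d (twocell_assoc f g h) (twocell_assoc f' g' h').
Proof.
exists (square_hcomp P (square_hcomp P s t) r)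
  (square_hcomp P s (square_hcomp P t r)).
rewrite /twocell_assoc; cbn [cmor].
have EL : inl P (legr (cospan_comp P f g)) (legl h) ;;
      (square_hcomp P (square_hcomp P s t) r ;; cospan_assoc P f' g' h')
    = square_hcomp P s t ;; (inl P _ _ ;; cospan_assoc P f' g' h').
  by rewrite !compA square_hcomp_inl.
apply: (copair_uniq P); first (rewrite EL; apply: (copair_uniq P)).
- rewrite [RHS]compA square_hcomp_inl -[RHS]compA cospan_assoc_1.
  rewrite [_ ;; (cospan_assoc P f g h ;; _)]compA [LHS]compA cospan_assoc_1.
  exact: square_hcomp_inl.
- rewrite [RHS]compA square_hcomp_inr -[RHS]compA cospan_assoc_2.
  rewrite [_ ;; (cospan_assoc P f g h ;; _)]compA [LHS]compA cospan_assoc_2.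
  rewrite -[LHS]compA (square_hcomp_inr s (square_hcomp P t r)) [LHS]compA square_hcomp_inl.
  by rewrite -compA.
- rewrite [RHS]compA square_hcomp_inr -[RHS]compA cospan_assoc_3.
  rewrite [LHS]compA cospan_assoc_3 -[LHS]compA.
  rewrite (square_hcomp_inr s (square_hcomp P t r)).
  by rewrite [LHS]compA square_hcomp_inr -compA.
Defined.

Definition row3_assoc : functor row3_cat cell_cat.
Proof.
exists (fun A => Cell (twocell_assoc (row3_12 A) (row3_23 A) (row3_34 A)))
  (fun A B f => @CellMap
     (Cell (twocell_assoc (row3_12 A) (row3_23 A) (row3_34 A)))
     (Cell (twocell_assoc (row3_12 B) (row3_23 B) (row3_34 B))) _ _
     (tsquare_assoc (rm3_12 f) (rm3_23 f) (rm3_34 f)))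
  => *; apply: cell_map_ext => //; apply: f_equal; cbn [sqs sqt].
- by rewrite /= !square_hcomp_id.
- by rewrite /= !square_hcomp_id.
- by rewrite /= !square_hcomp_comp.
- by rewrite /= !square_hcomp_comp.
Defined.

Definition twocell_lunit (x y : C) (f : cospan x y) : twocell x y :=
  Twocell (cospan_lunit P f).

Definition tsquare_lunit (x y x' y' : C) (u : hom x x') (v : hom y y')
    (f : cospan x y) (g : cospan x' y') (s : square u v f g) :
  tsquare u v (twocell_lunit f) (twocell_lunit g).
Proof.
exists (square_hcomp P (square_of_id u) s) s.
apply: (copair_uniq P).
- by rewrite /= !compA !copair_inl smap_l -compA copair_inl.
- by rewrite /= !compA !copair_inr -compA copair_inr comp1m compm1.
Defined.

Definition row_lunit : functor row_cat cell_cat.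
Proof.
exists (fun A => Cell (twocell_lunit (row_c A)))
  (fun A B f => @CellMap (Cell (twocell_lunit (row_c A)))
     (Cell (twocell_lunit (row_c B))) _ _ (tsquare_lunit (rm_c f)))
  => *; apply: cell_map_ext => //; apply: (copair_uniq P);
  by rewrite /= ?compA ?copair_inl ?copair_inr /= ?comp1m ?compm1 // -!compA
    ?copair_inl ?copair_inr.
Defined.

Definition twocell_runit (x y : C) (f : cospan x y) : twocell x y :=
  Twocell (cospan_runit P f).

Definition tsquare_runit (x y x' y' : C) (u : hom x x') (v : hom y y')
    (f : cospan x y) (g : cospan x' y') (s : square u v f g) :
  tsquare u v (twocell_runit f) (twocell_runit g).
Proof.
exists (square_hcomp P s (square_of_id v)) s.
apply: (copair_uniq P).
- by rewrite /= !compA !copair_inl -compA copair_inl comp1m compm1.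
- by rewrite /= !compA !copair_inr smap_r -compA copair_inr.
Defined.

Definition row_runit : functor row_cat cell_cat.
Proof.
exists (fun A => Cell (twocell_runit (row_c A)))
  (fun A B f => @CellMap (Cell (twocell_runit (row_c A)))
     (Cell (twocell_runit (row_c B))) _ _ (tsquare_runit (rm_c f)))
  => *; apply: cell_map_ext => //; apply: (copair_uniq P);
  by rewrite /= ?compA ?copair_inl ?copair_inr /= ?comp1m ?compm1 // -!compA
    ?copair_inl ?copair_inr.
Defined.

Definition twopath_fst (x y : C) (a : twopath x y) : twocell x y :=
  Twocell (pth01 a).

Definition twopath_snd (x y : C) (a : twopath x y) : twocell x y :=
  Twocell (pth12 a).

Definition twopath_comp (x y : C) (a : twopath x y) : twocell x y :=
  Twocell (cospan_map_comp (pth01 a) (pth12 a)).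

Definition psquare_fst (x y x' y' : C) (u : hom x x') (v : hom y y')
    (a : twopath x y) (b : twopath x' y') (s : psquare u v a b) :
  tsquare u v (twopath_fst a) (twopath_fst b).
Proof. by exists (psq0 s) (psq1 s); exact: psq01. Defined.

Definition psquare_snd (x y x' y' : C) (u : hom x x') (v : hom y y')
    (a : twopath x y) (b : twopath x' y') (s : psquare u v a b) :
  tsquare u v (twopath_snd a) (twopath_snd b).
Proof. by exists (psq1 s) (psq2 s); exact: psq12. Defined.

Definition psquare_vcomp (x y x' y' : C) (u : hom x x') (v : hom y y')
    (a : twopath x y) (b : twopath x' y') (s : psquare u v a b) :
  tsquare u v (twopath_comp a) (twopath_comp b).
Proof.
by exists (psq0 s) (psq2 s); rewrite /= -compA psq12 compA psq01 compA.
Defined.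

Definition vcells_fst : functor vcells_cat cell_cat.
Proof.
by exists (fun A => Cell (twopath_fst (vc_c A)))
  (fun A B f => @CellMap (Cell (twopath_fst (vc_c A)))
     (Cell (twopath_fst (vc_c B))) _ _ (psquare_fst (vm_c f)))
  => *; apply: cell_map_ext.
Defined.

Definition vcells_snd : functor vcells_cat cell_cat.
Proof.
by exists (fun A => Cell (twopath_snd (vc_c A)))
  (fun A B f => @CellMap (Cell (twopath_snd (vc_c A)))
     (Cell (twopath_snd (vc_c B))) _ _ (psquare_snd (vm_c f)))
  => *; apply: cell_map_ext.
Defined.

Definition vcells_comp : functor vcells_cat cell_cat.
Proof.
by exists (fun A => Cell (twopath_comp (vc_c A)))
  (fun A B f => @CellMap (Cell (twopath_comp (vc_c A)))
     (Cell (twopath_comp (vc_c B))) _ _ (psquare_vcomp (vm_c f)))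
  => *; apply: cell_map_ext.
Defined.

Definition hcells_fst : functor hcells_cat cell_cat.
Proof.
by exists (fun A => Cell (hc_12 A))
  (fun A B f => @CellMap (Cell (hc_12 A)) (Cell (hc_12 B)) _ _ (hm_12 f)).
Defined.

Definition hcells_snd : functor hcells_cat cell_cat.
Proof.
by exists (fun A => Cell (hc_23 A))
  (fun A B f => @CellMap (Cell (hc_23 A)) (Cell (hc_23 B)) _ _ (hm_23 f)).
Defined.

Definition twocell_hcomp (x y z : C) (a : twocell x y) (b : twocell y z) :
    twocell x z := Twocell (cospan_map_hcomp P (cmor a) (cmor b)).

Definition tsquare_hcomp (x y z x' y' z' : C)
    (u : hom x x') (v : hom y y') (w : hom z z')
    (a : twocell x y) (a' : twocell x' y') (b : twocell y z)
    (b' : twocell y' z') (s : tsquare u v a a') (t : tsquare v w b b') :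
  tsquare u w (twocell_hcomp a b) (twocell_hcomp a' b').
Proof.
exists (square_hcomp P (sqs s) (sqs t)) (square_hcomp P (sqt s) (sqt t)).
apply: (copair_uniq P).
- by rewrite /= !compA !copair_inl -!compA !copair_inl !compA sqc.
- by rewrite /= !compA !copair_inr -!compA !copair_inr !compA sqc.
Defined.

Definition hcells_comp : functor hcells_cat cell_cat.
Proof.
exists (fun A => Cell (twocell_hcomp (hc_12 A) (hc_23 A)))
  (fun A B f => @CellMap (Cell (twocell_hcomp (hc_12 A) (hc_23 A)))
     (Cell (twocell_hcomp (hc_12 B) (hc_23 B))) _ _
     (tsquare_hcomp (hm_12 f) (hm_23 f)))
  => *; apply: cell_map_ext => //; apply: f_equal.
- exact: square_hcomp_id.
- exact: square_hcomp_id.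
- exact: square_hcomp_comp.
- exact: square_hcomp_comp.
Defined.

End Diagrams.

Section TwoCosp.

Variables (C : category) (P : pushouts C).

Definition TwoCosp : double_bicat_data := {|
  Obj := Cosp P;
  Mor := Cosp (row_po P);
  TwoMor := Cosp (cell_po P);
  srcM := Cosp_functor (row_left C) (row_po P) P;
  tgtM := Cosp_functor (row_right C) (row_po P) P;
  srcO := Cosp_functor (cell_left C) (cell_po P) P;
  tgtO := Cosp_functor (cell_right C) (cell_po P) P;
  srcT := Cosp_functor (cell_src C) (cell_po P) (row_po P);
  tgtT := Cosp_functor (cell_tgt C) (cell_po P) (row_po P);
  idO := Cosp_functor (row_of_id C) P (row_po P);
  idM := Cosp_functor (cell_of_id C) (row_po P) (cell_po P);
  MorMor := Cosp (row2_po P);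
  mm1 := Cosp_functor (row2_fst C) (row2_po P) (row_po P);
  mm2 := Cosp_functor (row2_snd C) (row2_po P) (row_po P);
  compM := Cosp_functor (row2_comp P) (row2_po P) (row_po P);
  TwoVert := Cosp (vcells_po P);
  vv1 := Cosp_functor (vcells_fst C) (vcells_po P) (cell_po P);
  vv2 := Cosp_functor (vcells_snd C) (vcells_po P) (cell_po P);
  compV := Cosp_functor (vcells_comp C) (vcells_po P) (cell_po P);
  TwoHoriz := Cosp (hcells_po P);
  hh1 := Cosp_functor (hcells_fst C) (hcells_po P) (cell_po P);
  hh2 := Cosp_functor (hcells_snd C) (hcells_po P) (cell_po P);
  compH := Cosp_functor (hcells_comp P) (hcells_po P) (cell_po P);
  MorMorMor := Cosp (row3_po P);
  mmm1 := Cosp_functor (row3_fst C) (row3_po P) (row_po P);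
  mmm2 := Cosp_functor (row3_snd C) (row3_po P) (row_po P);
  mmm3 := Cosp_functor (row3_thd C) (row3_po P) (row_po P);
  assocM := Cosp_functor (row3_assoc P) (row3_po P) (cell_po P);
  lunitM := Cosp_functor (row_lunit P) (row_po P) (cell_po P);
  runitM := Cosp_functor (row_runit P) (row_po P) (cell_po P) |}.

End TwoCosp.

(* Main.v *)
From Stdlib Require Import FunctionalExtensionality ProofIrrelevance JMeq.
From Stdlib Require Import IndefiniteDescription.
From mathcomp Require Import ssreflect ssrfun ssrbool.
Require Import Defs.

Set Implicit Arguments.
Unset Strict Implicit.
Unset Printing Implicit Defensive.

(** [Cosp] turns a functor preserving pushouts, i.e. with invertible comparison
    maps, into a weak 2-functor, strictly compatibly with composition, and turns
    a strict pullback of categories with pushouts into a pullback of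
    bicategories.  All structure 2-functors of [TwoCosp] are of this form; for
    the compositions this is the fact that pushouts commute with pushouts.

    A 2-functor into [Cosp (cell_po P)] is determined by its composites with the
    source and target 2-functors together with the cospan maps that it assigns
    to the objects and 1-cells of its domain, because a map of cospan maps is
    just a pair of maps making a square commute.  Hence every equation between
    generalized elements of [TwoMor] splits into equations between their sources
    and targets and an equation between cospan maps in [C], and the latter is
    one of the laws of the bicategory [Cosp P]. *)

(** * Weak 2-functors and pullbacks of bicategories *)

(** Equality of 2-functors is Leibniz equality of dependently typed data, so the components of an
    equation are extracted as [JMeq] and become plain equations only once objects and 1-cells have
    been identified. The laws are quantified over an arbitrary [T], whose 2-functors into cospans
    need not be induced by functors; equations between functors alone do not settle them, and values
    on objects and 1-cells have to be compared as well. Coherence cells impose no further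
    conditions: those of a composite are an invertible cell followed by an image, and the invertible
    cell cancels, so a jointly faithful pair of projections determines them. Pushouts of diagrams
    are the chosen pushouts of [C] taken pointwise, so projections preserve them strictly;
    horizontal composition preserves them only up to the canonical isomorphism. The pullbacks
    require choice: cells over a compatible pair are known merely to exist, while a 2-functor needs
    them as data. *)

Section Bicategories.

Variables (B : prebicat) (HB : is_bicat B).

Lemma iso2_inv_uniq (x y : B) (f g : cell1 x y) (a : cell2 f g)
    (b b' : cell2 g f) :
  vcomp b a = id2 g -> vcomp a b' = id2 f -> b = b'.
Proof.
move=> e e'.
by rewrite -(vcompc1 HB b) -e' (vcompA HB) e (vcomp1c HB).
Qed.

Lemma iso2_id2 (x y : B) (f : cell1 x y) : iso2 (id2 f).
Proof. by exists (id2 f); rewrite (vcomp1c HB). Qed.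

Lemma iso2_vcomp (x y : B) (f g h : cell1 x y) (a : cell2 f g) (b : cell2 g h) :
  iso2 a -> iso2 b -> iso2 (vcomp a b).
Proof.
case=> a' [aa' a'a] [b' [bb' b'b]]; exists (vcomp b' a'); split.
- by rewrite (vcompA HB) -(vcompA HB a) bb' (vcompc1 HB).
- by rewrite (vcompA HB) -(vcompA HB b') a'a (vcompc1 HB).
Qed.

Lemma iso2_hcomp (x y z : B) (f f' : cell1 x y) (g g' : cell1 y z)
    (a : cell2 f f') (b : cell2 g g') : iso2 a -> iso2 b -> iso2 (hcomp a b).
Proof.
case=> a' [aa' a'a] [b' [bb' b'b]]; exists (hcomp a' b').
by rewrite -!(hcomp_vcomp HB) aa' a'a bb' b'b !(hcomp_id2 HB).
Qed.

Lemma iso2_epi (x y : B) (f g h : cell1 x y) (a : cell2 f g)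
    (b b' : cell2 g h) : iso2 a -> vcomp a b = vcomp a b' -> b = b'.
Proof.
case=> a' [_ a'a] e.
by rewrite -(vcomp1c HB b) -(vcomp1c HB b') -a'a -!(vcompA HB) e.
Qed.

Lemma hcomp_vcompl (x y z : B) (f f' f'' : cell1 x y) (g : cell1 y z)
    (a : cell2 f f') (a' : cell2 f' f'') :
  hcomp (vcomp a a') (id2 g) = vcomp (hcomp a (id2 g)) (hcomp a' (id2 g)).
Proof. by rewrite -(hcomp_vcomp HB) (vcomp1c HB). Qed.

Lemma hcomp_vcompr (x y z : B) (f : cell1 x y) (g g' g'' : cell1 y z)
    (b : cell2 g g') (b' : cell2 g' g'') :
  hcomp (id2 f) (vcomp b b') = vcomp (hcomp (id2 f) b) (hcomp (id2 f) b').
Proof. by rewrite -(hcomp_vcomp HB) (vcomp1c HB). Qed.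

End Bicategories.

Lemma f2_iso2 (A B : prebicat) (F : prefun A B) (HF : is_weak_functor F)
    (x y : A) (f g : cell1 x y) (a : cell2 f g) : iso2 a -> iso2 (f2 F a).
Proof.
case=> b [ab ba]; exists (f2 F b).
by rewrite -!(f2_vcomp HF) ab ba !(f2_id2 HF).
Qed.

(** Both sides share the object and 1-cell maps [o] and [m], so the remaining components have the
    same types and no transport appears. *)
Lemma prefun_ext (A B : prebicat) (o : A -> B)
    (m : forall x y, cell1 x y -> cell1 (o x) (o y))
    (t t' : forall (x y : A) (f g : cell1 x y),
      cell2 f g -> cell2 (m _ _ f) (m _ _ g))
    (i i' : forall x, cell2 (id1 (o x)) (m _ _ (id1 x)))
    (c c' : forall (x y z : A) (f : cell1 x y) (g : cell1 y z),
      cell2 (comp1 (m _ _ f) (m _ _ g)) (m _ _ (comp1 f g))) :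
  (forall x y (f g : cell1 x y) (a : cell2 f g), t _ _ _ _ a = t' _ _ _ _ a) ->
  (forall x, i x = i' x) ->
  (forall x y z (f : cell1 x y) (g : cell1 y z), c _ _ _ f g = c' _ _ _ f g) ->
  @Prefun A B o m t i c = @Prefun A B o m t' i' c'.
Proof.
move=> et ei ec.
have -> : t = t'.
  by do 5 (apply: functional_extensionality_dep => ?); apply: et.
have -> : i = i' by apply: functional_extensionality_dep.
have -> // : c = c'.
by do 5 (apply: functional_extensionality_dep => ?); apply: ec.
Qed.

(** Not definitional: the two bracketings nest the coherence cells differently, and matching them
    takes functoriality of [H] on 2-cells and associativity of [vcomp]. *)
Lemma pcompA (A B C D : prebicat) (H : prefun C D) (G : prefun B C)
    (F : prefun A B) :
  is_bicat D -> is_weak_functor H -> H ∘ G ∘ F = H ∘ (G ∘ F).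
Proof.
move=> HD HH; apply: prefun_ext => //= *.
- by rewrite (f2_vcomp HH) (vcompA HD).
- by rewrite (f2_vcomp HH) (vcompA HD).
Qed.

Lemma pcomp_pid (A B : prebicat) (F : prefun A B) :
  is_bicat B -> is_weak_functor F -> F ∘ pid A = F.
Proof.
move=> HB HF; apply: prefun_ext => //= *;
  by rewrite (f2_id2 HF) (vcompc1 HB).
Qed.

Lemma pid_pcomp (A B : prebicat) (F : prefun A B) :
  is_bicat B -> pid B ∘ F = F.
Proof. by move=> HB; apply: prefun_ext => //= *; rewrite (vcomp1c HB). Qed.

Lemma pid_wf (A : prebicat) : is_bicat A -> is_weak_functor (pid A).
Proof.
move=> HA; split=> //= *.
- by rewrite (vcomp1c HA) (vcompc1 HA).
- exact: iso2_id2.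
- exact: iso2_id2.
- by rewrite !(hcomp_id2 HA) !(vcomp1c HA) (vcompc1 HA).
- by rewrite !(hcomp_id2 HA) !(vcomp1c HA).
- by rewrite !(hcomp_id2 HA) !(vcomp1c HA).
Qed.

Section Composition.

Variables (T A B : prebicat) (HA : is_bicat A) (HB : is_bicat B).
Variables (G : prefun A B) (HG : is_weak_functor G) (F : prefun T A).

(** The coherence laws of [G ∘ F] are the images under [G] of those of [F],
    preceded by an invertible cell built from the coherence cells of [G]. *)

Lemma pcomp_assocl (w x y z : T)
    (f : cell1 w x) (g : cell1 x y) (h : cell1 y z) :
  vcomp (vcomp (hcomp (fcomp (G ∘ F) f g) (id2 (f1 (G ∘ F) h)))
               (fcomp (G ∘ F) (comp1 f g) h)) (f2 (G ∘ F) (assoc f g h))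
  = vcomp (vcomp (hcomp (fcomp G (f1 F f) (f1 F g)) (id2 (f1 G (f1 F h))))
                 (fcomp G (comp1 (f1 F f) (f1 F g)) (f1 F h)))
      (f2 G (vcomp (vcomp (hcomp (fcomp F f g) (id2 (f1 F h)))
                     (fcomp F (comp1 f g) h)) (f2 F (assoc f g h)))).
Proof.
rewrite /= !(f2_vcomp HG) (hcomp_vcompl HB) !(vcompA HB).
rewrite -(f2_id2 HG) -!(vcompA HB); congr vcomp.
by rewrite [LHS](vcompA HB) (fcomp_nat HG) -(vcompA HB).
Qed.

Lemma pcomp_assocr (w x y z : T)
    (f : cell1 w x) (g : cell1 x y) (h : cell1 y z) :
  vcomp (assoc (f1 (G ∘ F) f) (f1 (G ∘ F) g) (f1 (G ∘ F) h))
    (vcomp (hcomp (id2 (f1 (G ∘ F) f)) (fcomp (G ∘ F) g h))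
           (fcomp (G ∘ F) f (comp1 g h)))
  = vcomp (vcomp (hcomp (fcomp G (f1 F f) (f1 F g)) (id2 (f1 G (f1 F h))))
                 (fcomp G (comp1 (f1 F f) (f1 F g)) (f1 F h)))
      (f2 G (vcomp (assoc (f1 F f) (f1 F g) (f1 F h))
        (vcomp (hcomp (id2 (f1 F f)) (fcomp F g h)) (fcomp F f (comp1 g h))))).
Proof.
rewrite (f2_vcomp HG) [RHS](vcompA HB) (fcomp_assoc HG) /=.
rewrite !(f2_vcomp HG) (hcomp_vcompr HB) -!(vcompA HB); congr vcomp.
rewrite -(f2_id2 HG); congr vcomp.
by rewrite !(vcompA HB) (fcomp_nat HG).
Qed.

Lemma pcomp_lunitl (x y : T) (f : cell1 x y) :
  vcomp (vcomp (hcomp (fid (G ∘ F) x) (id2 (f1 (G ∘ F) f)))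
               (fcomp (G ∘ F) (id1 x) f)) (f2 (G ∘ F) (lunit f))
  = vcomp (vcomp (hcomp (fid G (F x)) (id2 (f1 G (f1 F f))))
                 (fcomp G (id1 (F x)) (f1 F f)))
      (f2 G (vcomp (vcomp (hcomp (fid F x) (id2 (f1 F f)))
                     (fcomp F (id1 x) f)) (f2 F (lunit f)))).
Proof.
rewrite /= !(f2_vcomp HG) (hcomp_vcompl HB) -!(vcompA HB); congr vcomp.
by rewrite -(f2_id2 HG) !(vcompA HB) (fcomp_nat HG).
Qed.

Lemma pcomp_runitl (x y : T) (f : cell1 x y) :
  vcomp (vcomp (hcomp (id2 (f1 (G ∘ F) f)) (fid (G ∘ F) y))
               (fcomp (G ∘ F) f (id1 y))) (f2 (G ∘ F) (runit f))
  = vcomp (vcomp (hcomp (id2 (f1 G (f1 F f))) (fid G (F y)))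
                 (fcomp G (f1 F f) (id1 (F y))))
      (f2 G (vcomp (vcomp (hcomp (id2 (f1 F f)) (fid F y))
                     (fcomp F f (id1 y))) (f2 F (runit f)))).
Proof.
rewrite /= !(f2_vcomp HG) (hcomp_vcompr HB) -!(vcompA HB); congr vcomp.
by rewrite -(f2_id2 HG) !(vcompA HB) (fcomp_nat HG).
Qed.

Lemma pcomp_natl (x y z : T) (f f' : cell1 x y) (g g' : cell1 y z)
    (a : cell2 f f') (b : cell2 g g') :
  vcomp (hcomp (f2 (G ∘ F) a) (f2 (G ∘ F) b)) (fcomp (G ∘ F) f' g')
  = vcomp (fcomp G (f1 F f) (f1 F g))
      (f2 G (vcomp (hcomp (f2 F a) (f2 F b)) (fcomp F f' g'))).
Proof.
by rewrite /= (f2_vcomp HG) !(vcompA HB) (fcomp_nat HG).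
Qed.

Lemma pcomp_natr (x y z : T) (f f' : cell1 x y) (g g' : cell1 y z)
    (a : cell2 f f') (b : cell2 g g') :
  vcomp (fcomp (G ∘ F) f g) (f2 (G ∘ F) (hcomp a b))
  = vcomp (fcomp G (f1 F f) (f1 F g))
      (f2 G (vcomp (fcomp F f g) (f2 F (hcomp a b)))).
Proof. by rewrite /= (f2_vcomp HG) !(vcompA HB). Qed.

(** After the rewritings above, each law of [G ∘ F] is a law of [F] under [f2 G]. The same
    rewritings, read backwards, serve in [reflect_wf]. *)
Lemma pcomp_wf : is_weak_functor F -> is_weak_functor (G ∘ F).
Proof.
move=> HF; split=> *.
- by rewrite /= (f2_id2 HF) (f2_id2 HG).
- by rewrite /= (f2_vcomp HF) (f2_vcomp HG).
- by rewrite pcomp_natl pcomp_natr (fcomp_nat HF).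
- apply: (iso2_vcomp HB); first exact: (fid_iso HG).
  exact: (f2_iso2 HG (fid_iso HF _)).
- apply: (iso2_vcomp HB); first exact: (fcomp_iso HG).
  exact: (f2_iso2 HG (fcomp_iso HF _ _)).
- by rewrite pcomp_assocl pcomp_assocr (fcomp_assoc HF).
- by rewrite pcomp_lunitl (fcomp_lunit HF) (fcomp_lunit HG).
- by rewrite pcomp_runitl (fcomp_runit HF) (fcomp_runit HG).
Qed.

End Composition.

(** Applied to a coherence cell of [p ∘ w], which is one of [p] followed by the image of one of [w],
    it shows that image to be invertible. *)
Lemma iso2_cancel (B : prebicat) (HB : is_bicat B) (x y : B)
    (f g h : cell1 x y) (a : cell2 f g) (b : cell2 g h) :
  iso2 a -> iso2 (vcomp a b) -> iso2 b.
Proof.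
case=> a' [aa' a'a] [c [abc cab]].
have -> : b = vcomp a' (vcomp a b) by rewrite (vcompA HB) a'a (vcomp1c HB).
by apply: (iso2_vcomp HB); [exists a | exists c].
Qed.

(** * Pairs of 2-functors that are jointly faithful on 2-cells *)

Section JointlyFaithful.

Variables (E A B : prebicat) (HA : is_bicat A).
Variable HB : is_bicat B.
Variables (p : prefun E A) (q : prefun E B).
Hypotheses (Hp : is_weak_functor p) (Hq : is_weak_functor q).
Hypothesis faithful : forall (e e' : E) (k k' : cell1 e e') (a b : cell2 k k'),
  f2 p a = f2 p b -> f2 q a = f2 q b -> a = b.
Variable T : prebicat.

(** Joint faithfulness handles 2-cells directly. A coherence cell of [p ∘ w] is one of [p] followed
    by the [p]-image of one of [w]; cancelling the former by [iso2_epi] leaves images to which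
    faithfulness applies. *)
Lemma prefun_eq (w w' : prefun T E) :
  (forall x, w x = w' x) ->
  (forall x y (k : cell1 x y), JMeq (f1 w k) (f1 w' k)) ->
  p ∘ w = p ∘ w' -> q ∘ w = q ∘ w' -> w = w'.
Proof.
case: w => o m t i c; case: w' => o' m' t' i' c' /= e0 e1.
have e := functional_extensionality _ _ e0; subst o'.
have e : m = m'.
  by do 3 (apply: functional_extensionality_dep => ?); apply: JMeq_eq.
subst m' => ep eq; apply: prefun_ext.
- move=> x y f g a; apply: faithful; apply: JMeq_eq.
  + exact: (eq_ind _ (fun F : prefun T A => JMeq _ (f2 F a)) JMeq_refl _ ep).
  (* The type of [f2 F a] varies with [F], so the component is transported along [ep]
     heterogeneously; [JMeq_eq] applies because [o] and [m] are already shared. *)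
  + exact: (eq_ind _ (fun F : prefun T B => JMeq _ (f2 F a)) JMeq_refl _ eq).
- move=> x; apply: faithful.
  + apply: (iso2_epi HA (fid_iso Hp (o x))); apply: JMeq_eq.
    exact: (eq_ind _ (fun F : prefun T A => JMeq _ (fid F x)) JMeq_refl _ ep).
  + apply: (iso2_epi HB (fid_iso Hq (o x))); apply: JMeq_eq.
    exact: (eq_ind _ (fun F : prefun T B => JMeq _ (fid F x)) JMeq_refl _ eq).
- move=> x y z f g; apply: faithful.
  + apply: (iso2_epi HA (fcomp_iso Hp (m _ _ f) (m _ _ g))); apply: JMeq_eq.
    exact: (eq_ind _ (fun F : prefun T A => JMeq _ (fcomp F f g))
      JMeq_refl _ ep).
  + apply: (iso2_epi HB (fcomp_iso Hq (m _ _ f) (m _ _ g))); apply: JMeq_eq.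
    exact: (eq_ind _ (fun F : prefun T B => JMeq _ (fcomp F f g))
      JMeq_refl _ eq).
Qed.

Hypothesis reflects : forall (e e' : E) (k k' : cell1 e e') (a : cell2 k k'),
  iso2 (f2 p a) -> iso2 (f2 q a) -> iso2 a.

(** Each equational law of [w] can be tested after [p] and [q], where it is the law of [p ∘ w] or
    [q ∘ w] up to an invertible prefix; invertibility of the coherence cells is reflected. *)
Lemma reflect_wf (w : prefun T E) :
  is_weak_functor (p ∘ w) -> is_weak_functor (q ∘ w) -> is_weak_functor w.
Proof.
move=> Hpw Hqw; split.
- move=> *; apply: faithful; rewrite (f2_id2 Hp, f2_id2 Hq).
  + exact: (f2_id2 Hpw).
  + exact: (f2_id2 Hqw).
- move=> *; apply: faithful; rewrite (f2_vcomp Hp, f2_vcomp Hq).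
  + exact: (f2_vcomp Hpw).
  + exact: (f2_vcomp Hqw).
- move=> *; apply: faithful.
  + by apply: (iso2_epi HA (fcomp_iso Hp _ _));
      rewrite -(pcomp_natl HA Hp) -(pcomp_natr HA Hp) (fcomp_nat Hpw).
  + by apply: (iso2_epi HB (fcomp_iso Hq _ _));
      rewrite -(pcomp_natl HB Hq) -(pcomp_natr HB Hq) (fcomp_nat Hqw).
- move=> *; apply: reflects.
  + exact: (iso2_cancel HA (fid_iso Hp _) (fid_iso Hpw _)).
  + exact: (iso2_cancel HB (fid_iso Hq _) (fid_iso Hqw _)).
- move=> *; apply: reflects.
  + exact: (iso2_cancel HA (fcomp_iso Hp _ _) (fcomp_iso Hpw _ _)).
  + exact: (iso2_cancel HB (fcomp_iso Hq _ _) (fcomp_iso Hqw _ _)).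
- move=> ? ? ? ? f g h; apply: faithful.
  + have := fcomp_assoc Hpw f g h.
    rewrite (pcomp_assocl HA Hp) (pcomp_assocr HA Hp); apply: (iso2_epi HA).
    apply: (iso2_vcomp HA); last exact: (fcomp_iso Hp).
    by apply: (iso2_hcomp HA); [exact: (fcomp_iso Hp) | exact: iso2_id2].
  + have := fcomp_assoc Hqw f g h.
    rewrite (pcomp_assocl HB Hq) (pcomp_assocr HB Hq); apply: (iso2_epi HB).
    apply: (iso2_vcomp HB); last exact: (fcomp_iso Hq).
    by apply: (iso2_hcomp HB); [exact: (fcomp_iso Hq) | exact: iso2_id2].
- move=> x y f; apply: faithful.
  + have := fcomp_lunit Hpw f.
    (* The unitor on the right is expanded by the unit law of [p], so that both sides start with the
       same invertible prefix. *)
    rewrite (pcomp_lunitl HA Hp) -(fcomp_lunit Hp); apply: (iso2_epi HA).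
    apply: (iso2_vcomp HA); last exact: (fcomp_iso Hp).
    by apply: (iso2_hcomp HA); [exact: (fid_iso Hp) | exact: iso2_id2].
  + have := fcomp_lunit Hqw f.
    rewrite (pcomp_lunitl HB Hq) -(fcomp_lunit Hq); apply: (iso2_epi HB).
    apply: (iso2_vcomp HB); last exact: (fcomp_iso Hq).
    by apply: (iso2_hcomp HB); [exact: (fid_iso Hq) | exact: iso2_id2].
- move=> x y f; apply: faithful.
  + have := fcomp_runit Hpw f.
    rewrite (pcomp_runitl HA Hp) -(fcomp_runit Hp); apply: (iso2_epi HA).
    apply: (iso2_vcomp HA); last exact: (fcomp_iso Hp).
    by apply: (iso2_hcomp HA); [exact: iso2_id2 | exact: (fid_iso Hp)].
  + have := fcomp_runit Hqw f.
    rewrite (pcomp_runitl HB Hq) -(fcomp_runit Hq); apply: (iso2_epi HB).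
    apply: (iso2_vcomp HB); last exact: (fcomp_iso Hq).
    by apply: (iso2_hcomp HB); [exact: iso2_id2 | exact: (fid_iso Hq)].
Qed.

End JointlyFaithful.

(** Uniqueness of inverses, stated across two equal but not convertible 2-functors: it makes
    inverses found separately in [A] and [B] agree over [D]. *)
Lemma iso2_JMeq (A B : prebicat) (HB : is_bicat B) (F F' : prefun A B) :
  F = F' -> forall (x y : A) (k l : cell1 x y) (a : cell2 k l)
    (b : cell2 (f1 F l) (f1 F k)) (b' : cell2 (f1 F' l) (f1 F' k)),
  vcomp (f2 F a) b = id2 (f1 F k) -> vcomp b' (f2 F' a) = id2 (f1 F' l) ->
  JMeq b b'.
Proof.
by move=> <- x y k l a b b' e e'; rewrite (iso2_inv_uniq HB e' e).
Qed.

(** Cancellation of a coherence cell in a heterogeneous equation. It is used with [f ∘ p] and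
    [g ∘ q] as [F] and [F'], as is [fcomp_JMeq]. *)
Lemma fid_JMeq (A B : prebicat) (HB : is_bicat B) (F F' : prefun A B) :
  is_weak_functor F -> F = F' ->
  forall (x : A) (k : cell1 x x) (a : cell2 (f1 F (id1 x)) (f1 F k))
    (a' : cell2 (f1 F' (id1 x)) (f1 F' k)),
  JMeq (vcomp (fid F x) a) (vcomp (fid F' x) a') -> JMeq a a'.
Proof.
move=> HF <- x k a a' e.
by rewrite (iso2_epi HB (fid_iso HF x) (JMeq_eq e)).
Qed.

Lemma fcomp_JMeq (A B : prebicat) (HB : is_bicat B) (F F' : prefun A B) :
  is_weak_functor F -> F = F' ->
  forall (x y z : A) (f : cell1 x y) (g : cell1 y z) (k : cell1 x z)
    (a : cell2 (f1 F (comp1 f g)) (f1 F k))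
    (a' : cell2 (f1 F' (comp1 f g)) (f1 F' k)),
  JMeq (vcomp (fcomp F f g) a) (vcomp (fcomp F' f g) a') -> JMeq a a'.
Proof.
move=> HF <- x y z f g k a a' e.
by rewrite (iso2_epi HB (fcomp_iso HF f g) (JMeq_eq e)).
Qed.

Lemma iso2_factor (B : prebicat) (HB : is_bicat B) (x y : B)
    (f g h : cell1 x y) (a : cell2 f g) (b : cell2 f h) :
  iso2 a -> exists c, vcomp a c = b.
Proof.
case=> a' [aa' _]; exists (vcomp a' b).
by rewrite (vcompA HB) aa' (vcomp1c HB).
Qed.

(** * Recognising strict pullbacks of bicategories dimension by dimension *)

Section Pullback.

Variables (E A B D : prebicat).
Variables (p : prefun E A) (q : prefun E B) (f : prefun A D) (g : prefun B D).
Hypotheses (HA : is_bicat A) (HB : is_bicat B).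
Hypotheses (HD : is_bicat D) (Hp : is_weak_functor p) (Hq : is_weak_functor q).
Hypotheses (Hf : is_weak_functor f) (Hg : is_weak_functor g).
Hypothesis fp : f ∘ p = g ∘ q.

(** Gluing and separation for cells of dimension 0, 1 and 2. The boundary is fixed in [E], and
    agreement over [D] is [JMeq] since [f (p e)] and [g (q e)] are equal without being
    convertible. *)
Hypothesis ex0 : forall a b, f a = g b -> exists e, p e = a /\ q e = b.
Hypothesis uniq0 : forall e e', p e = p e' -> q e = q e' -> e = e'.
Hypothesis ex1 : forall e e' (a : cell1 (p e) (p e')) (b : cell1 (q e) (q e')),
  JMeq (f1 f a) (f1 g b) -> exists k : cell1 e e', f1 p k = a /\ f1 q k = b.
Hypothesis uniq1 : forall e e' (k k' : cell1 e e'),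
  f1 p k = f1 p k' -> f1 q k = f1 q k' -> k = k'.
Hypothesis ex2 : forall e e' (k l : cell1 e e') (a : cell2 (f1 p k) (f1 p l))
    (b : cell2 (f1 q k) (f1 q l)),
  JMeq (f2 f a) (f2 g b) -> exists c : cell2 k l, f2 p c = a /\ f2 q c = b.
Hypothesis uniq2 : forall e e' (k l : cell1 e e') (c c' : cell2 k l),
  f2 p c = f2 p c' -> f2 q c = f2 q c' -> c = c'.

Lemma pullback_uniq (T : prebicat) (w w' : prefun T E) :
  p ∘ w = p ∘ w' -> q ∘ w = q ∘ w' -> w = w'.
Proof.
move=> ep eq.
have e0 x : w x = w' x.
  by apply: uniq0; [apply: (f_equal (fun F : prefun T A => F x) ep)
                   | apply: (f_equal (fun F : prefun T B => F x) eq)].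
apply: (prefun_eq HA HB Hp Hq uniq2 e0 _ ep eq) => x y k.
have: JMeq (f1 p (f1 w k)) (f1 p (f1 w' k)).
  exact: (eq_ind _ (fun F : prefun T A => JMeq _ (f1 F k)) JMeq_refl _ ep).
have: JMeq (f1 q (f1 w k)) (f1 q (f1 w' k)).
  exact: (eq_ind _ (fun F : prefun T B => JMeq _ (f1 F k)) JMeq_refl _ eq).
(* Abstracting the two 1-cells allows their endpoints to be rewritten by [e0]; the [JMeq] hypotheses
   then become homogeneous. *)
move: (f1 w k) (f1 w' k); rewrite !e0 => l l' eq' ep'.
by rewrite (uniq1 (JMeq_eq ep') (JMeq_eq eq')).
Qed.

(** The inverses of the two images agree over [D] because inverses are unique there, hence they glue
    to a 2-cell of [E]. *)
Lemma pullback_reflects (e e' : E) (k l : cell1 e e') (c : cell2 k l) :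
  iso2 (f2 p c) -> iso2 (f2 q c) -> iso2 c.
Proof.
case=> a [ca ac] [b [cb bc]].
have /ex2 [d [dp dq]] : JMeq (f2 f a) (f2 g b).
  apply: (iso2_JMeq HD fp (a := c)) => /=.
  - by rewrite -(f2_vcomp Hf) ca (f2_id2 Hf).
  - by rewrite -(f2_vcomp Hg) bc (f2_id2 Hg).
exists d; split; apply: uniq2;
  by rewrite ?(f2_vcomp Hp) ?(f2_vcomp Hq) ?(f2_id2 Hp) ?(f2_id2 Hq) ?dp ?dq.
Qed.

(** The data of [w] are chosen by dimension. After each choice [u] and [v] are replaced by the
    images of what was chosen, so that the next dimension is posed over a boundary in [E]. *)
Lemma pullback_ex (T : prebicat) (u : prefun T A) (v : prefun T B) :
  f ∘ u = g ∘ v -> exists w : prefun T E, p ∘ w = u /\ q ∘ w = v.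
Proof.
case: u => u0 u1 u2 ui uc; case: v => v0 v1 v2 vi vc e.
have [w0 Hw0] : exists w0 : T -> E,
    forall x, p (w0 x) = u0 x /\ q (w0 x) = v0 x.
  apply: (functional_choice (fun x y => p y = u0 x /\ q y = v0 x)) => x.
  apply: ex0.
  exact: (f_equal (fun F : prefun T D => F x) e).
have e0 : u0 = fun x => p (w0 x).
  by apply: functional_extensionality => x; case: (Hw0 x).
have e0' : v0 = fun x => q (w0 x).
  by apply: functional_extensionality => x; case: (Hw0 x).
subst u0 v0 => {Hw0}.
have Hex1 x y (k : cell1 x y) :
    exists l : cell1 (w0 x) (w0 y), f1 p l = u1 _ _ k /\ f1 q l = v1 _ _ k.
  apply: ex1.
  exact: (eq_ind _ (fun F : prefun T D => JMeq _ (f1 F k)) JMeq_refl _ e).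
(* The type of the chosen 1-cell depends on its endpoints, which [functional_choice] does not cover;
   indefinite description selects each value separately. *)
pose w1 x y (k : cell1 x y) := proj1_sig (constructive_indefinite_description _
  (Hex1 x y k)).
have Hw1 x y (k : cell1 x y) :
    f1 p (w1 x y k) = u1 _ _ k /\ f1 q (w1 x y k) = v1 _ _ k.
  exact: (proj2_sig (constructive_indefinite_description _ (Hex1 x y k))).
move: w1 Hw1 => {Hex1} w1 Hw1.
have e1 : u1 = fun x y k => f1 p (w1 x y k).
  do 3 (apply: functional_extensionality_dep => ?); apply: esym.
  exact: (proj1 (Hw1 _ _ _)).
have e1' : v1 = fun x y k => f1 q (w1 x y k).
  do 3 (apply: functional_extensionality_dep => ?); apply: esym.
  exact: (proj2 (Hw1 _ _ _)).
subst u1 v1 => {Hw1}.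
have Hex2 x y (k l : cell1 x y) (a : cell2 k l) :
    exists c : cell2 (w1 _ _ k) (w1 _ _ l),
    f2 p c = u2 _ _ _ _ a /\ f2 q c = v2 _ _ _ _ a.
  apply: ex2.
  exact: (eq_ind _ (fun F : prefun T D => JMeq _ (f2 F a)) JMeq_refl _ e).
have Hexi x : exists c : cell2 (id1 (w0 x)) (w1 _ _ (id1 x)),
    vcomp (fid p (w0 x)) (f2 p c) = ui x /\
    vcomp (fid q (w0 x)) (f2 q c) = vi x.
  (* The identity cell of [p ∘ w] begins with [fid p], so what must be lifted to [E] is [ui x]
     divided by that cell, and likewise for [q]. *)
  have [a ea] := iso2_factor HA (ui x) (fid_iso Hp (w0 x)).
  have [b eb] := iso2_factor HB (vi x) (fid_iso Hq (w0 x)).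
  suff [c [e1 e2]] : exists c : cell2 (id1 (w0 x)) (w1 _ _ (id1 x)),
      f2 p c = a /\ f2 q c = b by exists c; rewrite e1 e2.
  apply: ex2; apply: (fid_JMeq HD (pcomp_wf HD Hf Hp) fp (x := w0 x)).
  rewrite /= -!(vcompA HD) -(f2_vcomp Hf) -(f2_vcomp Hg) ea eb.
  exact: (eq_ind _ (fun F : prefun T D => JMeq _ (fid F x)) JMeq_refl _ e).
have Hexc x y z (k : cell1 x y) (l : cell1 y z) :
    exists c : cell2 (comp1 (w1 _ _ k) (w1 _ _ l)) (w1 _ _ (comp1 k l)),
    vcomp (fcomp p _ _) (f2 p c) = uc _ _ _ k l /\
    vcomp (fcomp q _ _) (f2 q c) = vc _ _ _ k l.
  have [a ea] := iso2_factor HA (uc _ _ _ k l)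
    (fcomp_iso Hp (w1 _ _ k) (w1 _ _ l)).
  have [b eb] := iso2_factor HB (vc _ _ _ k l)
    (fcomp_iso Hq (w1 _ _ k) (w1 _ _ l)).
  suff [c [e1 e2]] : exists c :
      cell2 (comp1 (w1 _ _ k) (w1 _ _ l)) (w1 _ _ (comp1 k l)),
      f2 p c = a /\ f2 q c = b by exists c; rewrite e1 e2.
  apply: ex2.
  apply: (fcomp_JMeq HD (pcomp_wf HD Hf Hp) fp (f := w1 _ _ k) (g := w1 _ _ l)).
  rewrite /= -!(vcompA HD) -(f2_vcomp Hf) -(f2_vcomp Hg) ea eb.
  exact: (eq_ind _ (fun F : prefun T D => JMeq _ (fcomp F k l)) JMeq_refl _ e).
pose cid A0 P0 (H : exists x, P0 x) :=
  @constructive_indefinite_description A0 P0 H.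
exists (@Prefun T E w0 w1
  (fun _ _ _ _ a => proj1_sig (cid _ _ (Hex2 _ _ _ _ a)))
  (fun x => proj1_sig (cid _ _ (Hexi x)))
  (fun _ _ _ k l => proj1_sig (cid _ _ (Hexc _ _ _ k l)))).
split; apply: prefun_ext => /= *.
- exact: (proj1 (proj2_sig (cid _ _ (Hex2 _ _ _ _ _)))).
- exact: (proj1 (proj2_sig (cid _ _ (Hexi _)))).
- exact: (proj1 (proj2_sig (cid _ _ (Hexc _ _ _ _ _)))).
- exact: (proj2 (proj2_sig (cid _ _ (Hex2 _ _ _ _ _)))).
- exact: (proj2 (proj2_sig (cid _ _ (Hexi _)))).
- exact: (proj2 (proj2_sig (cid _ _ (Hexc _ _ _ _ _)))).
Qed.

(** [pullback_ex] glues bare data; weakness of the result is reflected from its composites with [p]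
    and [q]. *)
Lemma pullback_intro : is_pullback p q f g.
Proof.
split=> // T u v HT Hu Hv e; have [w [ew ew']] := pullback_ex e.
exists w; split.
  split=> //; apply: (reflect_wf HA HB Hp Hq uniq2 pullback_reflects);
    by rewrite (ew, ew').
by move=> w' [_ e1 e2]; apply: pullback_uniq; rewrite (e1, e2).
Qed.

End Pullback.

(** * The bicategory of cospans *)

Definition functor_id (C : category) : functor C C :=
  @Functor C C (fun x => x) (fun _ _ f => f) (fun _ => erefl)
    (fun _ _ _ _ _ => erefl).

Definition functor_comp (C D E : category) (G : functor D E) (F : functor C D) :
  functor C E.
Proof.
exists (fun x => G (F x)) (fun _ _ f => fmap G (fmap F f)) => *.
- by rewrite !fmap1.
- by rewrite !fmapM.
Defined.

Lemma functor_ext (C D : category) (F G : functor C D) :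
  (forall x, F x = G x) ->
  (forall x y (f : hom x y), JMeq (fmap F f) (fmap G f)) -> F = G.
Proof.
case: F => o m m1 mM; case: G => o' m' m1' mM' /= e0 e1.
have e := functional_extensionality _ _ e0; subst o'.
have e : m = m'.
  by do 3 (apply: functional_extensionality_dep => ?); apply: JMeq_eq.
subst m'.
by rewrite (proof_irrelevance _ m1 m1') (proof_irrelevance _ mM mM').
Qed.

Definition is_iso (C : category) (x y : C) (f : hom x y) : Prop :=
  exists g : hom y x, f ;; g = idm x /\ g ;; f = idm y.

Lemma is_iso_id (C : category) (x : C) : is_iso (idm x).
Proof. by exists (idm x); rewrite comp1m. Qed.

Lemma is_iso_comp (C : category) (x y z : C) (f : hom x y) (g : hom y z) :
  is_iso f -> is_iso g -> is_iso (f ;; g).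
Proof.
case=> f' [ff' f'f] [g' [gg' g'g]]; exists (g' ;; f'); split.
- by rewrite compA -(compA f) gg' compm1.
- by rewrite compA -(compA g') f'f compm1.
Qed.

Lemma is_iso_cancel (C : category) (x y z : C) (f : hom x y) (g : hom y z) :
  is_iso f -> is_iso (f ;; g) -> is_iso g.
Proof.
case=> f' [ff' f'f] [h [fgh hfg]].
have -> : g = f' ;; (f ;; g) by rewrite compA f'f comp1m.
by apply: is_iso_comp; [exists f | exists h].
Qed.

Lemma is_iso_fmap (C D : category) (F : functor C D) (x y : C) (f : hom x y) :
  is_iso f -> is_iso (fmap F f).
Proof.
by case=> g [fg gf]; exists (fmap F g); rewrite -!fmapM fg gf !fmap1.
Qed.

Lemma inv_uniq (C : category) (x y : C) (f : hom x y) (g g' : hom y x) :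
  g ;; f = idm y -> f ;; g' = idm x -> g = g'.
Proof. by move=> e e'; rewrite -(compm1 g) -e' compA e comp1m. Qed.

Section PushoutRules.

Variables (C : category) (P : pushouts C).

(** The copairing rules for right-associated composites, the normal form into which [po_simpl]
    rewrites. *)
Lemma copair_inl_comp (x a b z t : C) (f : hom x a) (g : hom x b)
    (u : hom a z) (v : hom b z) (e : f ;; u = g ;; v) (h : hom z t) :
  inl P f g ;; (copair P e ;; h) = u ;; h.
Proof. by rewrite compA copair_inl. Qed.

Lemma copair_inr_comp (x a b z t : C) (f : hom x a) (g : hom x b)
    (u : hom a z) (v : hom b z) (e : f ;; u = g ;; v) (h : hom z t) :
  inr P f g ;; (copair P e ;; h) = v ;; h.
Proof. by rewrite compA copair_inr. Qed.

Definition poE := (@copair_inl C P, @copair_inr C P, @copair_inl_comp,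
  @copair_inr_comp).

End PushoutRules.

Ltac po_simpl P :=
  repeat progress rewrite /= -?compA ?(poE P) ?comp1m ?compm1 -?fmapM ?fmap1.

Section Cospans.

Variables (C : category) (P : pushouts C).

(** The inverse of the underlying arrow commutes with the legs automatically. *)
Lemma cospan_iso2 (x y : C) (f g : cospan x y) (a : cospan_map f g) :
  is_iso (cmap a) -> iso2 (B := Cosp P) a.
Proof.
case=> b [ab ba].
have bl : legl g ;; b = legl f by rewrite -(cmap_l a) -compA ab compm1.
have br : legr g ;; b = legr f by rewrite -(cmap_r a) -compA ab compm1.
by exists (CospanMap bl br); split; apply: cospan_map_ext.
Qed.

(** The inverse is the mirror image of the associator: [e] allows the inner copairing out of
    [g ⊔ h], and [e'] the outer one out of [f ⊔ (g ⊔ h)]. *)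
Lemma cospan_assoc_is_iso (w x y z : C)
    (f : cospan w x) (g : cospan x y) (h : cospan y z) :
  is_iso (cospan_assoc P f g h).
Proof.
set fg := cospan_comp P f g; set gh := cospan_comp P g h.
have e : legr g ;; (inr P (legr f) (legl g) ;; inl P (legr fg) (legl h))
    = legl h ;; inr P (legr fg) (legl h).
  by rewrite compA po_comm.
have e' : legr f ;; (inl P (legr f) (legl g) ;; inl P (legr fg) (legl h))
    = legl gh ;; copair P e.
  by rewrite /= -compA copair_inl !compA po_comm.
exists (copair P e'); rewrite {}/fg {}/gh in e e' *; split.
- by apply: (copair_uniq P); first apply: (copair_uniq P);
    po_simpl P.
- apply: (copair_uniq P); last apply: (copair_uniq P);
    by po_simpl P.
Qed.

Lemma cospan_lunit_is_iso (x y : C) (f : cospan x y) :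
  is_iso (cospan_lunit P f).
Proof.
exists (inr P (idm x) (legl f)); rewrite poE; split=> //.
apply: (copair_uniq P); po_simpl P => //; rewrite -po_comm.
by rewrite comp1m.
Qed.

Lemma cospan_runit_is_iso (x y : C) (f : cospan x y) :
  is_iso (cospan_runit P f).
Proof.
exists (inl P (legr f) (idm y)); rewrite poE; split=> //.
apply: (copair_uniq P); po_simpl P => //; rewrite po_comm.
by rewrite comp1m.
Qed.

(** Each equation involving a pushout compares two maps out of it, possibly iterated, and is checked
    on the injections of the apices. *)
Lemma Cosp_bicat : is_bicat (Cosp P).
Proof.
split=> *.
- by apply: cospan_map_ext; apply: comp1m.
- by apply: cospan_map_ext; apply: compm1.
- by apply: cospan_map_ext; apply: compA.
- by apply: cospan_map_ext; apply: (copair_uniq P); po_simpl P.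
- by apply: cospan_map_ext; apply: (copair_uniq P); po_simpl P.
- by apply: cospan_map_ext; apply: (copair_uniq P);
    first apply: (copair_uniq P); po_simpl P.
(* On the identity component, naturality of the unitor is the compatibility of the 2-cell with the
   left leg. *)
- by apply: cospan_map_ext; apply: (copair_uniq P); po_simpl P; rewrite ?cmap_l.
- by apply: cospan_map_ext; apply: (copair_uniq P); po_simpl P; rewrite ?cmap_r.
- by apply: cospan_iso2; apply: cospan_assoc_is_iso.
- by apply: cospan_iso2; apply: cospan_lunit_is_iso.
- by apply: cospan_iso2; apply: cospan_runit_is_iso.
- by apply: cospan_map_ext; do ! (apply: (copair_uniq P));
    po_simpl P.
(* In the triangle the middle identity cospan goes to [legl g ;; inr] along one path and
   [legr f ;; inl] along the other, which the pushout square identifies. *)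
- apply: cospan_map_ext; do 2? (apply: (copair_uniq P)); po_simpl P => //.
  by rewrite po_comm.
Qed.

End Cospans.

(** * Preservation of pushouts and the induced weak 2-functors *)

Section Comparison.

Variables (C D : category) (F : functor C D) (P : pushouts C) (Q : pushouts D).

Lemma po_compare_comm (x a b : C) (f : hom x a) (g : hom x b) :
  fmap F f ;; fmap F (inl P f g) = fmap F g ;; fmap F (inr P f g).
Proof. by rewrite -!fmapM po_comm. Qed.

Definition po_compare (x a b : C) (f : hom x a) (g : hom x b) :
    hom (po Q (fmap F f) (fmap F g)) (F (po P f g)) :=
  copair Q (po_compare_comm f g).

Definition preserves_po : Prop :=
  forall (x a b : C) (f : hom x a) (g : hom x b), is_iso (po_compare f g).

Lemma map_cospan_compE (x y z : C) (f : cospan x y) (g : cospan y z) :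
  cmap (map_cospan_comp F P Q f g) = po_compare (legr f) (legl g).
Proof.
by apply: (copair_uniq Q); rewrite /po_compare ?copair_inl ?copair_inr /=
  ?copair_inl ?copair_inr.
Qed.

(** Preservation of pushouts is what makes [fcomp] invertible. The coherence equations compare maps
    out of pushouts in [D] and are settled on the injections. *)
Lemma Cosp_functor_wf : preserves_po -> is_weak_functor (Cosp_functor F P Q).
Proof.
move=> HF; split=> *.
- by apply: cospan_map_ext; apply: fmap1.
- by apply: cospan_map_ext; apply: fmapM.
- by apply: cospan_map_ext; apply: (copair_uniq Q); po_simpl Q; po_simpl P.
- by apply: cospan_iso2; apply: is_iso_id.
- by apply: cospan_iso2; rewrite map_cospan_compE; apply: HF.
- by apply: cospan_map_ext; do 2? (apply: (copair_uniq Q));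
    po_simpl Q; po_simpl P.
- by apply: cospan_map_ext; apply: (copair_uniq Q); po_simpl Q; po_simpl P.
- by apply: cospan_map_ext; apply: (copair_uniq Q); po_simpl Q; po_simpl P.
Qed.

End Comparison.

Lemma Cosp_functor_id (C : category) (P : pushouts C) :
  Cosp_functor (functor_id C) P P = pid (Cosp P).
Proof.
apply: prefun_ext => *; apply: cospan_map_ext => //.
by apply: (copair_uniq P); po_simpl P.
Qed.

(** The equality includes the coherence cells: the composite comparison map and the direct one have
    the same restrictions to both injections. This reduces equations between structure 2-functors to
    equations between functors. *)
Lemma Cosp_functor_comp (C D E : category) (G : functor D E) (F : functor C D)
    (P : pushouts C) (Q : pushouts D) (R : pushouts E) :
  Cosp_functor G Q R ∘ Cosp_functor F P Q = Cosp_functor (functor_comp G F) P R.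
Proof.
apply: prefun_ext => *; apply: cospan_map_ext => //=.
- by rewrite comp1m fmap1.
- by apply: (copair_uniq R);
    rewrite /= compA ?copair_inl ?copair_inr -fmapM ?copair_inl ?copair_inr.
Qed.

Section PreservesComp.

Variables (C D E : category) (G : functor D E) (F : functor C D).
Variables (P : pushouts C) (Q : pushouts D) (R : pushouts E).

Lemma po_compare_comp (x a b : C) (f : hom x a) (g : hom x b) :
  po_compare (functor_comp G F) P R f g
  = po_compare G Q R (fmap F f) (fmap F g) ;; fmap G (po_compare F P Q f g).
Proof.
by apply: (copair_uniq R);
  rewrite /po_compare; po_simpl R; po_simpl Q.
Qed.

Lemma preserves_po_comp :
  preserves_po F P Q -> preserves_po G Q R ->
  preserves_po (functor_comp G F) P R.
Proof.
move=> HF HG x a b f g; rewrite po_compare_comp.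
apply: is_iso_comp; first exact: HG.
exact: (is_iso_fmap G (HF _ _ _ _ _)).
Qed.

(** Two out of three for the factorization of the comparison map. With a family of functors [G] that
    jointly reflects isomorphisms, it yields preservation by [F]. *)
Lemma preserves_po_cancel :
  preserves_po G Q R -> preserves_po (functor_comp G F) P R ->
  forall (x a b : C) (f : hom x a) (g : hom x b),
  is_iso (fmap G (po_compare F P Q f g)).
Proof.
move=> HG HGF x a b f g.
by apply: (is_iso_cancel (HG _ _ _ (fmap F f) (fmap F g)));
  rewrite -po_compare_comp; apply: HGF.
Qed.

End PreservesComp.

Lemma preserves_po_id (C : category) (P : pushouts C) :
  preserves_po (functor_id C) P P.
Proof.
move=> x a b f g; suff -> : po_compare (functor_id C) P P f g = idm (po P f g).
  exact: is_iso_id.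
by apply: (copair_uniq P); rewrite /po_compare; po_simpl P.
Qed.

Lemma cospan_JMeq (C : category) (x x' y y' : C) (f : cospan x y)
    (f' : cospan x' y') :
  x = x' -> y = y' -> JMeq f f' ->
  [/\ apex f = apex f', JMeq (legl f) (legl f') & JMeq (legr f) (legr f')].
Proof. by move=> ex ey; subst x' y' => e; rewrite (JMeq_eq e). Qed.

(** The legs are typed over the apex; passing through [JMeq] avoids equalities of dependent
    pairs. *)
Lemma cospan_inj (C : category) (x y a : C) (l l' : hom x a) (r r' : hom y a) :
  Cospan a l r = Cospan a l' r' -> l = l' /\ r = r'.
Proof.
move=> e; have ej : JMeq (Cospan a l r) (Cospan a l' r') by rewrite e.
by have [_ /= el er] := cospan_JMeq erefl erefl ej; split; apply: JMeq_eq.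
Qed.

Lemma cospan_map_JMeq (C : category) (x x' y y' : C) (f g : cospan x y)
    (f' g' : cospan x' y') (a : cospan_map f g) (a' : cospan_map f' g') :
  x = x' -> y = y' -> JMeq f f' -> JMeq g g' -> JMeq a a' ->
  JMeq (cmap a) (cmap a').
Proof.
move=> ex ey; subst x' y' => ef eg.
have ? := JMeq_eq ef; have ? := JMeq_eq eg; subst f' g'.
by move=> e; rewrite (JMeq_eq e).
Qed.

Section CospPullback.

Variables (E A B D : category) (p : functor E A) (q : functor E B).
Variables (f : functor A D) (g : functor B D).
Variables (PE : pushouts E) (PA : pushouts A) (PB : pushouts B).
Variable PD : pushouts D.
Hypotheses (Hp : preserves_po p PE PA) (Hq : preserves_po q PE PB).
Hypotheses (Hf : preserves_po f PA PD) (Hg : preserves_po g PB PD).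
Hypothesis fp : functor_comp f p = functor_comp g q.

Hypothesis ex0 : forall a b, f a = g b -> exists e, p e = a /\ q e = b.
Hypothesis uniq0 : forall e e', p e = p e' -> q e = q e' -> e = e'.
Hypothesis ex1 : forall e e' (a : hom (p e) (p e')) (b : hom (q e) (q e')),
  JMeq (fmap f a) (fmap g b) ->
  exists c : hom e e', fmap p c = a /\ fmap q c = b.
Hypothesis uniq1 : forall e e' (c c' : hom e e'),
  fmap p c = fmap p c' -> fmap q c = fmap q c' -> c = c'.

(** Two dimensions of diagram data give three of cospans: an apex is glued by [ex0], legs and cospan
    maps by [ex1]. A glued cospan map commutes with the legs by [uniq1], as it does so after [p] and
    after [q]. *)
Lemma Cosp_pullback :
  is_pullback (Cosp_functor p PE PA) (Cosp_functor q PE PB)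
    (Cosp_functor f PA PD) (Cosp_functor g PB PD).
Proof.
have e0 e : f (p e) = g (q e).
  exact: (f_equal (fun F : functor E D => F e) fp).
apply: pullback_intro => //; try exact: Cosp_bicat; try exact: Cosp_functor_wf.
- by rewrite !Cosp_functor_comp fp.
- move=> e e' [a al ar] [b bl br].
  case/(cospan_JMeq (e0 e) (e0 e')) => /= /ex0 [z [? ?]]; subst a b.
  move=> /ex1 [l [<- <-]] /ex1 [r [<- <-]].
  by exists (Cospan z l r).
- move=> e e' [a l r] [a' l' r'] /= ep eq.
  have ea : a = a'.
    by apply: uniq0; [exact: (f_equal (fun c : cospan _ _ => apex c) ep)
                     | exact: (f_equal (fun c : cospan _ _ => apex c) eq)].
  subst a'.
  have [el er] := cospan_inj ep; have [el' er'] := cospan_inj eq.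
  by move: (uniq1 el el') (uniq1 er er') => /= -> ->.
- move=> e e' k l a b.
  have ek (m : cospan e e') :
      JMeq (map_cospan f (map_cospan p m)) (map_cospan g (map_cospan q m)).
    exact: (eq_ind _ (fun F : functor E D => JMeq _ (map_cospan F m))
      JMeq_refl _ fp).
  move=> /(cospan_map_JMeq (e0 e) (e0 e') (ek k) (ek l)) /= /ex1 [c [cp cq]].
  have cl : legl k ;; c = legl l.
    apply: uniq1; rewrite fmapM ?cp ?cq; first exact: (cmap_l a).
    exact: (cmap_l b).
  have cr : legr k ;; c = legr l.
    apply: uniq1; rewrite fmapM ?cp ?cq; first exact: (cmap_r a).
    exact: (cmap_r b).
  by exists (CospanMap cl cr); split; apply: cospan_map_ext.
- move=> e e' k l c c' ep eq; apply: cospan_map_ext; apply: uniq1.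
  + exact: (f_equal (fun c : cospan_map _ _ => cmap c) ep).
  + exact: (f_equal (fun c : cospan_map _ _ => cmap c) eq).
Qed.

End CospPullback.

(** * Preservation of pushouts by the structure functors *)

Lemma is_iso_eq_id (C : category) (x : C) (k : hom x x) : k = idm x -> is_iso k.
Proof. by move=> ->; exact: is_iso_id. Qed.

(** For functors sending chosen pushouts to chosen pushouts: the two ends of the comparison map are
    convertible, and the map restricts to the injections as the identity does. *)
Ltac strict_po Q :=
  move=> ? ? ? ? ?; apply: is_iso_eq_id; apply: (copair_uniq Q);
  [ exact: (etrans (copair_inl Q _) (esym (compm1 _)))
  | exact: (etrans (copair_inr Q _) (esym (compm1 _))) ].

(** For functors that agree by computation on objects and arrows and differ at most in their proofs
    of functoriality. *)
Ltac strict_eq := by apply: functor_ext => *; [ | apply: JMeq_refl].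

Section Preservation.

Variables (C : category) (P : pushouts C).

Definition row_apex : functor (row_cat C) C.
Proof.
by exists (fun A => apex (row_c A))
  (fun A B (f : row_map A B) => smap (rm_c f)).
Defined.

Lemma row_left_po : preserves_po (row_left C) (row_po P) P.
Proof. strict_po P. Qed.

Lemma row_right_po : preserves_po (row_right C) (row_po P) P.
Proof. strict_po P. Qed.

Lemma row_apex_po : preserves_po row_apex (row_po P) P.
Proof. strict_po P. Qed.

Lemma row2_fst_po : preserves_po (row2_fst C) (row2_po P) (row_po P).
Proof. strict_po (row_po P). Qed.

Lemma row2_snd_po : preserves_po (row2_snd C) (row2_po P) (row_po P).
Proof. strict_po (row_po P). Qed.

Lemma row3_fst_po : preserves_po (row3_fst C) (row3_po P) (row_po P).
Proof. strict_po (row_po P). Qed.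

Lemma row3_snd_po : preserves_po (row3_snd C) (row3_po P) (row_po P).
Proof. strict_po (row_po P). Qed.

Lemma row3_thd_po : preserves_po (row3_thd C) (row3_po P) (row_po P).
Proof. strict_po (row_po P). Qed.

Lemma cell_left_po : preserves_po (cell_left C) (cell_po P) P.
Proof. strict_po P. Qed.

Lemma cell_right_po : preserves_po (cell_right C) (cell_po P) P.
Proof. strict_po P. Qed.

Lemma cell_src_po : preserves_po (cell_src C) (cell_po P) (row_po P).
Proof. strict_po (row_po P). Qed.

Lemma cell_tgt_po : preserves_po (cell_tgt C) (cell_po P) (row_po P).
Proof. strict_po (row_po P). Qed.

Lemma vcells_fst_po : preserves_po (vcells_fst C) (vcells_po P) (cell_po P).
Proof. strict_po (cell_po P). Qed.

Lemma vcells_snd_po : preserves_po (vcells_snd C) (vcells_po P) (cell_po P).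
Proof. strict_po (cell_po P). Qed.

Lemma hcells_fst_po : preserves_po (hcells_fst C) (hcells_po P) (cell_po P).
Proof. strict_po (cell_po P). Qed.

Lemma hcells_snd_po : preserves_po (hcells_snd C) (hcells_po P) (cell_po P).
Proof. strict_po (cell_po P). Qed.

(** The legs of the inverse commute by conjugating the equations of [s] with the inverses; only the
    underlying arrow has to be given. *)
Lemma square_inv (x y x' y' : C) (u : hom x x') (v : hom y y')
    (u' : hom x' x) (v' : hom y' y) (f : cospan x y) (g : cospan x' y')
    (s : square u v f g) (k : hom (apex g) (apex f)) :
  u' ;; u = idm x' -> v' ;; v = idm y' -> s ;; k = idm _ ->
  exists t : square u' v' g f, smap t = k.
Proof.
move=> eu ev ek.
have tl : legl g ;; k = u' ;; legl f.
  rewrite -[RHS]compm1 -ek -compA (compA (legl f)) smap_l.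
  by rewrite !compA eu comp1m.
have tr : legr g ;; k = v' ;; legr f.
  rewrite -[RHS]compm1 -ek -compA (compA (legr f)) smap_r.
  by rewrite !compA ev comp1m.
by exists (Square tl tr).
Qed.

Lemma row_is_iso (A B : row_cat C) (k : hom A B) :
  is_iso (fmap (row_left C) k) -> is_iso (fmap (row_right C) k) ->
  is_iso (fmap row_apex k) -> is_iso k.
Proof.
case=> u [ku uk] [v [kv vk]] [w [kw wk]].
have [t et] := square_inv uk vk kw.
by exists (RowMap t); split; apply: row_map_ext; rewrite //= et.
Qed.

Lemma row2_is_iso (A B : row2_cat C) (k : hom A B) :
  is_iso (fmap (row2_fst C) k) -> is_iso (fmap (row2_snd C) k) -> is_iso k.
Proof.
case=> [[u v s]] [ks sk] [[v' w t]] [kt tk].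
(* Both inverses restrict to an inverse of the same middle arrow, so they agree there and glue. *)
have e : v = v'.
  exact: (inv_uniq (f_equal (fun h : row_map _ _ => rm_r h) sk)
                   (f_equal (fun h : row_map _ _ => rm_l h) kt)).
subst v'; exists (@Row2Map C B A _ _ _ s t); split; apply: row2_map_ext.
- exact: (f_equal (fun h : row_map _ _ => rm_l h) ks).
- exact: (f_equal (fun h : row_map _ _ => rm_r h) ks).
- exact: (f_equal (fun h : row_map _ _ => rm_r h) kt).
- exact: (f_equal (fun h : row_map _ _ => smap (rm_c h)) ks).
- exact: (f_equal (fun h : row_map _ _ => smap (rm_c h)) kt).
- exact: (f_equal (fun h : row_map _ _ => rm_l h) sk).
- exact: (f_equal (fun h : row_map _ _ => rm_r h) sk).
- exact: (f_equal (fun h : row_map _ _ => rm_r h) tk).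
- exact: (f_equal (fun h : row_map _ _ => smap (rm_c h)) sk).
- exact: (f_equal (fun h : row_map _ _ => smap (rm_c h)) tk).
Qed.

Lemma cell_map_eq (A B : cell_cat C) (k l : hom A B) :
  fmap (cell_src C) k = fmap (cell_src C) l ->
  fmap (cell_tgt C) k = fmap (cell_tgt C) l -> k = l.
Proof.
move=> es et; apply: cell_map_ext.
- exact: (f_equal (fun h : row_map _ _ => rm_l h) es).
- exact: (f_equal (fun h : row_map _ _ => rm_r h) es).
- exact: (f_equal (fun h : row_map _ _ => smap (rm_c h)) es).
- exact: (f_equal (fun h : row_map _ _ => smap (rm_c h)) et).
Qed.

Lemma cell_is_iso (A B : cell_cat C) (k : hom A B) :
  is_iso (fmap (cell_src C) k) -> is_iso (fmap (cell_tgt C) k) -> is_iso k.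
Proof.
case=> [[u v s]] [ks sk] [[u' v' t]] [kt tk].
have e : u = u'.
  exact: (inv_uniq (f_equal (fun h : row_map _ _ => rm_l h) sk)
                   (f_equal (fun h : row_map _ _ => rm_l h) kt)).
have e' : v = v'.
  exact: (inv_uniq (f_equal (fun h : row_map _ _ => rm_r h) sk)
                   (f_equal (fun h : row_map _ _ => rm_r h) kt)).
subst u' v'.
(* Compatibility of the inverse pair is the equation [sqc] of [k], conjugated by the inverses. *)
have c : cmor (cell_c B) ;; t = s ;; cmor (cell_c A).
  have st : sqs (cm_c k) ;; s = idm _.
    exact: (f_equal (fun h : row_map _ _ => smap (rm_c h)) ks).
  have ts : s ;; sqs (cm_c k) = idm _.
    exact: (f_equal (fun h : row_map _ _ => smap (rm_c h)) sk).
  have tt : sqt (cm_c k) ;; t = idm _.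
    exact: (f_equal (fun h : row_map _ _ => smap (rm_c h)) kt).
  rewrite -[LHS]comp1m -[X in X ;; _]ts -compA (compA (sqs (cm_c k))).
  by rewrite -sqc -compA tt compm1.
by exists (@CellMap C B A u v (Tsquare c)); split; apply: cell_map_eq.
Qed.

Section Codomain.

Variables (X : category) (PX : pushouts X).

(** The three projections preserve pushouts and jointly reflect isomorphisms, so the comparison map
    of [F] can be tested after them. The next two lemmas follow the same pattern. *)
Lemma row_preserves (F : functor X (row_cat C)) :
  preserves_po (functor_comp (row_left C) F) PX P ->
  preserves_po (functor_comp (row_right C) F) PX P ->
  preserves_po (functor_comp row_apex F) PX P ->
  preserves_po F PX (row_po P).
Proof.
move=> Fl Fr Fa x a b f g; apply: row_is_iso.
- exact: (preserves_po_cancel row_left_po Fl).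
- exact: (preserves_po_cancel row_right_po Fr).
- exact: (preserves_po_cancel row_apex_po Fa).
Qed.

Lemma row2_preserves (F : functor X (row2_cat C)) :
  preserves_po (functor_comp (row2_fst C) F) PX (row_po P) ->
  preserves_po (functor_comp (row2_snd C) F) PX (row_po P) ->
  preserves_po F PX (row2_po P).
Proof.
move=> F1 F2 x a b f g; apply: row2_is_iso.
- exact: (preserves_po_cancel row2_fst_po F1).
- exact: (preserves_po_cancel row2_snd_po F2).
Qed.

Lemma cell_preserves (F : functor X (cell_cat C)) :
  preserves_po (functor_comp (cell_src C) F) PX (row_po P) ->
  preserves_po (functor_comp (cell_tgt C) F) PX (row_po P) ->
  preserves_po F PX (cell_po P).
Proof.
move=> Fs Ft x a b f g; apply: cell_is_iso.
- exact: (preserves_po_cancel cell_src_po Fs).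
- exact: (preserves_po_cancel cell_tgt_po Ft).
Qed.

End Codomain.

End Preservation.

Section StructureFunctors.

Variables (C : category) (P : pushouts C).

(** Three adjacent rows are seen as two overlapping pairs, through this functor and the next; the
    triple pullback is assembled from them. *)
Definition row3_fst2 : functor (row3_cat C) (row2_cat C).
Proof.
by exists (fun A => Row2 (row3_12 A) (row3_23 A))
  (fun A B f => @Row2Map C (Row2 (row3_12 A) (row3_23 A))
    (Row2 (row3_12 B) (row3_23 B)) _ _ _ (rm3_12 f) (rm3_23 f)).
Defined.

Definition row3_snd2 : functor (row3_cat C) (row2_cat C).
Proof.
by exists (fun A => Row2 (row3_23 A) (row3_34 A))
  (fun A B f => @Row2Map C (Row2 (row3_23 A) (row3_34 A))
    (Row2 (row3_23 B) (row3_34 B)) _ _ _ (rm3_23 f) (rm3_34 f)).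
Defined.

(** Followed by [row2_comp] this is the source of the associator, and [row3_compr] likewise gives
    its target; [row_idl] and [row_idr] do the same for the sources of the unitors. *)
Definition row3_compl : functor (row3_cat C) (row2_cat C).
Proof.
exists (fun A => Row2 (cospan_comp P (row3_12 A) (row3_23 A)) (row3_34 A))
  (fun A B f => @Row2Map C
    (Row2 (cospan_comp P (row3_12 A) (row3_23 A)) (row3_34 A))
    (Row2 (cospan_comp P (row3_12 B) (row3_23 B)) (row3_34 B)) _ _ _
    (square_hcomp P (rm3_12 f) (rm3_23 f)) (rm3_34 f))
  => *; apply: row2_map_ext => //; apply: f_equal.
- exact: square_hcomp_id.
- exact: square_hcomp_comp.
Defined.

Definition row3_compr : functor (row3_cat C) (row2_cat C).
Proof.
exists (fun A => Row2 (row3_12 A) (cospan_comp P (row3_23 A) (row3_34 A)))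
  (fun A B f => @Row2Map C
    (Row2 (row3_12 A) (cospan_comp P (row3_23 A) (row3_34 A)))
    (Row2 (row3_12 B) (cospan_comp P (row3_23 B) (row3_34 B))) _ _ _
    (rm3_12 f) (square_hcomp P (rm3_23 f) (rm3_34 f)))
  => *; apply: row2_map_ext => //; apply: f_equal.
- exact: square_hcomp_id.
- exact: square_hcomp_comp.
Defined.

Definition row_idl : functor (row_cat C) (row2_cat C).
Proof.
by exists (fun A => Row2 (cospan_id (row_l A)) (row_c A))
  (fun A B f => @Row2Map C (Row2 (cospan_id (row_l A)) (row_c A))
    (Row2 (cospan_id (row_l B)) (row_c B)) _ _ _
    (square_of_id (rm_l f)) (rm_c f))
  => *; apply: row2_map_ext.
Defined.

Definition row_idr : functor (row_cat C) (row2_cat C).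
Proof.
by exists (fun A => Row2 (row_c A) (cospan_id (row_r A)))
  (fun A B f => @Row2Map C (Row2 (row_c A) (cospan_id (row_r A)))
    (Row2 (row_c B) (cospan_id (row_r B))) _ _ _
    (rm_c f) (square_of_id (rm_r f)))
  => *; apply: row2_map_ext.
Defined.

Definition hcells_src : functor (hcells_cat C) (row2_cat C).
Proof.
by exists (fun A => Row2 (csrc (hc_12 A)) (csrc (hc_23 A)))
  (fun A B f => @Row2Map C (Row2 (csrc (hc_12 A)) (csrc (hc_23 A)))
    (Row2 (csrc (hc_12 B)) (csrc (hc_23 B))) _ _ _
    (sqs (hm_12 f)) (sqs (hm_23 f))).
Defined.

Definition hcells_tgt : functor (hcells_cat C) (row2_cat C).
Proof.
by exists (fun A => Row2 (ctgt (hc_12 A)) (ctgt (hc_23 A)))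
  (fun A B f => @Row2Map C (Row2 (ctgt (hc_12 A)) (ctgt (hc_23 A)))
    (Row2 (ctgt (hc_12 B)) (ctgt (hc_23 B))) _ _ _
    (sqt (hm_12 f)) (sqt (hm_23 f))).
Defined.

Lemma row_of_id_po : preserves_po (row_of_id C) P (row_po P).
Proof.
apply: row_preserves.
- have -> : functor_comp (row_left C) (row_of_id C) = functor_id C by strict_eq.
  exact: preserves_po_id.
- have -> : functor_comp (row_right C) (row_of_id C) = functor_id C.
    by strict_eq.
  exact: preserves_po_id.
- have -> : functor_comp (row_apex C) (row_of_id C) = functor_id C by strict_eq.
  exact: preserves_po_id.
Qed.

Lemma cell_of_id_po : preserves_po (cell_of_id C) (row_po P) (cell_po P).
Proof.
apply: cell_preserves.
- have -> : functor_comp (cell_src C) (cell_of_id C) = functor_id _.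
    by strict_eq.
  exact: preserves_po_id.
- have -> : functor_comp (cell_tgt C) (cell_of_id C) = functor_id _.
    by strict_eq.
  exact: preserves_po_id.
Qed.

(** Pushouts commute with pushouts: both apices are colimits of the same diagram. The inverse
    comparison is the copairing of maps out of the pushouts of left apices ([e1]) and of right
    apices ([e2]). *)
Lemma row2_comp_apex_po :
  preserves_po (functor_comp (row_apex C) (row2_comp P)) (row2_po P) P.
Proof.
move=> X A B f g.
pose FA := cospan_comp P (row2_12 A) (row2_23 A).
pose FB := cospan_comp P (row2_12 B) (row2_23 B).
pose k := square_hcomp P (rm2_12 f) (rm2_23 f).
pose l := square_hcomp P (rm2_12 g) (rm2_23 g).
have e1 : rm2_12 f ;; (inl P (legr (row2_12 A)) (legl (row2_23 A)) ;; inl P k l)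
    = rm2_12 g ;; (inl P (legr (row2_12 B)) (legl (row2_23 B)) ;; inr P k l).
  rewrite !compA -(square_hcomp_inl P (rm2_12 f) (rm2_23 f)).
  by rewrite -(square_hcomp_inl P (rm2_12 g) (rm2_23 g)) -!compA po_comm.
have e2 : rm2_23 f ;; (inr P (legr (row2_12 A)) (legl (row2_23 A)) ;; inl P k l)
    = rm2_23 g ;; (inr P (legr (row2_12 B)) (legl (row2_23 B)) ;; inr P k l).
  rewrite !compA -(square_hcomp_inr P (rm2_12 f) (rm2_23 f)).
  by rewrite -(square_hcomp_inr P (rm2_12 g) (rm2_23 g)) -!compA po_comm.
pose h := row2_po_ob P f g.
(* The two maps agree on the pushout of the middle objects, as is checked on its injections. *)
have e : legr (row2_12 h) ;; copair P e1 = legl (row2_23 h) ;; copair P e2.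
  apply: (copair_uniq P); rewrite /= /po_map; po_simpl P;
    by rewrite compA po_comm compA.
exists (copair P e); split.
- apply: (copair_uniq P); apply: (copair_uniq P);
    rewrite /po_compare /= /po_map; po_simpl P => //.
- apply: (copair_uniq P); apply: (copair_uniq P);
    rewrite /po_compare /= /po_map; po_simpl P => //.
Qed.

Lemma row2_comp_po : preserves_po (row2_comp P) (row2_po P) (row_po P).
Proof.
apply: row_preserves; last exact: row2_comp_apex_po.
- have -> : functor_comp (row_left C) (row2_comp P)
      = functor_comp (row_left C) (row2_fst C) by strict_eq.
  exact: preserves_po_comp (row2_fst_po P) (row_left_po P).
- have -> : functor_comp (row_right C) (row2_comp P)
      = functor_comp (row_right C) (row2_snd C) by strict_eq.
  exact: preserves_po_comp (row2_snd_po P) (row_right_po P).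
Qed.

Lemma row3_fst2_po : preserves_po row3_fst2 (row3_po P) (row2_po P).
Proof. strict_po (row2_po P). Qed.

Lemma row3_snd2_po : preserves_po row3_snd2 (row3_po P) (row2_po P).
Proof. strict_po (row2_po P). Qed.

Lemma row3_compl_po : preserves_po row3_compl (row3_po P) (row2_po P).
Proof.
apply: row2_preserves.
- have -> : functor_comp (row2_fst C) row3_compl
      = functor_comp (row2_comp P) row3_fst2 by strict_eq.
  exact: preserves_po_comp row3_fst2_po row2_comp_po.
- have -> : functor_comp (row2_snd C) row3_compl = row3_thd C by strict_eq.
  exact: row3_thd_po.
Qed.

Lemma row3_compr_po : preserves_po row3_compr (row3_po P) (row2_po P).
Proof.
apply: row2_preserves.
- have -> : functor_comp (row2_fst C) row3_compr = row3_fst C by strict_eq.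
  exact: row3_fst_po.
- have -> : functor_comp (row2_snd C) row3_compr
      = functor_comp (row2_comp P) row3_snd2 by strict_eq.
  exact: preserves_po_comp row3_snd2_po row2_comp_po.
Qed.

Lemma row_idl_po : preserves_po row_idl (row_po P) (row2_po P).
Proof.
apply: row2_preserves.
- have -> : functor_comp (row2_fst C) row_idl
      = functor_comp (row_of_id C) (row_left C) by strict_eq.
  exact: preserves_po_comp (row_left_po P) row_of_id_po.
- have -> : functor_comp (row2_snd C) row_idl = functor_id _ by strict_eq.
  exact: preserves_po_id.
Qed.

Lemma row_idr_po : preserves_po row_idr (row_po P) (row2_po P).
Proof.
apply: row2_preserves.
- have -> : functor_comp (row2_fst C) row_idr = functor_id _ by strict_eq.
  exact: preserves_po_id.
- have -> : functor_comp (row2_snd C) row_idr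
      = functor_comp (row_of_id C) (row_right C) by strict_eq.
  exact: preserves_po_comp (row_right_po P) row_of_id_po.
Qed.

Lemma hcells_src_po : preserves_po hcells_src (hcells_po P) (row2_po P).
Proof. strict_po (row2_po P). Qed.

Lemma hcells_tgt_po : preserves_po hcells_tgt (hcells_po P) (row2_po P).
Proof. strict_po (row2_po P). Qed.

Lemma row3_assoc_po : preserves_po (row3_assoc P) (row3_po P) (cell_po P).
Proof.
apply: cell_preserves.
- have -> : functor_comp (cell_src C) (row3_assoc P)
      = functor_comp (row2_comp P) row3_compl by strict_eq.
  exact: preserves_po_comp row3_compl_po row2_comp_po.
- have -> : functor_comp (cell_tgt C) (row3_assoc P)
      = functor_comp (row2_comp P) row3_compr by strict_eq.
  exact: preserves_po_comp row3_compr_po row2_comp_po.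
Qed.

Lemma row_lunit_po : preserves_po (row_lunit P) (row_po P) (cell_po P).
Proof.
apply: cell_preserves.
- have -> : functor_comp (cell_src C) (row_lunit P)
      = functor_comp (row2_comp P) row_idl by strict_eq.
  exact: preserves_po_comp row_idl_po row2_comp_po.
- have -> : functor_comp (cell_tgt C) (row_lunit P) = functor_id _
    by strict_eq.
  exact: preserves_po_id.
Qed.

Lemma row_runit_po : preserves_po (row_runit P) (row_po P) (cell_po P).
Proof.
apply: cell_preserves.
- have -> : functor_comp (cell_src C) (row_runit P)
      = functor_comp (row2_comp P) row_idr by strict_eq.
  exact: preserves_po_comp row_idr_po row2_comp_po.
- have -> : functor_comp (cell_tgt C) (row_runit P) = functor_id _
    by strict_eq.
  exact: preserves_po_id.
Qed.

Lemma vcells_comp_po : preserves_po (vcells_comp C) (vcells_po P) (cell_po P).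
Proof.
apply: cell_preserves.
- have -> : functor_comp (cell_src C) (vcells_comp C)
      = functor_comp (cell_src C) (vcells_fst C) by strict_eq.
  exact: preserves_po_comp (vcells_fst_po P) (cell_src_po P).
- have -> : functor_comp (cell_tgt C) (vcells_comp C)
      = functor_comp (cell_tgt C) (vcells_snd C) by strict_eq.
  exact: preserves_po_comp (vcells_snd_po P) (cell_tgt_po P).
Qed.

Lemma hcells_comp_po : preserves_po (hcells_comp P) (hcells_po P) (cell_po P).
Proof.
apply: cell_preserves.
- have -> : functor_comp (cell_src C) (hcells_comp P)
      = functor_comp (row2_comp P) hcells_src by strict_eq.
  exact: preserves_po_comp hcells_src_po row2_comp_po.
- have -> : functor_comp (cell_tgt C) (hcells_comp P)
      = functor_comp (row2_comp P) hcells_tgt by strict_eq.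
  exact: preserves_po_comp hcells_tgt_po row2_comp_po.
Qed.

End StructureFunctors.

(** * Strict pullbacks of diagram categories *)

Section Pullbacks.

Variables (C : category) (P : pushouts C).

(** [Row2] requires the middle object to be literally shared, so the second cospan is generalized
    over its left end and retyped along [e]. *)
Definition row2_glue (A B : row C) (e : row_r A = row_l B) : row2 C :=
  match e in _ = x return forall z, cospan x z -> row2 C with
  | erefl => fun z g => Row2 (row_c A) g
  end _ (row_c B).

Lemma row2_glueK (A B : row C) (e : row_r A = row_l B) :
  row2_fst C (row2_glue e) = A /\ row2_snd C (row2_glue e) = B.
Proof. by case: B e => x z g /= e; subst x. Qed.

(** By eta for records, [X] is convertible to the gluing of its projections along [erefl], and a
    gluing depends only on its pieces by proof irrelevance. *)
Lemma row2_eq (X Y : row2 C) :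
  row2_fst C X = row2_fst C Y -> row2_snd C X = row2_snd C Y -> X = Y.
Proof.
have E (A A' B B' : row C) (e : row_r A = row_l B) (e' : row_r A' = row_l B') :
    A = A' -> B = B' -> row2_glue e = row2_glue e'.
  by move=> ? ?; subst A' B'; rewrite (proof_irrelevance _ e e').
exact: (E (row2_fst C X) (row2_fst C Y) (row2_snd C X) (row2_snd C Y)
  erefl erefl).
Qed.

Lemma row2_pullback :
  is_pullback (Cosp_functor (row2_fst C) (row2_po P) (row_po P))
    (Cosp_functor (row2_snd C) (row2_po P) (row_po P))
    (Cosp_functor (row_right C) (row_po P) P)
    (Cosp_functor (row_left C) (row_po P) P).
Proof.
apply: Cosp_pullback.
- exact: row2_fst_po.
- exact: row2_snd_po.
- exact: row_right_po.
- exact: row_left_po.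
- by strict_eq.
- by move=> A B e; exists (row2_glue e); exact: row2_glueK.
- exact: row2_eq.
- move=> X Y [u v s] [v' w t] /= /(@JMeq_eq _ _ _) e; subst v'.
  by exists (@Row2Map C X Y _ _ _ s t).
- move=> X Y k l e1 e2; apply: row2_map_ext.
  + exact: (f_equal (fun h : row_map _ _ => rm_l h) e1).
  + exact: (f_equal (fun h : row_map _ _ => rm_r h) e1).
  + exact: (f_equal (fun h : row_map _ _ => rm_r h) e2).
  + exact: (f_equal (fun h : row_map _ _ => smap (rm_c h)) e1).
  + exact: (f_equal (fun h : row_map _ _ => smap (rm_c h)) e2).
Qed.

Definition hcells_glue (A B : cell C) (e : cell_r A = cell_l B) : hcells C :=
  match e in _ = x return forall z, twocell x z -> hcells C with
  | erefl => fun z b => Hcells (cell_c A) b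
  end _ (cell_c B).

Lemma hcells_glueK (A B : cell C) (e : cell_r A = cell_l B) :
  hcells_fst C (hcells_glue e) = A /\ hcells_snd C (hcells_glue e) = B.
Proof. by case: B e => x z g /= e; subst x. Qed.

Lemma hcells_eq (X Y : hcells C) :
  hcells_fst C X = hcells_fst C Y -> hcells_snd C X = hcells_snd C Y -> X = Y.
Proof.
have E (A A' B B' : cell C) (e : cell_r A = cell_l B)
    (e' : cell_r A' = cell_l B') :
    A = A' -> B = B' -> hcells_glue e = hcells_glue e'.
  by move=> ? ?; subst A' B'; rewrite (proof_irrelevance _ e e').
exact: (E (hcells_fst C X) (hcells_fst C Y) (hcells_snd C X) (hcells_snd C Y)
  erefl erefl).
Qed.

Lemma hcells_pullback :
  is_pullback (Cosp_functor (hcells_fst C) (hcells_po P) (cell_po P))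
    (Cosp_functor (hcells_snd C) (hcells_po P) (cell_po P))
    (Cosp_functor (cell_right C) (cell_po P) P)
    (Cosp_functor (cell_left C) (cell_po P) P).
Proof.
apply: Cosp_pullback.
- exact: hcells_fst_po.
- exact: hcells_snd_po.
- exact: cell_right_po.
- exact: cell_left_po.
- by strict_eq.
- by move=> A B e; exists (hcells_glue e); exact: hcells_glueK.
- exact: hcells_eq.
- move=> X Y [u v s] [v' w t] /= /(@JMeq_eq _ _ _) e; subst v'.
  by exists (@HcellsMap C X Y _ _ _ s t).
- move=> X Y k l e1 e2; apply: hcells_map_ext.
  + exact: (f_equal (fun h : cell_map _ _ => cm_l h) e1).
  + exact: (f_equal (fun h : cell_map _ _ => cm_r h) e1).
  + exact: (f_equal (fun h : cell_map _ _ => cm_r h) e2).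
  + exact: (f_equal (fun h : cell_map _ _ => smap (sqs (cm_c h))) e1).
  + exact: (f_equal (fun h : cell_map _ _ => smap (sqt (cm_c h))) e1).
  + exact: (f_equal (fun h : cell_map _ _ => smap (sqs (cm_c h))) e2).
  + exact: (f_equal (fun h : cell_map _ _ => smap (sqt (cm_c h))) e2).
Qed.

Definition vcells_glue (A B : cell C) (e : cell_tgt C A = cell_src C B) :
    vcells C :=
  match e in _ = R return forall t : cospan (row_l R) (row_r R),
    cospan_map (row_c R) t -> vcells C with
  | erefl => fun t b => Vcells (Twopath (cmor (cell_c A)) b)
  end _ (cmor (cell_c B)).

Lemma vcells_glueK (A B : cell C) (e : cell_tgt C A = cell_src C B) :
  vcells_fst C (vcells_glue e) = A /\ vcells_snd C (vcells_glue e) = B.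
Proof.
(* The right-hand side of [e] is not a variable, so the claim is generalized to an arbitrary row [R]
   before substitution. *)
have E (R : row C) (e' : cell_tgt C A = R) (t : cospan (row_l R) (row_r R))
    (b : cospan_map (row_c R) t) :
  let V := match e' in _ = R return forall t : cospan (row_l R) (row_r R),
    cospan_map (row_c R) t -> vcells C with
    | erefl => fun t b => Vcells (Twopath (cmor (cell_c A)) b)
    end _ b in
  vcells_fst C V = A /\ vcells_snd C V = Cell (Twocell b).
  by subst R.
exact: (E (cell_src C B) e _ (cmor (cell_c B))).
Qed.

Lemma vcells_eq (X Y : vcells C) :
  vcells_fst C X = vcells_fst C Y -> vcells_snd C X = vcells_snd C Y -> X = Y.
Proof.
have E (A A' B B' : cell C) (e : cell_tgt C A = cell_src C B)
    (e' : cell_tgt C A' = cell_src C B') :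
    A = A' -> B = B' -> vcells_glue e = vcells_glue e'.
  by move=> ? ?; subst A' B'; rewrite (proof_irrelevance _ e e').
exact: (E (vcells_fst C X) (vcells_fst C Y) (vcells_snd C X) (vcells_snd C Y)
  erefl erefl).
Qed.

Lemma vcells_pullback :
  is_pullback (Cosp_functor (vcells_fst C) (vcells_po P) (cell_po P))
    (Cosp_functor (vcells_snd C) (vcells_po P) (cell_po P))
    (Cosp_functor (cell_tgt C) (cell_po P) (row_po P))
    (Cosp_functor (cell_src C) (cell_po P) (row_po P)).
Proof.
apply: Cosp_pullback.
- exact: vcells_fst_po.
- exact: vcells_snd_po.
- exact: cell_tgt_po.
- exact: cell_src_po.
- by strict_eq.
- by move=> A B e; exists (vcells_glue e); exact: vcells_glueK.
- exact: vcells_eq.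
- move=> X Y a b /(@JMeq_eq _ _ _) e.
  have eu := f_equal (fun h : row_map _ _ => rm_l h) e.
  have ev := f_equal (fun h : row_map _ _ => rm_r h) e.
  have em := f_equal (fun h : row_map _ _ => smap (rm_c h)) e.
  case: a b eu ev em {e} => [u v [s t c]] [u' v' [t' r d]] /= eu ev em.
  subst u' v'; have et := square_ext em; subst t'.
  by exists (@VcellsMap C X Y _ _ (@Psquare C _ _ _ _ _ _ _ _ s t r c d)).
- move=> X Y k l e1 e2; apply: vcells_map_ext.
  + exact: (f_equal (fun h : cell_map _ _ => cm_l h) e1).
  + exact: (f_equal (fun h : cell_map _ _ => cm_r h) e1).
  + exact: (f_equal (fun h : cell_map _ _ => smap (sqs (cm_c h))) e1).
  + exact: (f_equal (fun h : cell_map _ _ => smap (sqt (cm_c h))) e1).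
  + exact: (f_equal (fun h : cell_map _ _ => smap (sqt (cm_c h))) e2).
Qed.

Definition row3_glue (A B : row2 C) (e : row2_snd C A = row2_fst C B) :
    row3 C :=
  match e in _ = R return forall z, cospan (row_r R) z -> row3 C with
  | erefl => fun z h => Row3 (row2_12 A) (row2_23 A) h
  end _ (row2_23 B).

Lemma row3_glueK (A B : row2 C) (e : row2_snd C A = row2_fst C B) :
  row3_fst2 C (row3_glue e) = A /\ row3_snd2 C (row3_glue e) = B.
Proof.
have E (R : row C) (e' : row2_snd C A = R) z (h : cospan (row_r R) z) :
  let V := match e' in _ = R return forall z, cospan (row_r R) z -> row3 C with
    | erefl => fun z h => Row3 (row2_12 A) (row2_23 A) h
    end _ h in
  row3_fst2 C V = A /\ row3_snd2 C V = Row2 (row_c R) h.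
  by subst R.
exact: (E (row2_fst C B) e _ (row2_23 B)).
Qed.

Lemma row3_eq (X Y : row3 C) :
  row3_fst2 C X = row3_fst2 C Y -> row3_snd2 C X = row3_snd2 C Y -> X = Y.
Proof.
have E (A A' B B' : row2 C) (e : row2_snd C A = row2_fst C B)
    (e' : row2_snd C A' = row2_fst C B') :
    A = A' -> B = B' -> row3_glue e = row3_glue e'.
  by move=> ? ?; subst A' B'; rewrite (proof_irrelevance _ e e').
exact: (E (row3_fst2 C X) (row3_fst2 C Y) (row3_snd2 C X) (row3_snd2 C Y)
  erefl erefl).
Qed.

Lemma row3_pullback :
  is_pullback (Cosp_functor (row3_fst2 C) (row3_po P) (row2_po P))
    (Cosp_functor (row3_snd2 C) (row3_po P) (row2_po P))
    (Cosp_functor (row2_snd C) (row2_po P) (row_po P))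
    (Cosp_functor (row2_fst C) (row2_po P) (row_po P)).
Proof.
apply: Cosp_pullback.
- exact: row3_fst2_po.
- exact: row3_snd2_po.
- exact: row2_snd_po.
- exact: row2_fst_po.
- by strict_eq.
- by move=> A B e; exists (row3_glue e); exact: row3_glueK.
- exact: row3_eq.
- move=> X Y a b /(@JMeq_eq _ _ _) e.
  have eu := f_equal (fun h : row_map _ _ => rm_l h) e.
  have ev := f_equal (fun h : row_map _ _ => rm_r h) e.
  have em := f_equal (fun h : row_map _ _ => smap (rm_c h)) e.
  case: a b eu ev em {e} => [u v w s t] [v' w' z t' r] /= eu ev em.
  subst v' w'; have et := square_ext em; subst t'.
  by exists (@Row3Map C X Y _ _ _ _ s t r).
- move=> X Y k l e1 e2; apply: row3_map_ext.
  + exact: (f_equal (fun h : row2_map _ _ => rm2_1 h) e1).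
  + exact: (f_equal (fun h : row2_map _ _ => rm2_2 h) e1).
  + exact: (f_equal (fun h : row2_map _ _ => rm2_3 h) e1).
  + exact: (f_equal (fun h : row2_map _ _ => rm2_3 h) e2).
  + exact: (f_equal (fun h : row2_map _ _ => smap (rm2_12 h)) e1).
  + exact: (f_equal (fun h : row2_map _ _ => smap (rm2_23 h)) e1).
  + exact: (f_equal (fun h : row2_map _ _ => smap (rm2_23 h)) e2).
Qed.

End Pullbacks.

(** * Generalized elements *)

Section PullbackFacts.

Variables (E A B D : prebicat).
Variables (p : prefun E A) (q : prefun E B) (f : prefun A D) (g : prefun B D).
Hypotheses (HA : is_bicat A) (HB : is_bicat B).
Hypotheses (HD : is_bicat D) (Hp : is_weak_functor p) (Hq : is_weak_functor q).
Hypotheses (Hf : is_weak_functor f) (Hg : is_weak_functor g).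
Hypothesis pb : is_pullback p q f g.
Variables (T : prebicat) (HT : is_bicat T).

Lemma is_pullback_comm (w : prefun T E) : f ∘ (p ∘ w) = g ∘ (q ∘ w).
Proof. by rewrite -!pcompA // (proj1 pb). Qed.

Lemma is_pullback_inj (w w' : prefun T E) :
  is_weak_functor w -> is_weak_functor w' ->
  p ∘ w = p ∘ w' -> q ∘ w = q ∘ w' -> w = w'.
Proof.
move=> Hw Hw' ep eq.
have [x [_ Ux]] := proj2 pb T (p ∘ w) (q ∘ w) HT (pcomp_wf HA Hp Hw)
  (pcomp_wf HB Hq Hw) (is_pullback_comm w).
by rewrite -(Ux w) // -(Ux w').
Qed.

Lemma is_pullback_ex (u : prefun T A) (v : prefun T B) :
  is_weak_functor u -> is_weak_functor v -> f ∘ u = g ∘ v ->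
  exists w : prefun T E, [/\ is_weak_functor w, p ∘ w = u & q ∘ w = v].
Proof.
by move=> Hu Hv e; have [w [Hw _]] := proj2 pb T u v HT Hu Hv e; exists w.
Qed.

End PullbackFacts.

(** Equations between structure 2-functors, evaluated at a generalized element [z]. Reassociating is
    not definitional, whence the assumptions on the outer 2-functors here and in the next two
    lemmas. *)
Lemma pcomp_square_at (T X A B W : prebicat) (F : prefun X A) (G : prefun A W)
    (F' : prefun X B) (G' : prefun B W) (z : prefun T X) :
  is_bicat W -> is_weak_functor G -> is_weak_functor G' ->
  G ∘ F = G' ∘ F' -> G ∘ (F ∘ z) = G' ∘ (F' ∘ z).
Proof. by move=> HW HG HG' e; rewrite -!pcompA // e. Qed.

Lemma pcomp_triangle_at (T X A W : prebicat) (F : prefun X A) (G : prefun A W)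
    (H : prefun X W) (z : prefun T X) :
  is_bicat W -> is_weak_functor G ->
  G ∘ F = H -> G ∘ (F ∘ z) = H ∘ z.
Proof. by move=> HW HG e; rewrite -pcompA // e. Qed.

Lemma pcomp_section_at (T X A : prebicat) (F : prefun X A) (G : prefun A X)
    (z : prefun T X) :
  is_bicat X -> is_weak_functor G -> G ∘ F = pid X -> G ∘ (F ∘ z) = z.
Proof. by move=> HX HG e; rewrite -pcompA // e pid_pcomp. Qed.

Section CospCalculus.

Variables (X Y Z W : category) (PX : pushouts X) (PY : pushouts Y).
Variables (PZ : pushouts Z) (PW : pushouts W).

Lemma Cosp_functor_square (F : functor X Y) (G : functor Y W)
    (F' : functor X Z) (G' : functor Z W) :
  functor_comp G F = functor_comp G' F' ->
  Cosp_functor G PY PW ∘ Cosp_functor F PX PY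
  = Cosp_functor G' PZ PW ∘ Cosp_functor F' PX PZ.
Proof. by rewrite !Cosp_functor_comp => ->. Qed.

Lemma Cosp_functor_triangle (F : functor X Y) (G : functor Y W)
    (H : functor X W) :
  functor_comp G F = H ->
  Cosp_functor G PY PW ∘ Cosp_functor F PX PY = Cosp_functor H PX PW.
Proof. by rewrite Cosp_functor_comp => ->. Qed.

Lemma Cosp_functor_section (F : functor X Y) (G : functor Y X) :
  functor_comp G F = functor_id X ->
  Cosp_functor G PY PX ∘ Cosp_functor F PX PY = pid (Cosp PX).
Proof. by rewrite Cosp_functor_comp => ->; exact: Cosp_functor_id. Qed.

End CospCalculus.

(** The diagrams underlying a 2-functor into cospans: its values on objects and
    the apices of its values on 1-cells. *)

Inductive point (T : prebicat) : Type :=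
| PtObj (x : T)
| PtArr (x y : T) (k : cell1 x y).

Definition val (T : prebicat) (X : category) (PX : pushouts X)
    (z : prefun T (Cosp PX)) (t : point T) : X :=
  match t with
  | PtObj x => z x
  | PtArr _ _ k => apex (f1 z k)
  end.

Lemma val_comp (T : prebicat) (X Y : category) (PX : pushouts X)
    (PY : pushouts Y) (F : functor X Y) (z : prefun T (Cosp PX)) (t : point T) :
  val (Cosp_functor F PX PY ∘ z) t = F (val z t).
Proof. by case: t. Qed.

(** A structure 2-functor standing alone is read at the identity element, so that laws stated for
    2-functors also become statements about diagrams. *)
Lemma val_Cosp_functor (X Y : category) (PX : pushouts X)
    (PY : pushouts Y) (F : functor X Y) (t : point (Cosp PX)) :
  val (Cosp_functor F PX PY) t = F (val (pid (Cosp PX)) t).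
Proof. by case: t. Qed.

Section Internal.

Variables (C : category) (P : pushouts C).

(** The apex cell must be supplied, since source and target rows do not determine its cospan map;
    the legs are then fixed by their images under [cell_src] and [cell_tgt]. *)
Lemma cell_cospan_JMeq (A A' B B' : cell_cat C) (f : cospan A B)
    (f' : cospan A' B') :
  A = A' -> B = B' -> apex f = apex f' ->
  JMeq (map_cospan (cell_src C) f) (map_cospan (cell_src C) f') ->
  JMeq (map_cospan (cell_tgt C) f) (map_cospan (cell_tgt C) f') ->
  JMeq f f'.
Proof.
move=> eA eB; subst A' B'.
case: f f' => [a l r] [a' l' r'] /= e; subst a'.
move=> /(@JMeq_eq _ _ _) es /(@JMeq_eq _ _ _) et.
have [els ers] := cospan_inj es; have [elt ert] := cospan_inj et.
by have /= -> := cell_map_eq els elt; have /= -> := cell_map_eq ers ert.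
Qed.

Lemma cell_prefun_ext (T : prebicat) (z z' : prefun T (Cosp (cell_po P))) :
  srcT (TwoCosp P) ∘ z = srcT (TwoCosp P) ∘ z' ->
  tgtT (TwoCosp P) ∘ z = tgtT (TwoCosp P) ∘ z' ->
  (forall t, val z t = val z' t) -> z = z'.
Proof.
move=> es et ev; have e0 x : z x = z' x := ev (PtObj x).
have HR := Cosp_bicat (row_po P).
apply: (prefun_eq HR HR (Cosp_functor_wf (cell_src_po P))
  (Cosp_functor_wf (cell_tgt_po P)) _ e0 _ es et) => [A B k l a b ea eb|x y k].
- apply: cospan_map_ext; apply: cell_map_eq.
  + exact: (f_equal (fun c : cospan_map _ _ => cmap c) ea).
  + exact: (f_equal (fun c : cospan_map _ _ => cmap c) eb).
- apply: (cell_cospan_JMeq (e0 x) (e0 y) (ev (PtArr k))).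
  + exact: (eq_ind _ (fun F : prefun T _ => JMeq _ (f1 F k)) JMeq_refl _ es).
  + exact: (eq_ind _ (fun F : prefun T _ => JMeq _ (f1 F k)) JMeq_refl _ et).
Qed.

End Internal.

(** * The bicategory laws as relations between cospan maps *)

Section Cells.

Variables (C : category) (P : pushouts C).

(** With the ends and cospans fixed, this is the function through which an equation of cospan maps
    becomes one of cells, by [f_equal]. *)
Definition cell_of (x y : C) (f g : cospan x y) (a : cospan_map f g) : cell C :=
  Cell (Twocell a).

(** A graph with a composable pair as witness, as in [is_compM]: composability is carried by the
    witness instead of an equation along which to transport. *)
Definition row_comp (A B R : row C) : Prop := exists X : row2 C,
  [/\ row2_fst C X = A, row2_snd C X = B & row2_comp P X = R].

Definition cell_vcomp (A B R : cell C) : Prop := exists X : vcells C,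
  [/\ vcells_fst C X = A, vcells_snd C X = B & vcells_comp C X = R].

Definition cell_hcomp (A B R : cell C) : Prop := exists X : hcells C,
  [/\ hcells_fst C X = A, hcells_snd C X = B & hcells_comp P X = R].

Definition row_associator (A B E : row C) (R : cell C) : Prop :=
  exists X : row3 C, [/\ row3_fst C X = A, row3_snd C X = B,
    row3_thd C X = E & row3_assoc P X = R].

(** Inverting the relation retypes [B] over the right end of [A], so that a chain of relations
    becomes a chain of literally composable cospans. *)
Lemma row_compP (A B R : row C) : row_comp A B R ->
  exists z (g : cospan (row_r A) z),
  B = Row g /\ R = Row (cospan_comp P (row_c A) g).
Proof. by case=> X [<- <- <-]; exists (row2_3 X), (row2_23 X). Qed.

Lemma cell_vcompP (A B R : cell C) : cell_vcomp A B R ->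
  exists (t : cospan (cell_l A) (cell_r A))
    (b : cospan_map (ctgt (cell_c A)) t),
  B = Cell (Twocell b) /\
  R = Cell (Twocell (cospan_map_comp (cmor (cell_c A)) b)).
Proof. by case=> X [<- <- <-]; exists (pth2 (vc_c X)), (pth12 (vc_c X)). Qed.

(** For literally composable factors the witness is unique, so the relation computes its result. *)
Lemma cell_vcompE (x y : C) (f g h : cospan x y) (a : cospan_map f g)
    (b : cospan_map g h) (R : cell C) :
  cell_vcomp (Cell (Twocell a)) (Cell (Twocell b)) R ->
  R = Cell (Twocell (cospan_map_comp a b)).
Proof.
case=> X [e1 e2 <-].
by have -> : X = Vcells (Twopath a b) by apply: vcells_eq.
Qed.

Lemma cell_hcompP (A B R : cell C) : cell_hcomp A B R ->
  exists z (b : twocell (cell_r A) z),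
  B = Cell b /\ R = Cell (twocell_hcomp P (cell_c A) b).
Proof. by case=> X [<- <- <-]; exists (hc_3 X), (hc_23 X). Qed.

Lemma cell_hcompE (x y z : C) (a : twocell x y) (b : twocell y z) (R : cell C) :
  cell_hcomp (Cell a) (Cell b) R -> R = Cell (twocell_hcomp P a b).
Proof.
case=> X [e1 e2 <-].
by have -> : X = Hcells a b by apply: hcells_eq.
Qed.

Lemma row_associatorE (w x y z : C) (f : cospan w x) (g : cospan x y)
    (h : cospan y z) (R : cell C) :
  row_associator (Row f) (Row g) (Row h) R -> R = Cell (twocell_assoc P f g h).
Proof.
case=> X [e1 e2 e3 <-].
have -> // : X = Row3 f g h.
by apply: row3_eq; apply: row2_eq.
Qed.

Lemma cell_vcompA (A B E AB BE R R' : cell C) :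
  cell_vcomp A B AB -> cell_vcomp B E BE ->
  cell_vcomp A BE R -> cell_vcomp AB E R' -> R = R'.
Proof.
case: A => x y [f g a] /cell_vcompP /= [h [b [-> ->]]].
move=> /cell_vcompP /= [k [c [-> ->]]] /cell_vcompE -> /cell_vcompE ->.
apply: (f_equal (@cell_of _ _ _ _)); apply: cospan_map_ext; exact: compA.
Qed.

Lemma cell_vcomp1 (A R : cell C) :
  cell_vcomp (cell_of_id C (cell_src C A)) A R -> R = A.
Proof.
case: A => x y [f g a] /cell_vcompE ->.
apply: (f_equal (@cell_of _ _ _ _)); apply: cospan_map_ext; exact: comp1m.
Qed.

Lemma cell_vcompr1 (A R : cell C) :
  cell_vcomp A (cell_of_id C (cell_tgt C A)) R -> R = A.
Proof.
case: A => x y [f g a] /cell_vcompE ->.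
apply: (f_equal (@cell_of _ _ _ _)); apply: cospan_map_ext; exact: compm1.
Qed.

Lemma cell_hcomp_id (A B AB : row C) (R : cell C) :
  row_comp A B AB ->
  cell_hcomp (cell_of_id C A) (cell_of_id C B) R -> R = cell_of_id C AB.
Proof.
case: A => x y f /row_compP /= [z [g [-> ->]]] /cell_hcompE ->.
exact: (f_equal (@cell_of _ _ _ _) (hcomp_id2 (Cosp_bicat P) f g)).
Qed.

Lemma cell_interchange (A A' B B' AA' BB' AB AB' R R' : cell C) :
  cell_vcomp A A' AA' -> cell_vcomp B B' BB' ->
  cell_hcomp A B AB -> cell_hcomp A' B' AB' ->
  cell_hcomp AA' BB' R -> cell_vcomp AB AB' R' -> R = R'.
Proof.
case: A => x y [f f' a] /cell_vcompP /= [f'' [a' [-> ->]]] HB.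
case/cell_hcompP => /= z [[g g' b] [eB ->]]; subst B.
(* Only now, with the ends of [B] aligned with those of [A], can its vertical composite be
   inverted. *)
case/cell_vcompP: HB => /= g'' [b' [-> ->]].
move=> /cell_hcompE -> /cell_hcompE -> /cell_vcompE ->.
exact: (f_equal (@cell_of _ _ _ _) (hcomp_vcomp (Cosp_bicat P) a a' b b')).
Qed.

Lemma cell_assoc_nat (A B E AB BE AB_E A_BE S U R R' : cell C) :
  cell_hcomp A B AB -> cell_hcomp AB E AB_E ->
  cell_hcomp B E BE -> cell_hcomp A BE A_BE ->
  row_associator (cell_src C A) (cell_src C B) (cell_src C E) S ->
  row_associator (cell_tgt C A) (cell_tgt C B) (cell_tgt C E) U ->
  cell_vcomp AB_E U R -> cell_vcomp S A_BE R' -> R = R'.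
Proof.
case: A => w x [f f' a] /cell_hcompP /= [y [[g g' b] [-> ->]]].
case/cell_hcompP => /= z [[h h' c] [-> ->]].
move=> /cell_hcompE -> /cell_hcompE -> /row_associatorE -> /row_associatorE ->.
move=> /cell_vcompE -> /cell_vcompE ->.
exact: (f_equal (@cell_of _ _ _ _) (assoc_nat (Cosp_bicat P) a b c)).
Qed.

Lemma cell_lunit_nat (A X R R' : cell C) :
  cell_hcomp (cell_of_id C (row_of_id C (cell_left C A))) A X ->
  cell_vcomp X (row_lunit P (cell_tgt C A)) R ->
  cell_vcomp (row_lunit P (cell_src C A)) A R' -> R = R'.
Proof.
case: A => x y [f g a] /cell_hcompE -> /cell_vcompE -> /cell_vcompE ->.
exact: (f_equal (@cell_of _ _ _ _) (lunit_nat (Cosp_bicat P) a)).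
Qed.

Lemma cell_runit_nat (A X R R' : cell C) :
  cell_hcomp A (cell_of_id C (row_of_id C (cell_right C A))) X ->
  cell_vcomp X (row_runit P (cell_tgt C A)) R ->
  cell_vcomp (row_runit P (cell_src C A)) A R' -> R = R'.
Proof.
case: A => x y [f g a] /cell_hcompE -> /cell_vcompE -> /cell_vcompE ->.
exact: (f_equal (@cell_of _ _ _ _) (runit_nat (Cosp_bicat P) a)).
Qed.

Lemma row_pentagon (F G H K FG GH HK : row C)
    (A1 A2 A3 A4 A5 A1K FA3 A12 R R' : cell C) :
  row_comp F G FG -> row_comp G H GH -> row_comp H K HK ->
  row_associator F G H A1 -> row_associator F GH K A2 ->
  row_associator G H K A3 -> row_associator FG H K A4 ->
  row_associator F G HK A5 ->
  cell_hcomp A1 (cell_of_id C K) A1K -> cell_hcomp (cell_of_id C F) A3 FA3 ->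
  cell_vcomp A1K A2 A12 -> cell_vcomp A12 FA3 R -> cell_vcomp A4 A5 R' ->
  R = R'.
Proof.
case: F => v w f /row_compP /= [x [g [-> ->]]] /row_compP /= [y [h [-> ->]]].
case/row_compP => /= z [k [-> ->]].
do 5! move=> /row_associatorE ->.
move=> /cell_hcompE -> /cell_hcompE -> /cell_vcompE -> /cell_vcompE ->.
move=> /cell_vcompE ->.
exact: (f_equal (@cell_of _ _ _ _) (pentagon (Cosp_bicat P) f g h k)).
Qed.

Lemma row_triangle (F G FG : row C) (A X Y R : cell C) :
  row_comp F G FG ->
  row_associator F (row_of_id C (row_right C F)) G A ->
  cell_hcomp (cell_of_id C F) (row_lunit P G) X ->
  cell_hcomp (row_runit P F) (cell_of_id C G) Y ->
  cell_vcomp A X R -> R = Y.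
Proof.
case: F => x y f /row_compP /= [z [g [-> _]]] /row_associatorE ->.
move=> /cell_hcompE -> /cell_hcompE -> /cell_vcompE ->.
exact: (f_equal (@cell_of _ _ _ _) (triangle (Cosp_bicat P) f g)).
Qed.

(** Pointwise inverses of a natural cospan map are again natural, so exchanging source and target
    and choosing inverses gives a functor [G]. *)
Lemma cell_functor_inv (X : category) (PX : pushouts X)
    (F : functor X (cell_cat C)) :
  preserves_po F PX (cell_po P) -> (forall x, is_iso (cmor (cell_c (F x)))) ->
  exists G : functor X (cell_cat C), [/\ preserves_po G PX (cell_po P),
    functor_comp (cell_src C) G = functor_comp (cell_tgt C) F,
    functor_comp (cell_tgt C) G = functor_comp (cell_src C) F,
    forall x R, cell_vcomp (F x) (G x) R ->
      R = cell_of_id C (cell_src C (F x))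
  & forall x R, cell_vcomp (G x) (F x) R ->
      R = cell_of_id C (cell_tgt C (F x))].
Proof.
move=> HF iF.
pose ex x := constructive_indefinite_description _ (cospan_iso2 P (iF x)).
pose b x : cospan_map (ctgt (cell_c (F x))) (csrc (cell_c (F x))) :=
  proj1_sig (ex x).
have ab x : cospan_map_comp (cmor (cell_c (F x))) (b x) = cospan_map_id _.
  exact: (proj1 (proj2_sig (ex x))).
have ba x : cospan_map_comp (b x) (cmor (cell_c (F x))) = cospan_map_id _.
  exact: (proj2 (proj2_sig (ex x))).
move: b ab ba => {ex} b ab ba.
have nat x y (f : hom x y) : b x ;; sqs (cm_c (fmap F f))
    = sqt (cm_c (fmap F f)) ;; b y.
  have abE z : cmor (cell_c (F z)) ;; b z = idm _.
    exact: (f_equal (fun m : cospan_map _ _ => cmap m) (ab z)).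
  have baE z : b z ;; cmor (cell_c (F z)) = idm _.
    exact: (f_equal (fun m : cospan_map _ _ => cmap m) (ba z)).
  rewrite -[LHS]compm1 -abE -compA (compA (sqs _)) -sqc !compA baE comp1m.
  by [].
pose Go x := Cell (Twocell (b x)).
pose Gm x y (f : hom x y) : cell_map (Go x) (Go y) :=
  @CellMap C (Go x) (Go y) _ _ (@Tsquare C _ _ _ _ _ _
    (Twocell (b x)) (Twocell (b y)) _ _ (nat x y f)).
have Gm1 x : Gm x x (idm x) = cell_map_id (Go x).
  have e := fmap1 F x.
  apply: cell_map_ext.
  - exact: (f_equal (fun h : cell_map _ _ => cm_l h) e).
  - exact: (f_equal (fun h : cell_map _ _ => cm_r h) e).
  - exact: (f_equal (fun h : cell_map _ _ => smap (sqt (cm_c h))) e).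
  - exact: (f_equal (fun h : cell_map _ _ => smap (sqs (cm_c h))) e).
have GmM x y z (f : hom x y) (g : hom y z) :
    Gm x z (f ;; g) = cell_map_comp (Gm x y f) (Gm y z g).
  have e := fmapM F f g.
  apply: cell_map_ext.
  - exact: (f_equal (fun h : cell_map _ _ => cm_l h) e).
  - exact: (f_equal (fun h : cell_map _ _ => cm_r h) e).
  - exact: (f_equal (fun h : cell_map _ _ => smap (sqt (cm_c h))) e).
  - exact: (f_equal (fun h : cell_map _ _ => smap (sqs (cm_c h))) e).
pose G := @Functor X (cell_cat C) Go Gm Gm1 GmM.
have es : functor_comp (cell_src C) G = functor_comp (cell_tgt C) F.
  by strict_eq.
have et : functor_comp (cell_tgt C) G = functor_comp (cell_src C) F.
  by strict_eq.
exists G; split=> //.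
(* Source and target of [G] are those of [F] exchanged, and both preserve pushouts because [F]
   does. *)
- apply: cell_preserves; rewrite (es, et).
  + exact: preserves_po_comp HF (cell_tgt_po P).
  + exact: preserves_po_comp HF (cell_src_po P).
- move=> x R; rewrite /= /Go => H.
  rewrite (cell_vcompE H); exact: (f_equal (@cell_of _ _ _ _) (ab x)).
- move=> x R; rewrite /= /Go => H.
  rewrite (cell_vcompE H); exact: (f_equal (@cell_of _ _ _ _) (ba x)).
Qed.

End Cells.

(** * The double bicategory of double cospans *)

Section DoubleCospans.

Variables (C : category) (P : pushouts C).
Local Notation D := (TwoCosp P).

Lemma TwoCosp_Obj_bicat : is_bicat (Obj D).
Proof. exact: Cosp_bicat. Qed.

Lemma TwoCosp_Mor_bicat : is_bicat (Mor D).
Proof. exact: Cosp_bicat. Qed.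

Lemma TwoCosp_TwoMor_bicat : is_bicat (TwoMor D).
Proof. exact: Cosp_bicat. Qed.

Lemma TwoCosp_MorMor_bicat : is_bicat (MorMor D).
Proof. exact: Cosp_bicat. Qed.

Lemma TwoCosp_TwoVert_bicat : is_bicat (TwoVert D).
Proof. exact: Cosp_bicat. Qed.

Lemma TwoCosp_TwoHoriz_bicat : is_bicat (TwoHoriz D).
Proof. exact: Cosp_bicat. Qed.

Lemma TwoCosp_MorMorMor_bicat : is_bicat (MorMorMor D).
Proof. exact: Cosp_bicat. Qed.

Lemma TwoCosp_srcM_wf : is_weak_functor (srcM D).
Proof. exact: Cosp_functor_wf (row_left_po P). Qed.

Lemma TwoCosp_tgtM_wf : is_weak_functor (tgtM D).
Proof. exact: Cosp_functor_wf (row_right_po P). Qed.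

Lemma TwoCosp_srcO_wf : is_weak_functor (srcO D).
Proof. exact: Cosp_functor_wf (cell_left_po P). Qed.

Lemma TwoCosp_tgtO_wf : is_weak_functor (tgtO D).
Proof. exact: Cosp_functor_wf (cell_right_po P). Qed.

Lemma TwoCosp_srcT_wf : is_weak_functor (srcT D).
Proof. exact: Cosp_functor_wf (cell_src_po P). Qed.

Lemma TwoCosp_tgtT_wf : is_weak_functor (tgtT D).
Proof. exact: Cosp_functor_wf (cell_tgt_po P). Qed.

Lemma TwoCosp_idO_wf : is_weak_functor (idO D).
Proof. exact: Cosp_functor_wf (row_of_id_po P). Qed.

Lemma TwoCosp_idM_wf : is_weak_functor (idM D).
Proof. exact: Cosp_functor_wf (cell_of_id_po P). Qed.

Lemma TwoCosp_mm1_wf : is_weak_functor (mm1 D).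
Proof. exact: Cosp_functor_wf (row2_fst_po P). Qed.

Lemma TwoCosp_mm2_wf : is_weak_functor (mm2 D).
Proof. exact: Cosp_functor_wf (row2_snd_po P). Qed.

Lemma TwoCosp_compM_wf : is_weak_functor (compM D).
Proof. exact: Cosp_functor_wf (row2_comp_po P). Qed.

Lemma TwoCosp_vv1_wf : is_weak_functor (vv1 D).
Proof. exact: Cosp_functor_wf (vcells_fst_po P). Qed.

Lemma TwoCosp_vv2_wf : is_weak_functor (vv2 D).
Proof. exact: Cosp_functor_wf (vcells_snd_po P). Qed.

Lemma TwoCosp_compV_wf : is_weak_functor (compV D).
Proof. exact: Cosp_functor_wf (vcells_comp_po P). Qed.

Lemma TwoCosp_hh1_wf : is_weak_functor (hh1 D).
Proof. exact: Cosp_functor_wf (hcells_fst_po P). Qed.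

Lemma TwoCosp_hh2_wf : is_weak_functor (hh2 D).
Proof. exact: Cosp_functor_wf (hcells_snd_po P). Qed.

Lemma TwoCosp_compH_wf : is_weak_functor (compH D).
Proof. exact: Cosp_functor_wf (hcells_comp_po P). Qed.

Lemma TwoCosp_mmm1_wf : is_weak_functor (mmm1 D).
Proof. exact: Cosp_functor_wf (row3_fst_po P). Qed.

Lemma TwoCosp_mmm2_wf : is_weak_functor (mmm2 D).
Proof. exact: Cosp_functor_wf (row3_snd_po P). Qed.

Lemma TwoCosp_mmm3_wf : is_weak_functor (mmm3 D).
Proof. exact: Cosp_functor_wf (row3_thd_po P). Qed.

Lemma TwoCosp_assocM_wf : is_weak_functor (assocM D).
Proof. exact: Cosp_functor_wf (row3_assoc_po P). Qed.

Lemma TwoCosp_lunitM_wf : is_weak_functor (lunitM D).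
Proof. exact: Cosp_functor_wf (row_lunit_po P). Qed.

Lemma TwoCosp_runitM_wf : is_weak_functor (runitM D).
Proof. exact: Cosp_functor_wf (row_runit_po P). Qed.

Lemma TwoCosp_srcO_srcT : srcO D = srcM D ∘ srcT D.
Proof. by apply: esym; apply: Cosp_functor_triangle; strict_eq. Qed.

Lemma TwoCosp_srcO_tgtT : srcO D = srcM D ∘ tgtT D.
Proof. by apply: esym; apply: Cosp_functor_triangle; strict_eq. Qed.

Lemma TwoCosp_tgtO_srcT : tgtO D = tgtM D ∘ srcT D.
Proof. by apply: esym; apply: Cosp_functor_triangle; strict_eq. Qed.

Lemma TwoCosp_tgtO_tgtT : tgtO D = tgtM D ∘ tgtT D.
Proof. by apply: esym; apply: Cosp_functor_triangle; strict_eq. Qed.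

Lemma TwoCosp_srcM_idO : srcM D ∘ idO D = pid (Obj D).
Proof. by apply: Cosp_functor_section; strict_eq. Qed.

Lemma TwoCosp_tgtM_idO : tgtM D ∘ idO D = pid (Obj D).
Proof. by apply: Cosp_functor_section; strict_eq. Qed.

Lemma TwoCosp_srcT_idM : srcT D ∘ idM D = pid (Mor D).
Proof. by apply: Cosp_functor_section; strict_eq. Qed.

Lemma TwoCosp_tgtT_idM : tgtT D ∘ idM D = pid (Mor D).
Proof. by apply: Cosp_functor_section; strict_eq. Qed.

Lemma TwoCosp_tgtT_lunitM : tgtT D ∘ lunitM D = pid (Mor D).
Proof. by apply: Cosp_functor_section; strict_eq. Qed.

Lemma TwoCosp_tgtT_runitM : tgtT D ∘ runitM D = pid (Mor D).
Proof. by apply: Cosp_functor_section; strict_eq. Qed.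

Lemma TwoCosp_srcM_compM : srcM D ∘ compM D = srcM D ∘ mm1 D.
Proof. by apply: Cosp_functor_square; strict_eq. Qed.

Lemma TwoCosp_tgtM_compM : tgtM D ∘ compM D = tgtM D ∘ mm2 D.
Proof. by apply: Cosp_functor_square; strict_eq. Qed.

Lemma TwoCosp_srcT_compV : srcT D ∘ compV D = srcT D ∘ vv1 D.
Proof. by apply: Cosp_functor_square; strict_eq. Qed.

Lemma TwoCosp_tgtT_compV : tgtT D ∘ compV D = tgtT D ∘ vv2 D.
Proof. by apply: Cosp_functor_square; strict_eq. Qed.

Lemma TwoCosp_MorMor_pb : is_pullback (mm1 D) (mm2 D) (tgtM D) (srcM D).
Proof. exact: row2_pullback. Qed.

Lemma TwoCosp_TwoVert_pb : is_pullback (vv1 D) (vv2 D) (tgtT D) (srcT D).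
Proof. exact: vcells_pullback. Qed.

Lemma TwoCosp_TwoHoriz_pb : is_pullback (hh1 D) (hh2 D) (tgtO D) (srcO D).
Proof. exact: hcells_pullback. Qed.

End DoubleCospans.

(* The side conditions of being a bicategory or a weak 2-functor are left to automation from here
   on. *)
#[local] Hint Resolve
  TwoCosp_Obj_bicat TwoCosp_Mor_bicat TwoCosp_TwoMor_bicat TwoCosp_MorMor_bicat
  TwoCosp_TwoVert_bicat TwoCosp_TwoHoriz_bicat TwoCosp_MorMorMor_bicat
  TwoCosp_srcM_wf TwoCosp_tgtM_wf TwoCosp_srcO_wf TwoCosp_tgtO_wf
  TwoCosp_srcT_wf TwoCosp_tgtT_wf TwoCosp_idO_wf TwoCosp_idM_wf TwoCosp_mm1_wf
  TwoCosp_mm2_wf TwoCosp_compM_wf TwoCosp_vv1_wf TwoCosp_vv2_wf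
  TwoCosp_compV_wf TwoCosp_hh1_wf TwoCosp_hh2_wf TwoCosp_compH_wf
  TwoCosp_mmm1_wf TwoCosp_mmm2_wf TwoCosp_mmm3_wf TwoCosp_assocM_wf
  TwoCosp_lunitM_wf TwoCosp_runitM_wf
  pcomp_wf Cosp_bicat : core.

Section TwoCospLaws.

Variables (C : category) (P : pushouts C).
Local Notation D := (TwoCosp P).

Section Elements.

Variables (T : prebicat) (HT : is_bicat T).

Section Equations.

Variables (f : prefun T (Mor D)) (a : prefun T (TwoMor D)).

Lemma srcM_srcT : srcM D ∘ (srcT D ∘ a) = srcO D ∘ a.
Proof. by apply: pcomp_triangle_at; rewrite // -TwoCosp_srcO_srcT. Qed.

Lemma tgtM_srcT : tgtM D ∘ (srcT D ∘ a) = tgtO D ∘ a.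
Proof. by apply: pcomp_triangle_at; rewrite // -TwoCosp_tgtO_srcT. Qed.

Lemma srcT_idM_at : srcT D ∘ (idM D ∘ f) = f.
Proof. by apply: pcomp_section_at => //; exact: TwoCosp_srcT_idM. Qed.

Lemma tgtT_idM_at : tgtT D ∘ (idM D ∘ f) = f.
Proof. by apply: pcomp_section_at => //; exact: TwoCosp_tgtT_idM. Qed.

Lemma tgtT_lunitM_at : tgtT D ∘ (lunitM D ∘ f) = f.
Proof. by apply: pcomp_section_at => //; exact: TwoCosp_tgtT_lunitM. Qed.

Lemma tgtT_runitM_at : tgtT D ∘ (runitM D ∘ f) = f.
Proof. by apply: pcomp_section_at => //; exact: TwoCosp_tgtT_runitM. Qed.

End Equations.

Lemma compM_inv (f g h : prefun T (Mor D)) : is_compM f g h ->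
  [/\ is_weak_functor f, is_weak_functor g & is_weak_functor h] /\
  [/\ tgtM D ∘ f = srcM D ∘ g, srcM D ∘ h = srcM D ∘ f
    & tgtM D ∘ h = tgtM D ∘ g].
Proof.
case=> u [Hu <- <- <-]; split; first by split; auto.
split.
- by apply: is_pullback_comm; auto; exact: TwoCosp_MorMor_pb.
- by apply: pcomp_square_at; auto; exact: TwoCosp_srcM_compM.
- by apply: pcomp_square_at; auto; exact: TwoCosp_tgtM_compM.
Qed.

Lemma compM_ex (f g : prefun T (Mor D)) :
  is_weak_functor f -> is_weak_functor g -> tgtM D ∘ f = srcM D ∘ g ->
  exists h, is_compM f g h.
Proof.
move=> Hf Hg e.
have [u [Hu e1 e2]] := is_pullback_ex (TwoCosp_MorMor_pb P) HT Hf Hg e.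
by exists (compM D ∘ u), u.
Qed.

(** Factorization through the pullback is unique, so a composite is determined by its factors.
    Source and target equations below are obtained by comparing two composites of the same pair. *)
Lemma compM_fun (f g h h' : prefun T (Mor D)) :
  is_compM f g h -> is_compM f g h' -> h = h'.
Proof.
case=> u [Hu e1 e2 <-] [v [Hv e1' e2' <-]]; congr pcomp.
apply: (is_pullback_inj _ _ _ _ _ _ _ (TwoCosp_MorMor_pb P)) => //; auto.
- exact: etrans e1 (esym e1').
- exact: etrans e2 (esym e2').
Qed.

Lemma compV_inv (a b c : prefun T (TwoMor D)) : is_compV a b c ->
  [/\ is_weak_functor a, is_weak_functor b & is_weak_functor c] /\
  [/\ tgtT D ∘ a = srcT D ∘ b, srcT D ∘ c = srcT D ∘ a
    & tgtT D ∘ c = tgtT D ∘ b].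
Proof.
case=> u [Hu <- <- <-]; split; first by split; auto.
split.
- by apply: is_pullback_comm; auto; exact: TwoCosp_TwoVert_pb.
- by apply: pcomp_square_at; auto; exact: TwoCosp_srcT_compV.
- by apply: pcomp_square_at; auto; exact: TwoCosp_tgtT_compV.
Qed.

Lemma compV_ex (a b : prefun T (TwoMor D)) :
  is_weak_functor a -> is_weak_functor b -> tgtT D ∘ a = srcT D ∘ b ->
  exists c, is_compV a b c.
Proof.
move=> Ha Hb e.
have [u [Hu e1 e2]] := is_pullback_ex (TwoCosp_TwoVert_pb P) HT Ha Hb e.
by exists (compV D ∘ u), u.
Qed.

Lemma compH_inv (a b c : prefun T (TwoMor D)) : is_compH a b c ->
  [/\ is_weak_functor a, is_weak_functor b & is_weak_functor c] /\
  [/\ tgtO D ∘ a = srcO D ∘ b, is_compM (srcT D ∘ a) (srcT D ∘ b) (srcT D ∘ c)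
    & is_compM (tgtT D ∘ a) (tgtT D ∘ b) (tgtT D ∘ c)].
Proof.
case=> u [Hu <- <- <-]; split; first by split; auto.
split.
- by apply: is_pullback_comm; auto; exact: TwoCosp_TwoHoriz_pb.
(* The composable pair of sources is the image of [u] under the functor taking both source rows; the
   next item uses the target rows. *)
- have Hs := Cosp_functor_wf (hcells_src_po P).
  exists (Cosp_functor (hcells_src C) _ _ ∘ u); split.
  + by apply: pcomp_wf.
  + by apply: pcomp_square_at; auto; apply: Cosp_functor_square; strict_eq.
  + by apply: pcomp_square_at; auto; apply: Cosp_functor_square; strict_eq.
  + by apply: pcomp_square_at; auto; apply: Cosp_functor_square; strict_eq.
- have Hs := Cosp_functor_wf (hcells_tgt_po P).
  exists (Cosp_functor (hcells_tgt C) _ _ ∘ u); split.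
  + by apply: pcomp_wf.
  + by apply: pcomp_square_at; auto; apply: Cosp_functor_square; strict_eq.
  + by apply: pcomp_square_at; auto; apply: Cosp_functor_square; strict_eq.
  + by apply: pcomp_square_at; auto; apply: Cosp_functor_square; strict_eq.
Qed.

Lemma compH_ex (a b : prefun T (TwoMor D)) :
  is_weak_functor a -> is_weak_functor b -> tgtO D ∘ a = srcO D ∘ b ->
  exists c, is_compH a b c.
Proof.
move=> Ha Hb e.
have [u [Hu e1 e2]] := is_pullback_ex (TwoCosp_TwoHoriz_pb P) HT Ha Hb e.
by exists (compH D ∘ u), u.
Qed.

(** The witnesses of the two bracketings are images of [u] under [row3_compl] and [row3_compr]. *)
Lemma assocM_inv (f g h : prefun T (Mor D)) (a : prefun T (TwoMor D)) :
  is_assocM f g h a -> is_weak_functor a /\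
  exists fg gh, [/\ is_compM f g fg, is_compM g h gh,
    is_compM fg h (srcT D ∘ a) & is_compM f gh (tgtT D ∘ a)].
Proof.
case=> u [Hu <- <- <- <-]; split; first by auto.
have H1 := Cosp_functor_wf (row3_fst2_po P).
have H2 := Cosp_functor_wf (row3_snd2_po P).
have H3 := Cosp_functor_wf (row3_compl_po P).
have H4 := Cosp_functor_wf (row3_compr_po P).
exists (compM D ∘ (Cosp_functor (row3_fst2 C) (row3_po P) (row2_po P) ∘ u)).
exists (compM D ∘ (Cosp_functor (row3_snd2 C) (row3_po P) (row2_po P) ∘ u)).
split.
- exists (Cosp_functor (row3_fst2 C) (row3_po P) (row2_po P) ∘ u).
  split; auto; apply: pcomp_triangle_at; auto;
    by apply: Cosp_functor_triangle; strict_eq.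
- exists (Cosp_functor (row3_snd2 C) (row3_po P) (row2_po P) ∘ u).
  split; auto; apply: pcomp_triangle_at; auto;
    by apply: Cosp_functor_triangle; strict_eq.
- exists (Cosp_functor (row3_compl P) (row3_po P) (row2_po P) ∘ u).
  split; auto.
  + by apply: pcomp_square_at; auto; apply: Cosp_functor_square; strict_eq.
  + by apply: pcomp_triangle_at; auto; apply: Cosp_functor_triangle; strict_eq.
  + by apply: pcomp_square_at; auto; apply: Cosp_functor_square; strict_eq.
- exists (Cosp_functor (row3_compr P) (row3_po P) (row2_po P) ∘ u).
  split; auto.
  + by apply: pcomp_triangle_at; auto; apply: Cosp_functor_triangle; strict_eq.
  + by apply: pcomp_square_at; auto; apply: Cosp_functor_square; strict_eq.
  + by apply: pcomp_square_at; auto; apply: Cosp_functor_square; strict_eq.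
Qed.

Lemma srcT_lunitM_at (f : prefun T (Mor D)) : is_weak_functor f ->
  is_compM (idO D ∘ (srcM D ∘ f)) f (srcT D ∘ (lunitM D ∘ f)).
Proof.
move=> Hf; have H := Cosp_functor_wf (row_idl_po P).
exists (Cosp_functor (row_idl C) (row_po P) (row2_po P) ∘ f); split; auto.
- by apply: pcomp_square_at; auto; apply: Cosp_functor_square; strict_eq.
- by apply: pcomp_section_at; auto; apply: Cosp_functor_section; strict_eq.
- by apply: pcomp_square_at; auto; apply: Cosp_functor_square; strict_eq.
Qed.

Lemma srcT_runitM_at (f : prefun T (Mor D)) : is_weak_functor f ->
  is_compM f (idO D ∘ (tgtM D ∘ f)) (srcT D ∘ (runitM D ∘ f)).
Proof.
move=> Hf; have H := Cosp_functor_wf (row_idr_po P).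
exists (Cosp_functor (row_idr C) (row_po P) (row2_po P) ∘ f); split; auto.
- by apply: pcomp_section_at; auto; apply: Cosp_functor_section; strict_eq.
- by apply: pcomp_square_at; auto; apply: Cosp_functor_square; strict_eq.
- by apply: pcomp_square_at; auto; apply: Cosp_functor_square; strict_eq.
Qed.

End Elements.

(** * Laws on generalized elements *)

Section ElementLaws.

Variables (T : prebicat) (HT : is_bicat T).

Lemma compM_val (f g h : prefun T (Mor D)) (t : point T) :
  is_compM f g h -> row_comp P (val f t) (val g t) (val h t).
Proof.
by case=> u [_ <- <- <-]; exists (val u t); rewrite !val_comp.
Qed.

Lemma compV_val (a b c : prefun T (TwoMor D)) (t : point T) :
  is_compV a b c -> cell_vcomp (val a t) (val b t) (val c t).
Proof.
by case=> u [_ <- <- <-]; exists (val u t); rewrite !val_comp.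
Qed.

Lemma compH_val (a b c : prefun T (TwoMor D)) (t : point T) :
  is_compH a b c -> cell_hcomp P (val a t) (val b t) (val c t).
Proof.
by case=> u [_ <- <- <-]; exists (val u t); rewrite !val_comp.
Qed.

Lemma assocM_val (f g h : prefun T (Mor D)) (a : prefun T (TwoMor D))
    (t : point T) :
  is_assocM f g h a -> row_associator P (val f t) (val g t) (val h t) (val a t).
Proof.
by case=> u [_ <- <- <- <-]; exists (val u t); rewrite !val_comp.
Qed.

(** A composite [x] exists by the pullback property; the boundary equations and the comparison of
    values then identify [c] with [x] by [cell_prefun_ext]. *)
Lemma compV_intro (a b c : prefun T (TwoMor D)) :
  is_weak_functor a -> is_weak_functor b ->
  tgtT D ∘ a = srcT D ∘ b -> srcT D ∘ c = srcT D ∘ a ->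
  tgtT D ∘ c = tgtT D ∘ b ->
  (forall t R, cell_vcomp (val a t) (val b t) R -> R = val c t) ->
  is_compV a b c.
Proof.
move=> Ha Hb e es et ev; have [x Hx] := compV_ex HT Ha Hb e.
suff -> : c = x by [].
have [_ [_ es' et']] := compV_inv Hx.
apply: cell_prefun_ext; first by rewrite [LHS]es -es'.
  by rewrite [LHS]et -et'.
by move=> t; rewrite -(ev t _ (compV_val t Hx)).
Qed.

Lemma vsquare_intro (a b c d : prefun T (TwoMor D)) :
  is_weak_functor a -> is_weak_functor b ->
  is_weak_functor c -> is_weak_functor d ->
  tgtT D ∘ a = srcT D ∘ b -> tgtT D ∘ c = srcT D ∘ d ->
  srcT D ∘ a = srcT D ∘ c -> tgtT D ∘ b = tgtT D ∘ d ->
  (forall t R R', cell_vcomp (val a t) (val b t) R ->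
    cell_vcomp (val c t) (val d t) R' -> R = R') ->
  vsquare a b c d.
Proof.
move=> Ha Hb Hc Hd eab ecd es et ev; have [x Hx] := compV_ex HT Ha Hb eab.
exists x => //; have [_ [_ esx etx]] := compV_inv Hx.
apply: compV_intro => //.
- by rewrite esx.
- by rewrite etx.
- by move=> t R H; rewrite (ev t _ _ (compV_val t Hx) H).
Qed.

(** As for [compV_intro], except that source and target are themselves composites, identified by
    [compM_fun]. *)
Lemma compH_intro (a b c : prefun T (TwoMor D)) :
  is_weak_functor a -> is_weak_functor b ->
  tgtO D ∘ a = srcO D ∘ b ->
  is_compM (srcT D ∘ a) (srcT D ∘ b) (srcT D ∘ c) ->
  is_compM (tgtT D ∘ a) (tgtT D ∘ b) (tgtT D ∘ c) ->
  (forall t R, cell_hcomp P (val a t) (val b t) R -> R = val c t) ->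
  is_compH a b c.
Proof.
move=> Ha Hb e es et ev; have [x Hx] := compH_ex HT Ha Hb e.
suff -> : c = x by [].
have [_ [_ es' et']] := compH_inv Hx.
apply: cell_prefun_ext.
- exact: (compM_fun HT es es').
- exact: (compM_fun HT et et').
- by move=> t; rewrite -(ev t _ (compH_val t Hx)).
Qed.

Lemma TwoCosp_compV_assoc (a b c ab bc : prefun T (TwoMor D)) :
  is_compV a b ab -> is_compV b c bc -> vsquare a bc ab c.
Proof.
move=> Hab Hbc.
have [[Ha Hb Hab'] [e1 e2 e3]] := compV_inv Hab.
have [[_ Hc Hbc'] [e4 e5 e6]] := compV_inv Hbc.
apply: vsquare_intro => //.
- by rewrite e5.
- by rewrite e3.
- move=> t R R'.
  exact: (cell_vcompA (compV_val t Hab) (compV_val t Hbc)).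
Qed.

Lemma TwoCosp_compH_id (f g h : prefun T (Mor D)) :
  is_compM f g h -> is_compH (idM D ∘ f) (idM D ∘ g) (idM D ∘ h).
Proof.
move=> H; have [[Hf Hg Hh] [e _ _]] := compM_inv H.
apply: compH_intro; auto.
- by rewrite -tgtM_srcT -srcM_srcT !srcT_idM_at.
- by rewrite !srcT_idM_at.
- by rewrite !tgtT_idM_at.
- move=> t R; rewrite !val_comp.
  exact: (cell_hcomp_id (compM_val t H)).
Qed.

Lemma TwoCosp_interchange (a a' b b' aa' bb' ab a'b' : prefun T (TwoMor D)) :
  is_compV a a' aa' -> is_compV b b' bb' ->
  is_compH a b ab -> is_compH a' b' a'b' ->
  exists2 c, is_compH aa' bb' c & is_compV ab a'b' c.
Proof.
move=> Ha Hb Hab Hab'.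
have [[wa wa' waa'] [ea esa eta]] := compV_inv Ha.
have [[wb wb' wbb'] [eb esb etb]] := compV_inv Hb.
have [[_ _ wab] [e sab tab]] := compH_inv Hab.
have [[_ _ wab'] [e' sab' tab']] := compH_inv Hab'.
(* Vertical composites have the source rows of [a] and [b], hence the same ends over [Obj D], and so
   are horizontally composable. *)
have [] := compH_ex HT waa' wbb'.
  by rewrite -tgtM_srcT -srcM_srcT esa esb tgtM_srcT srcM_srcT.
move=> c Hc; exists c => //; have [_ [_ sc tc]] := compH_inv Hc.
apply: compV_intro => //.
- by apply: (compM_fun HT tab); rewrite ea eb.
- by apply: (compM_fun HT sc); rewrite esa esb.
- by apply: (compM_fun HT tc); rewrite eta etb.
- move=> t R H; apply: esym.
  exact: (cell_interchange (compV_val t Ha) (compV_val t Hb) (compH_val t Hab)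
    (compH_val t Hab') (compH_val t Hc) H).
Qed.

Lemma TwoCosp_srcT_assocM (f g h fg fgh : prefun T (Mor D))
    (a : prefun T (TwoMor D)) :
  is_assocM f g h a -> is_compM f g fg -> is_compM fg h fgh ->
  srcT D ∘ a = fgh.
Proof.
move=> Ha H H'; have [_ [x [y [Hx _ Hs _]]]] := assocM_inv Ha.
by apply: (compM_fun HT Hs); rewrite (compM_fun HT Hx H).
Qed.

Lemma TwoCosp_tgtT_assocM (f g h gh fgh : prefun T (Mor D))
    (a : prefun T (TwoMor D)) :
  is_assocM f g h a -> is_compM g h gh -> is_compM f gh fgh ->
  tgtT D ∘ a = fgh.
Proof.
move=> Ha H H'; have [_ [x [y [_ Hy _ Ht]]]] := assocM_inv Ha.
by apply: (compM_fun HT Ht); rewrite (compM_fun HT Hy H).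
Qed.

Lemma TwoCosp_assocM_nat (a b c ab bc ab_c a_bc s u : prefun T (TwoMor D)) :
  is_compH a b ab -> is_compH ab c ab_c ->
  is_compH b c bc -> is_compH a bc a_bc ->
  is_assocM (srcT D ∘ a) (srcT D ∘ b) (srcT D ∘ c) s ->
  is_assocM (tgtT D ∘ a) (tgtT D ∘ b) (tgtT D ∘ c) u ->
  vsquare ab_c u s a_bc.
Proof.
move=> Hab Hab_c Hbc Ha_bc Hs Hu.
have [_ [_ sab tab]] := compH_inv Hab.
have [[_ _ w1] [_ sab_c tab_c]] := compH_inv Hab_c.
have [_ [_ sbc tbc]] := compH_inv Hbc.
have [[_ _ w2] [_ sa_bc ta_bc]] := compH_inv Ha_bc.
have [ws _] := assocM_inv Hs; have [wu _] := assocM_inv Hu.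
apply: vsquare_intro => //.
- by rewrite (TwoCosp_srcT_assocM Hu tab tab_c).
- by rewrite (TwoCosp_tgtT_assocM Hs sbc sa_bc).
- by rewrite (TwoCosp_srcT_assocM Hs sab sab_c).
- by rewrite (TwoCosp_tgtT_assocM Hu tbc ta_bc).
- move=> t R R'; have Hst := assocM_val t Hs; have Hut := assocM_val t Hu.
  rewrite !val_comp in Hst Hut.
  exact: (cell_assoc_nat (compH_val t Hab) (compH_val t Hab_c)
    (compH_val t Hbc) (compH_val t Ha_bc) Hst Hut).
Qed.

Lemma TwoCosp_pentagonM (f g h k fg gh hk : prefun T (Mor D))
    (a1 a2 a3 a4 a5 a1k fa3 a1a2 : prefun T (TwoMor D)) :
  is_compM f g fg -> is_compM g h gh -> is_compM h k hk ->
  is_assocM f g h a1 -> is_assocM f gh k a2 -> is_assocM g h k a3 ->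
  is_assocM fg h k a4 -> is_assocM f g hk a5 ->
  is_compH a1 (idM D ∘ k) a1k -> is_compH (idM D ∘ f) a3 fa3 ->
  is_compV a1k a2 a1a2 -> vsquare a1a2 fa3 a4 a5.
Proof.
move=> Hfg Hgh Hhk H1 H2 H3 H4 H5 H1k Hf3 H12.
have [_ [x1 [y1 [X1 Y1 S1 T1]]]] := assocM_inv H1.
have [_ [x2 [y2 [X2 Y2 S2 T2]]]] := assocM_inv H2.
have [_ [x3 [y3 [X3 Y3 S3 T3]]]] := assocM_inv H3.
have [w4 [x4 [y4 [X4 Y4 S4 T4]]]] := assocM_inv H4.
have [w5 [x5 [y5 [X5 Y5 S5 T5]]]] := assocM_inv H5.
(* The intermediate composites produced by [assocM_inv] are identified with the given [fg], [gh] and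
   [hk]. *)
rewrite (compM_fun HT X1 Hfg) in S1; rewrite (compM_fun HT X3 Hgh) in S3.
rewrite (compM_fun HT Y3 Hhk) in T3.
rewrite (compM_fun HT Y4 Hhk) in T4; rewrite (compM_fun HT X5 Hfg) in S5.
have [[_ _ w1k] [_ s1k t1k]] := compH_inv H1k.
have [[_ _ wf3] [_ sf3 tf3]] := compH_inv Hf3.
have [[_ _ w12] [_ s12 t12]] := compV_inv H12.
rewrite !srcT_idM_at in s1k sf3; rewrite !tgtT_idM_at in t1k tf3.
apply: vsquare_intro => //.
- rewrite t12; apply: (compM_fun HT T2).
  by rewrite (compM_fun HT Y2 S3).
- exact: (compM_fun HT T4 S5).
- rewrite s12; apply: (compM_fun HT s1k).
  by rewrite (compM_fun HT S1 X4).
- apply: (compM_fun HT tf3).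
  by rewrite (compM_fun HT T3 Y5).
- move=> t R R'.
  have H1kt := compH_val t H1k; have Hf3t := compH_val t Hf3.
  rewrite !val_comp in H1kt Hf3t.
  exact: (row_pentagon (compM_val t Hfg) (compM_val t Hgh) (compM_val t Hhk)
    (assocM_val t H1) (assocM_val t H2) (assocM_val t H3) (assocM_val t H4)
    (assocM_val t H5) H1kt Hf3t (compV_val t H12)).
Qed.

Lemma TwoCosp_triangleM (f g : prefun T (Mor D))
    (a x y : prefun T (TwoMor D)) :
  is_assocM f (idO D ∘ (tgtM D ∘ f)) g a ->
  is_compH (idM D ∘ f) (lunitM D ∘ g) x ->
  is_compH (runitM D ∘ f) (idM D ∘ g) y -> is_compV a x y.
Proof.
move=> Ha Hx Hy.
have [wa [f' [g' [F G Sa Ta]]]] := assocM_inv Ha.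
have [[wf _ _] _] := compM_inv F; have [[_ wg _] [e _ _]] := compM_inv G.
(* Composability of [f] and [g] is read off the middle identity of the associator, whose two ends
   coincide. *)
have {}e : tgtM D ∘ f = srcM D ∘ g.
  rewrite -e; apply: esym; apply: pcomp_section_at; auto.
  exact: TwoCosp_tgtM_idO.
have [[_ _ wx] [_ sx tx]] := compH_inv Hx.
have [[_ _ wy] [_ sy ty]] := compH_inv Hy.
rewrite !srcT_idM_at in sx sy; rewrite !tgtT_idM_at in tx ty.
rewrite tgtT_lunitM_at in tx; rewrite tgtT_runitM_at in ty.
have Lg := srcT_lunitM_at wg; have Rf := srcT_runitM_at wf.
apply: compV_intro => //.
- apply: (compM_fun HT Ta).
  by rewrite e in G; rewrite (compM_fun HT G Lg).
- apply: (compM_fun HT sy).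
  by rewrite (compM_fun HT Rf F).
- exact: (compM_fun HT ty tx).
(* A composite of [f] and [g] is formed so that their composability is available at the point
   [t]. *)
- move=> t R; have [h Hfg] := compM_ex HT wf wg e.
  have Hat := assocM_val t Ha; have Hxt := compH_val t Hx.
  have Hyt := compH_val t Hy; rewrite !val_comp in Hat Hxt Hyt.
  exact: (row_triangle (compM_val t Hfg) Hat Hxt Hyt).
Qed.

End ElementLaws.

(** The law is stated at the universal element, the identity of [TwoMor D], so the element lemmas
    are used with [T] equal to [TwoMor D]. *)
Lemma TwoCosp_lunitM_nat (x : prefun (TwoMor D) (TwoMor D)) :
  is_compH (idM D ∘ (idO D ∘ srcO D)) (pid (TwoMor D)) x ->
  vsquare x (lunitM D ∘ tgtT D) (lunitM D ∘ srcT D) (pid (TwoMor D)).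
Proof.
move=> Hx; have HT := TwoCosp_TwoMor_bicat P.
have [[_ _ wx] [_ sx tx]] := compH_inv Hx.
have Ls := srcT_lunitM_at (TwoCosp_srcT_wf P).
have Lt := srcT_lunitM_at (TwoCosp_tgtT_wf P).
rewrite -TwoCosp_srcO_srcT in Ls; rewrite -TwoCosp_srcO_tgtT in Lt.
rewrite srcT_idM_at pcomp_pid in sx; auto.
rewrite tgtT_idM_at pcomp_pid in tx; auto.
apply: vsquare_intro => //; auto.
- exact: pid_wf.
- exact: (compM_fun HT tx Lt).
- by rewrite tgtT_lunitM_at pcomp_pid; auto.
- exact: (compM_fun HT sx Ls).
- by rewrite tgtT_lunitM_at pcomp_pid; auto.
- move=> t R R'; have := compH_val t Hx; rewrite !val_comp !val_Cosp_functor.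
  exact: cell_lunit_nat.
Qed.

Lemma TwoCosp_runitM_nat (x : prefun (TwoMor D) (TwoMor D)) :
  is_compH (pid (TwoMor D)) (idM D ∘ (idO D ∘ tgtO D)) x ->
  vsquare x (runitM D ∘ tgtT D) (runitM D ∘ srcT D) (pid (TwoMor D)).
Proof.
move=> Hx; have HT := TwoCosp_TwoMor_bicat P.
have [[_ _ wx] [_ sx tx]] := compH_inv Hx.
have Ls := srcT_runitM_at (TwoCosp_srcT_wf P).
have Lt := srcT_runitM_at (TwoCosp_tgtT_wf P).
rewrite -TwoCosp_tgtO_srcT in Ls; rewrite -TwoCosp_tgtO_tgtT in Lt.
rewrite srcT_idM_at pcomp_pid in sx; auto.
rewrite tgtT_idM_at pcomp_pid in tx; auto.
apply: vsquare_intro => //; auto.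
- exact: pid_wf.
- exact: (compM_fun HT tx Lt).
- by rewrite tgtT_runitM_at pcomp_pid; auto.
- exact: (compM_fun HT sx Ls).
- by rewrite tgtT_runitM_at pcomp_pid; auto.
- move=> t R R'; have := compH_val t Hx; rewrite !val_comp !val_Cosp_functor.
  exact: cell_runit_nat.
Qed.

Lemma Cosp_functor_invertible (X : category) (PX : pushouts X)
    (F : functor X (cell_cat C)) :
  preserves_po F PX (cell_po P) -> (forall x, is_iso (cmor (cell_c (F x)))) ->
  invertible (D := D) (Cosp_functor F PX (cell_po P)).
Proof.
move=> HF iF; have HX := Cosp_bicat PX.
have [G [HG es et FG GF]] := cell_functor_inv HF iF.
have wF := Cosp_functor_wf HF; have wG := Cosp_functor_wf HG.
have ets : tgtT D ∘ Cosp_functor F PX (cell_po P)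
    = srcT D ∘ Cosp_functor G PX (cell_po P).
  exact: Cosp_functor_square (esym es).
have est : tgtT D ∘ Cosp_functor G PX (cell_po P)
    = srcT D ∘ Cosp_functor F PX (cell_po P).
  exact: Cosp_functor_square et.
exists (Cosp_functor G PX (cell_po P)); split=> //; apply: compV_intro => //.
- exact: srcT_idM_at.
- by rewrite tgtT_idM_at.
- move=> t R; rewrite !val_comp !val_Cosp_functor; exact: FG.
- by rewrite srcT_idM_at.
- exact: tgtT_idM_at.
- move=> t R; rewrite !val_comp !val_Cosp_functor; exact: GF.
Qed.

(** The pairs [(u, v)] and [(v, w)] factor through [MorMor D] and share [v], so they glue along the
    middle row by [row3_pullback]. Uniqueness is tested first on the overlapping pairs and then on
    their components. *)
Lemma TwoCosp_MorMorMor_pb : is_triple_pullback (mmm1 D) (mmm2 D) (mmm3 D)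
  (tgtM D) (srcM D) (tgtM D) (srcM D).
Proof.
split; try by apply: Cosp_functor_square; strict_eq.
set p12 := Cosp_functor (row3_fst2 C) (row3_po P) (row2_po P).
set p23 := Cosp_functor (row3_snd2 C) (row3_po P) (row2_po P).
have w12 : is_weak_functor p12 := Cosp_functor_wf (row3_fst2_po P).
have w23 : is_weak_functor p23 := Cosp_functor_wf (row3_snd2_po P).
have e1 : mm1 D ∘ p12 = mmm1 D by apply: Cosp_functor_triangle; strict_eq.
have e2 : mm2 D ∘ p12 = mmm2 D by apply: Cosp_functor_triangle; strict_eq.
have e2' : mm1 D ∘ p23 = mmm2 D by apply: Cosp_functor_triangle; strict_eq.
have e3 : mm2 D ∘ p23 = mmm3 D by apply: Cosp_functor_triangle; strict_eq.
have pb3 : is_pullback p12 p23 (mm2 D) (mm1 D) := row3_pullback P.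
move=> T u v w HT Hu Hv Hw uv vw.
have [x [Hx xu xv]] := is_pullback_ex (TwoCosp_MorMor_pb P) HT Hu Hv uv.
have [y [Hy yv yw]] := is_pullback_ex (TwoCosp_MorMor_pb P) HT Hv Hw vw.
have [z [Hz zx zy]] := is_pullback_ex pb3 HT Hx Hy
  (etrans xv (esym yv)).
exists z; split.
  split=> //.
  - by rewrite -e1 pcompA ?zx; auto.
  - by rewrite -e2 pcompA ?zx; auto.
  - by rewrite -e3 pcompA ?zy; auto.
move=> z' [Hz' z1 z2 z3].
have E (h h' : prefun T (MorMor D)) :
    is_weak_functor h -> is_weak_functor h' ->
    mm1 D ∘ h = mm1 D ∘ h' -> mm2 D ∘ h = mm2 D ∘ h' -> h = h'.
  move=> *.
  by apply: (is_pullback_inj _ _ _ _ _ _ _ (TwoCosp_MorMor_pb P)); auto.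
have wm1 := TwoCosp_mm1_wf P; have wm2 := TwoCosp_mm2_wf P.
apply: (is_pullback_inj _ _ _ _ _ _ _ pb3); auto.
- rewrite zx; apply: E; auto.
  + by rewrite xu -pcompA ?e1; auto.
  + by rewrite xv -pcompA ?e2; auto.
- rewrite zy; apply: E; auto.
  + by rewrite yv -pcompA ?e2'; auto.
  + by rewrite yw -pcompA ?e3; auto.
Qed.

Lemma TwoCosp_compV_id_l :
  is_compV (idM D ∘ srcT D) (pid (TwoMor D)) (pid (TwoMor D)).
Proof.
apply: compV_intro; rewrite ?srcT_idM_at ?tgtT_idM_at ?pcomp_pid; auto.
- exact: pid_wf.
- by move=> t R; rewrite val_comp val_Cosp_functor; exact: cell_vcomp1.
Qed.

Lemma TwoCosp_compV_id_r :
  is_compV (pid (TwoMor D)) (idM D ∘ tgtT D) (pid (TwoMor D)).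
Proof.
apply: compV_intro; rewrite ?srcT_idM_at ?tgtT_idM_at ?pcomp_pid; auto.
- exact: pid_wf.
- by move=> t R; rewrite val_comp val_Cosp_functor; exact: cell_vcompr1.
Qed.

End TwoCospLaws.

Theorem theorem4p1p3 (C : category) (P : pushouts C) :
  is_double_bicat (TwoCosp P).
Proof.
have HT := TwoCosp_TwoMor_bicat P; have HM := TwoCosp_Mor_bicat P.
(* The projections of [TwoHoriz] are the universal composable pair, witnessed by the identity;
   inverting this instance gives the source and target laws of [compH]. *)
have HH : is_compH (hh1 (TwoCosp P)) (hh2 (TwoCosp P)) (compH (TwoCosp P)).
  by exists (pid _); split; rewrite ?pcomp_pid; auto; apply: pid_wf.
have [_ [_ sH tH]] := compH_inv HH.
split; auto.
- exact: TwoCosp_MorMor_pb.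
- exact: TwoCosp_TwoVert_pb.
- exact: TwoCosp_TwoHoriz_pb.
- exact: TwoCosp_MorMorMor_pb.
- exact: TwoCosp_srcO_srcT.
- exact: TwoCosp_srcO_tgtT.
- exact: TwoCosp_tgtO_srcT.
- exact: TwoCosp_tgtO_tgtT.
- exact: TwoCosp_srcM_idO.
- exact: TwoCosp_tgtM_idO.
- exact: TwoCosp_srcT_idM.
- exact: TwoCosp_tgtT_idM.
- exact: TwoCosp_srcM_compM.
- exact: TwoCosp_tgtM_compM.
- exact: TwoCosp_srcT_compV.
- exact: TwoCosp_tgtT_compV.
- by move=> T f g h fg fgh a HT'; exact: TwoCosp_srcT_assocM.
- by move=> T f g h gh fgh a HT'; exact: TwoCosp_tgtT_assocM.
- by have := srcT_lunitM_at (pid_wf HM); rewrite !pcomp_pid; auto.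
- exact: TwoCosp_tgtT_lunitM.
- by have := srcT_runitM_at (pid_wf HM); rewrite !pcomp_pid; auto.
- exact: TwoCosp_tgtT_runitM.
- exact: TwoCosp_compV_id_l.
- exact: TwoCosp_compV_id_r.
- by move=> T a b c ab bc HT'; exact: TwoCosp_compV_assoc.
- by move=> T f g h HT'; exact: TwoCosp_compH_id.
- by move=> T a a' b b' aa' bb' ab ab' HT'; exact: TwoCosp_interchange.
- by move=> T a b c ab bc ab_c a_bc s u HT'; exact: TwoCosp_assocM_nat.
- exact: TwoCosp_lunitM_nat.
- exact: TwoCosp_runitM_nat.
- apply: (Cosp_functor_invertible (row3_assoc_po P)) => A.
  exact: cospan_assoc_is_iso.
- apply: (Cosp_functor_invertible (row_lunit_po P)) => A.
  exact: cospan_lunit_is_iso.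
- apply: (Cosp_functor_invertible (row_runit_po P)) => A.
  exact: cospan_runit_is_iso.
- move=> T f g h k fg gh hk a1 a2 a3 a4 a5 a1k fa3 a1a2 HT'.
  exact: TwoCosp_pentagonM.
- by move=> T f g a x y HT'; exact: TwoCosp_triangleM.
Qed.
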